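(* Let $\xi\in\mathbb{R}$ satisfy $\xi=G(\xi)$. If $|G'(\xi)\phi_k|<1$ for all nonzero integers $k$ and $\sigma$ is large enough, then all the $k$th-order modes with $k\neq0$ of the linearization of the nonlinear Fokker-Planck equation around the stationary state $\rho_\xi$ are stable.
   Context: $L>0$ and $\sigma>0$ are constants; $[0,L]$ is regarded as a torus, with $\|x\|=\min(|x|,L-|x|)$. $G:\mathbb{R}\to\mathbb{R}$ is an odd smooth function. $\phi$ is a nonnegative influence function with $\frac{1}{L}\int_0^L\phi(\|x\|)\,dx=1$, and $\phi_k=\frac1L\int_0^L\phi(\|x\|)e^{i2\pi kx/L}dx$ for $k\in\mathbb{Z}$ (these are real with $|\phi_k|\le1$). The nonlinear Fokker-Planck equation is $$\frac{\partial \rho}{\partial t} = - u\frac{\partial \rho}{\partial x} - \frac{\partial}{\partial u}\left\{\left[G\left(\int_0^L\int_{-\infty}^\infty u'\phi(\|x'\|) \rho(t,x-x',u') du'dx' \right) - u \right] \rho\right\} + \frac{1}{2} \sigma^2 \frac{\partial^2 \rho}{\partial u^2},$$ periodic in $x$. For $\xi=G(\xi)$ it has the stationary state $\rho_\xi(x,u)=\frac1L F_\xi(u)$, $F_\xi(u)=\frac{1}{\sqrt{\pi\sigma^2}}\exp(-(u-\xi)^2/\sigma^2)$. Linearizing with $\rho=\rho_\xi+\rho^{(1)}$ and expanding $\rho^{(1)}(t,x,u)=\sum_{k\in\mathbb{Z}}\rho^{(1)}_k(t,u)e^{-i2\pi kx/L}$, the $k$th-order mode $\rho^{(1)}_k$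 satisfies $$\frac{\partial\rho_k^{(1)}}{\partial t} = \frac{i 2\pi k}{L} u \rho_k^{(1)} - \frac{\partial}{\partial u}\left[(\xi-u) \rho_k^{(1)}\right] - G'(\xi)\phi_k\left[\int_{-\infty}^\infty u'\rho_k^{(1)}(t,u') du'\right] F'_\xi(u) + \frac{1}{2} \sigma^2 \frac{\partial^2 \rho_k^{(1)}}{\partial u^2}.$$ Let $\hat\rho_k^{(1)}(t,\eta)=\int_{-\infty}^\infty\rho_k^{(1)}(t,u)e^{-i\eta u}du$. Initial conditions are assumed to satisfy $\|\hat\rho_k^{(1)}(0,\cdot)\|_{L^1}+\|\hat\rho_k^{(1)}(0,\cdot)\|_{L^\infty}+\|\partial_\eta\hat\rho_k^{(1)}(0,\cdot)\|_{L^\infty}<\infty$. The $k$th-order mode is called stable if (for such initial conditions) $$\sup_{t\ge0}\big\{\|\hat\rho_k^{(1)}(t,\cdot)\|_{L^1}+\|\hat\rho_k^{(1)}(t,\cdot)\|_{L^\infty}+\|\partial_\eta\hat\rho_k^{(1)}(t,\cdot)\|_{L^\infty}\big\}<\infty.$$ ''$\sigma$ large enough'' means $\sigma$ larger than a threshold, with $G,\xi,\phi,L$ fixed; the threshold is the same for all $k\ne0$. *)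

(* Defs.v *)
From HB Require Import structures.
From mathcomp Require Import all_boot all_order all_algebra.
From mathcomp Require Import complex.
From mathcomp Require Import all_classical all_reals all_analysis.

Set Implicit Arguments.
Unset Strict Implicit.
Unset Printing Implicit Defensive.

Import Order.TTheory GRing.Theory Num.Theory.
Import numFieldNormedType.Exports.

Local Open Scope classical_set_scope.
Local Open Scope ring_scope.
Local Open Scope complex_scope.

(* Complex-valued calculus in a real variable. The carrier of complex numbers
   is [R[i]]; differentiation, integration and continuity are taken on the
   real and imaginary parts. *)
Section ComplexValued.
Context {R : realType}.
Implicit Types (f : R -> R[i]) (D : set R).

Local Notation mu := (@lebesgue_measure R).

Definition cabs (z : R[i]) : R := ComplexField.Normc.normc z.

Definition cis (x : R) : R[i] := cos x +i* sin x.

Definition cderivable f (x : R) : Prop :=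
  derivable (fun y => complex.Re (f y)) x 1 /\
  derivable (fun y => complex.Im (f y)) x 1.

Definition cderive f (x : R) : R[i] :=
  derive1 (fun y => complex.Re (f y)) x +i*
  derive1 (fun y => complex.Im (f y)) x.

Definition cintegrable D f : Prop :=
  mu.-integrable D (fun x => (complex.Re (f x))%:E) /\
  mu.-integrable D (fun x => (complex.Im (f x))%:E).

Definition cintegral D f : R[i] :=
  (\int[mu]_(x in D) complex.Re (f x)) +i*
  (\int[mu]_(x in D) complex.Im (f x)).

Definition ccontinuous_at2 (g : R -> R -> R[i]) (t u : R) : Prop :=
  {for (t, u), continuous (fun p : R * R => complex.Re (g p.1 p.2))} /\
  {for (t, u), continuous (fun p : R * R => complex.Im (g p.1 p.2))}.

Definition cLnorm (p : \bar R) f : \bar R :=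
  Lnorm mu p (fun x => (cabs (f x))%:E).

Definition fourier f (eta : R) : R[i] :=
  cintegral setT (fun u => f u * cis (- (eta * u))).

End ComplexValued.

Section Model.
Context {R : realType}.

Local Notation mu := (@lebesgue_measure R).

Definition smooth (G : R -> R) : Prop :=
  forall n x, derivable (derive1n n G) x 1.

Definition torus_norm (L x : R) : R := Num.min `|x| (L - `|x|).

(* The influence function is only ever evaluated at distances, hence the
   restriction of nonnegativity to nonnegative arguments. *)
Definition influence_function (L : R) (phi : R -> R) : Prop :=
  [/\ forall r, 0 <= r -> 0 <= phi r,
      mu.-integrable `[0, L]
        (fun x => (phi (torus_norm L x))%:E) &
      L^-1 * \int[mu]_(x in `[0, L]) phi (torus_norm L x) = 1].

Definition phi_coef (L : R) (phi : R -> R) (k : int) : R[i] :=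
  (L^-1)%:C *
  cintegral `[0, L]
    (fun x => (phi (torus_norm L x))%:C * cis (2 * pi * k%:~R * x / L)).

Definition F_ (sigma xi u : R) : R :=
  (Num.sqrt (pi * sigma ^+ 2))^-1 * expR (- (u - xi) ^+ 2 / sigma ^+ 2).

Definition mode_equation (L sigma : R) (G phi : R -> R) (xi : R) (k : int)
    (rho : R -> R -> R[i]) (t u : R) : Prop :=
  cderive (fun s => rho s u) t =
    (0 +i* 1) * (2 * pi * k%:~R / L)%:C * u%:C * rho t u
    - cderive (fun v => (xi - v)%:C * rho t v) u
    - (derive1 G xi)%:C * phi_coef L phi k
      * cintegral setT (fun v => v%:C * rho t v)
      * (derive1 (F_ sigma xi) u)%:C
    + (2^-1 * sigma ^+ 2)%:C * cderive (cderive (rho t)) u.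

(* Classical solutions of the Cauchy problem on [0, +oo[: of class C^{1,2} for
   t > 0, and a continuous curve in the weighted space L^1((1 + |u|) du) for
   t >= 0. The weight is what makes the first moment in the equation and the
   eta-derivative of the Fourier transform meaningful; continuity at t = 0 is
   the sense in which the initial condition [rho 0] is attained. *)
Definition mode_solution (L sigma : R) (G phi : R -> R) (xi : R) (k : int)
    (rho : R -> R -> R[i]) : Prop :=
  [/\ (forall t, 0 <= t ->
         cintegrable setT (rho t) /\
         cintegrable setT (fun u => u%:C * rho t u)),
      (forall t0, 0 <= t0 ->
         (\int[mu]_u
             ((1 + `|u|) * cabs (rho t u - rho t0 u))%:E)%E
           @[t --> within [set t | 0 <= t] (nbhs t0)] --> 0%E),
      (forall t u, 0 < t ->
         [/\ cderivable (fun s => rho s u) t,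
             cderivable (rho t) u &
             cderivable (cderive (rho t)) u]),
      (forall t u, 0 < t ->
         [/\ ccontinuous_at2 (fun s v => cderive (fun r => rho r v) s) t u,
             ccontinuous_at2 (fun s v => cderive (rho s) v) t u &
             ccontinuous_at2 (fun s v => cderive (cderive (rho s)) v) t u]) &
      (forall t u, 0 < t -> mode_equation L sigma G phi xi k rho t u)].

Definition mode_norm (f : R -> R[i]) : \bar R :=
  (cLnorm 1 (fourier f) + cLnorm +oo (fourier f)
   + cLnorm +oo (cderive (fourier f)))%E.

Definition mode_stable (L sigma : R) (G phi : R -> R) (xi : R) (k : int)
    : Prop :=
  forall rho : R -> R -> R[i],
    mode_solution L sigma G phi xi k rho ->
    (mode_norm (rho 0%R) < +oo)%E ->
    (ereal_sup [set mode_norm (rho t) | t in [set t : R | (0 <= t)%R]] < +oo)%E.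

End Model.

(* Main.v *)
Require Import Defs.
From mathcomp Require Import all_boot all_order all_algebra.
From mathcomp Require Import complex.
From mathcomp Require Import all_classical all_reals all_analysis.
From mathcomp Require Import measurable_realfun ess_sup_inf.
From mathcomp Require Import ring lra.

Import Order.TTheory GRing.Theory Num.Theory.
Import numFieldNormedType.Exports.

Local Open Scope classical_set_scope.
Local Open Scope ring_scope.
Local Open Scope complex_scope.

Set Implicit Arguments.
Unset Strict Implicit.
Unset Printing Implicit Defensive.

(** Why the modes are stable.

Write [a = 2 pi k / L], [c = G'(xi) phi_k] and [m(s) = int u rho(s, u) du].
Without its source [- c m(s) F'(u)], the mode equation is a linear
Fokker-Planck equation with the transport term [i a u rho].  The backward
adjoint equation of that linear part sends plane waves to plane waves: the
solution [w] that equals [exp (- i eta u)] at time [t] is, at time [s < t], a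
scalar multiple of [exp (- i q u)] with
[q = (eta + a) exp (- (t - s)) - a], and the modulus of the scalar is
[exp (- sigma^2 / 2 * int_s^t q^2)].  As [t - s] grows, the frequency [q] tends
to [- a <> 0], so the wave is damped at the rate
[A = sigma^2 a^2 / 2].  Along such a wave only the source acts:
[d/ds int rho w = - c m(s) int F' w], and the Gaussian integral [int F' w] is
explicit and carries the further factor [exp (- sigma^2 q^2 / 4)]
(lemma [dgauss_wave]).

The feedback comes from [m].  Differentiating the wave in [eta] at [eta = 0]
gives a test function that computes [m(T)], so [m(T)] is controlled by the
initial datum plus the supremum of [m] times the mass of the kernel
[exp (- A (tau - p)) (exp (- tau) + A p^2 + |xi a| p)], [p = 1 - exp (- tau)].
This kernel lives on times of order [1 / (sigma |a|)], and so does its mass.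
As [|a| >= 2 pi / L] for every nonzero [k], one threshold on [sigma] makes the
mass small for all modes at once ([noise_threshold]), and [m] is bounded
([moment_bound]).  With [m] bounded, the waves with arbitrary [eta] bound
[rho^ (t, eta)] and its derivative uniformly; the Gaussian factor makes the
contribution of the source integrable in [eta], while the initial datum
contributes [rho^ (0, q)] times the damping, which absorbs the Jacobian
[exp t] of [eta |-> q] as soon as [A >= 1] ([fpart_bound],
[mode_norm_bounded]).

A classical solution comes with no decay of its derivatives in [u].  The
pairing with [w] is therefore first truncated by a polynomial cutoff on
[[-N, N]]; the truncation errors vanish as [N] grows, uniformly for [s] in
[[0, T]], because [s |-> rho(s)] is continuous into [L^1 ((1 + |u|) du)] and
[[0, T]] is compact.  The integral form of the variation of constants is
avoided altogether: if the derivative in [s] of the pairing is at most [P'(s)]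
in absolute value, then the pairing changes by at most [P(T) - P(0)]
([duality_estimate]), and every kernel met here has an explicit antiderivative.

Complex quantities are split into real and imaginary parts.  Multiplying a wave
by [- i] shifts its phase by [pi / 2], so one family of real waves, indexed by a
phase [de], serves for both parts. *)

(** * Derivatives and continuity of explicit functions *)

Section Calculus.
Context {R : realType}.
Implicit Types (f g : R -> R) (x c : R).

(** These rules restate those of the library for functions written pointwise,
so that a tactic can choose the rule from the head symbol alone.  Leaving the
choice to unification is prohibitively slow on the waves below. *)
Lemma deriv_cst c x : is_derive x 1 (fun=> c) 0.
Proof. exact: is_derive_cst. Qed.

Lemma deriv_id x : is_derive x 1 (fun y : R => y) 1.
Proof. exact: is_derive_id. Qed.

Lemma deriv_add f g x df dg : is_derive x 1 f df -> is_derive x 1 g dg ->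
  is_derive x 1 (fun y => f y + g y) (df + dg).
Proof. by move=> *; exact: is_deriveD. Qed.

Lemma deriv_opp f x df : is_derive x 1 f df -> is_derive x 1 (fun y => - f y) (- df).
Proof. by move=> *; exact: is_deriveN. Qed.

Lemma deriv_mul f g x df dg : is_derive x 1 f df -> is_derive x 1 g dg ->
  is_derive x 1 (fun y => f y * g y) (f x * dg + g x * df).
Proof. by move=> *; exact: is_deriveM. Qed.

Lemma deriv_exp f n x df : is_derive x 1 f df ->
  is_derive x 1 (fun y => f y ^+ n.+1) (n.+1%:R * f x ^+ n * df).
Proof.
move=> h; rewrite (_ : (fun y => f y ^+ n.+1) = f ^+ n.+1); last first.
  by apply/funext => y; rewrite fctE.
apply: is_derive_eq; by rewrite /GRing.scale /= mulr_natl.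
Qed.

Lemma deriv_expR f x df : is_derive x 1 f df ->
  is_derive x 1 (fun y => expR (f y)) (expR (f x) * df).
Proof. by move=> *; apply: (@is_derive1_comp R expR f). Qed.

Lemma deriv_cos f x df : is_derive x 1 f df ->
  is_derive x 1 (fun y => cos (f y)) (- sin (f x) * df).
Proof. by move=> *; apply: (@is_derive1_comp R cos f). Qed.

Lemma deriv_sin f x df : is_derive x 1 f df ->
  is_derive x 1 (fun y => sin (f y)) (cos (f x) * df).
Proof. by move=> *; apply: (@is_derive1_comp R sin f). Qed.

Lemma deriv_atan f x df : is_derive x 1 f df ->
  is_derive x 1 (fun y => atan (f y)) ((1 + f x ^+ 2)^-1 * df).
Proof. by move=> *; apply: (@is_derive1_comp R atan f). Qed.

Lemma deriv_cont f x df : is_derive x 1 f df -> {for x, continuous f}.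
Proof.
move=> [h _]; apply: differentiable_continuous; exact/derivable1_diffP.
Qed.

Lemma deriv_conv f x df dg : is_derive x 1 f df -> df = dg -> is_derive x 1 f dg.
Proof. by move=> + <-. Qed.

End Calculus.

Ltac deriv_step :=
  lazymatch goal with
  | |- is_derive ?x _ ?f _ =>
    lazymatch f with
    | (fun _ => ?c) => notypeclasses refine (deriv_cst c x)
    | (fun y => y) => notypeclasses refine (deriv_id x)
    | (fun y => (@?a y + @?b y)%R) => notypeclasses refine (@deriv_add _ a b x _ _ _ _); cbv beta
    | (fun y => (- (@?a y))%R) => notypeclasses refine (@deriv_opp _ a x _ _); cbv beta
    | (fun y => (@?a y ^+ (S ?n))%R) => notypeclasses refine (@deriv_exp _ a n x _ _); cbv beta
    | (fun y => (@?a y * @?b y)%R) => notypeclasses refine (@deriv_mul _ a b x _ _ _ _); cbv beta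
    | (fun y => expR (@?a y)) => notypeclasses refine (@deriv_expR _ a x _ _); cbv beta
    | (fun y => cos (@?a y)) => notypeclasses refine (@deriv_cos _ a x _ _); cbv beta
    | (fun y => sin (@?a y)) => notypeclasses refine (@deriv_sin _ a x _ _); cbv beta
    | (fun y => atan (@?a y)) => notypeclasses refine (@deriv_atan _ a x _ _); cbv beta
    | _ => eassumption
    end
  end.
(** The remaining goal equates the derivative computed by the rules with the
announced one. *)
Ltac deriv := notypeclasses refine (deriv_conv _ _); [repeat deriv_step|cbv beta].

Section Continuity.
Context {R : realType} {T : topologicalType}.
Implicit Types (f g : T -> R) (x : T).

Lemma cont_cst (c : R) x : {for x, continuous (fun=> c : R)}.
Proof. exact: cst_continuous. Qed.

Lemma cont_add f g x : {for x, continuous f} -> {for x, continuous g} ->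
  {for x, continuous (fun y => f y + g y)}.
Proof. by move=> hf hg; exact: (cvgD hf hg). Qed.

Lemma cont_opp f x : {for x, continuous f} -> {for x, continuous (fun y => - f y)}.
Proof. by move=> hf; exact: (cvgN hf). Qed.

Lemma cont_mul f g x : {for x, continuous f} -> {for x, continuous g} ->
  {for x, continuous (fun y => f y * g y)}.
Proof. by move=> hf hg; exact: (cvgM hf hg). Qed.

Lemma cont_comp (h : R -> R) f x : continuous h -> {for x, continuous f} ->
  {for x, continuous (fun y => h (f y))}.
Proof. by move=> hh hf; apply: (@continuous_comp _ _ _ f h) => //; exact: hh. Qed.

Lemma cont_exp f n x : {for x, continuous f} -> {for x, continuous (fun y => f y ^+ n)}.
Proof. by move=> hf; apply: (@cont_comp (fun y => y ^+ n)) => //; exact: exprn_continuous. Qed.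

Lemma cont_expR f x : {for x, continuous f} -> {for x, continuous (fun y => expR (f y))}.
Proof. by apply: cont_comp; exact: continuous_expR. Qed.

Lemma cont_cos f x : {for x, continuous f} -> {for x, continuous (fun y => cos (f y))}.
Proof. by apply: cont_comp; exact: continuous_cos. Qed.

Lemma cont_sin f x : {for x, continuous f} -> {for x, continuous (fun y => sin (f y))}.
Proof. by apply: cont_comp; exact: continuous_sin. Qed.

Lemma cont_norm f x : {for x, continuous f} -> {for x, continuous (fun y => `|f y|)}.
Proof. by move=> hf; exact: (cvg_norm hf). Qed.

Lemma cont_inv f x : f x != 0 -> {for x, continuous f} -> {for x, continuous (fun y => (f y)^-1)}.
Proof. by move=> f0 hf; exact: (cvgV f0 hf). Qed.

End Continuity.

Lemma cont_id (R : realType) (x : R) : {for x, continuous (fun y : R => y)}.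
Proof. exact: cvg_id. Qed.

Lemma cont_fst (R : realType) (x : R * R) : {for x, continuous (fun p : R * R => p.1)}.
Proof. exact: cvg_fst. Qed.

Lemma cont_snd (R : realType) (x : R * R) : {for x, continuous (fun p : R * R => p.2)}.
Proof. exact: cvg_snd. Qed.

Ltac cont_step :=
  lazymatch goal with
  | |- {for ?x, continuous ?f} =>
    lazymatch f with
    | (fun _ => ?c) => notypeclasses refine (@cont_cst _ _ c x)
    | (fun y => y) => notypeclasses refine (@cont_id _ x)
    | (fun y => (y.1)%R) => notypeclasses refine (@cont_fst _ x)
    | (fun y => (y.2)%R) => notypeclasses refine (@cont_snd _ x)
    | (fun y => (@?a y + @?b y)%R) => notypeclasses refine (@cont_add _ _ a b x _ _); cbv beta
    | (fun y => (- (@?a y))%R) => notypeclasses refine (@cont_opp _ _ a x _); cbv beta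
    | (fun y => (@?a y ^+ ?n)%R) => notypeclasses refine (@cont_exp _ _ a n x _); cbv beta
    | (fun y => (@?a y * @?b y)%R) => notypeclasses refine (@cont_mul _ _ a b x _ _); cbv beta
    | (fun y => expR (@?a y)) => notypeclasses refine (@cont_expR _ _ a x _); cbv beta
    | (fun y => cos (@?a y)) => notypeclasses refine (@cont_cos _ _ a x _); cbv beta
    | (fun y => sin (@?a y)) => notypeclasses refine (@cont_sin _ _ a x _); cbv beta
    | (fun y => `|@?a y|%R) => notypeclasses refine (@cont_norm _ _ a x _); cbv beta
    | _ => eassumption
    end
  end.
Ltac cont := repeat cont_step.

(** * Real-valued Lebesgue integrals *)

Section Integral.
Context {R : realType}.
Local Notation mu := (@lebesgue_measure R).
Local Notation Rintegrable D f := (mu.-integrable D (EFin \o f)).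
Local Notation mble D := (@measurable _ (measurableTypeR R) D).
Implicit Types (f g : R -> R) (D : set R).

Lemma Rintegrable_add D f g : mble D -> Rintegrable D f -> Rintegrable D g -> Rintegrable D (fun x => f x + g x).
Proof.
move=> mD hf hg; have h := integrableD mD hf hg.
by apply: eq_integrable h.
Qed.

Lemma Rintegrable_sub D f g : mble D -> Rintegrable D f -> Rintegrable D g -> Rintegrable D (fun x => f x - g x).
Proof.
move=> mD hf hg; have h := integrableB mD hf hg.
by apply: eq_integrable h.
Qed.

Lemma Rintegrable_mull D (c : R) f : mble D -> Rintegrable D f -> Rintegrable D (fun x => c * f x).
Proof.
move=> mD hf; have h := integrableZl mD c hf.
by apply: eq_integrable h.
Qed.

Lemma Rintegrable_abs D f : mble D -> Rintegrable D f -> Rintegrable D (fun x => `|f x|).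
Proof. move=> mD hf; exact: (integrable_norm hf). Qed.

Lemma Rintegrable_meas D f : mble D -> Rintegrable D f -> measurable_fun D f.
Proof. by move=> mD /measurable_int /measurable_EFinP. Qed.

Lemma Rintegrable_le D f g : mble D -> measurable_fun D f ->
  (forall x, D x -> `|f x| <= g x) -> Rintegrable D g -> Rintegrable D f.
Proof.
move=> mD mf fg ig; apply: (le_integrable mD _ _ ig).
  exact/measurable_EFinP.
by move=> x Dx /=; rewrite lee_fin (le_trans (fg x Dx))// ler_norm.
Qed.

Lemma Rintegrable_cont (a b : R) f : continuous f -> Rintegrable `[a, b] f.
Proof.
move=> cf; apply: continuous_compact_integrable; first exact: segment_compact.
exact: continuous_subspaceT.
Qed.

Lemma Rintegrable_sub_set D f : mble D -> Rintegrable setT f -> Rintegrable D f.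
Proof. by move=> mD; apply: integrableS. Qed.

Lemma meas_cont D f : mble D -> continuous f -> measurable_fun D f.
Proof.
move=> mD cf; apply: subspace_continuous_measurable_fun => //; exact: continuous_subspaceT.
Qed.

Lemma Rint_le D f g : mble D -> Rintegrable D f -> Rintegrable D g ->
  (forall x, D x -> f x <= g x) -> \int[mu]_(x in D) f x <= \int[mu]_(x in D) g x.
Proof. move=> *; exact: le_Rintegral. Qed.

Lemma Rint_abs_le D f g : mble D -> Rintegrable D f -> Rintegrable D g ->
  (forall x, D x -> `|f x| <= g x) -> `|\int[mu]_(x in D) f x| <= \int[mu]_(x in D) g x.
Proof.
move=> mD hf hg fg; apply: le_trans (le_normr_Rintegral mD hf) _.
by apply: Rint_le => //; exact: Rintegrable_abs.
Qed.

Lemma Rint_subset_le D g : mble D -> Rintegrable setT g ->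
  (forall x, 0 <= g x) -> \int[mu]_(x in D) g x <= \int[mu]_x g x.
Proof.
move=> mD hg g0; rewrite fine_le//.
- by apply: integrable_fin_num => //; exact: Rintegrable_sub_set.
- exact: integrable_fin_num.
- apply: ge0_subset_integral => //; first by case/integrableP: hg.
  by move=> x _; rewrite lee_fin.
Qed.

Lemma Rint_ge0 D f : (forall x, D x -> 0 <= f x) -> 0 <= \int[mu]_(x in D) f x.
Proof. by move=> h; exact: (@Rintegral_ge0 _ (measurableTypeR R) R mu D f h). Qed.

Lemma Rint_eq D f g : (forall x, D x -> f x = g x) ->
  \int[mu]_(x in D) f x = \int[mu]_(x in D) g x.
Proof. by move=> h; apply: eq_Rintegral => x /set_mem /h. Qed.

Lemma Rint_mkcond D f : \int[mu]_(x in D) f x = \int[mu]_x (f x * \1_D x).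
Proof.
rewrite Rintegral_mkcond; apply: Rint_eq => x _.
by rewrite patchE indicE; case: ifP => _; rewrite ?mulr1 ?mulr0.
Qed.

Lemma Rint_dominated D (f_ : nat -> R -> R) f g : mble D ->
  (forall n, measurable_fun D (f_ n)) -> Rintegrable D f -> Rintegrable D g ->
  (forall x, D x -> f_ ^~ x @ \oo --> f x) ->
  (forall n x, D x -> `|f_ n x| <= g x) ->
  (fun n => \int[mu]_(x in D) f_ n x) @ \oo --> \int[mu]_(x in D) f x.
Proof.
move=> mD mf hf hg cf fg.
have h1 n : measurable_fun D (fun x => (f_ n x)%:E) by exact/measurable_EFinP.
have h2 : {ae mu, forall x, D x -> (fun n => (f_ n x)%:E) @ \oo --> (f x)%:E}.
  by apply: aeW => x Dx; apply: cvg_EFin; [exact: nearW|exact: cf].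
have h3 : {ae mu, forall x, forall n, D x -> (`|(f_ n x)%:E| <= (g x)%:E)%E}.
  by apply: aeW => x n Dx; rewrite lee_fin fg.
have [_ _ h] := dominated_convergence mD h1 (measurable_int mu hf) h2 hg h3.
rewrite /Rintegral; apply: fine_cvg; rewrite fineK//.
exact: integrable_fin_num.
Qed.

Lemma FTC_seg (F f : R -> R) (a b : R) : a < b -> (forall x : R, is_derive x 1 F (f x)) ->
  continuous f -> \int[mu]_(x in `[a, b]) f x = F b - F a.
Proof.
move=> ab dF cf; rewrite /Rintegral (@continuous_FTC2 _ f F)//.
- exact: continuous_subspaceT.
- split.
  + by move=> x _; case: (dF x).
  + exact/cvg_at_right_filter/(deriv_cont (dF a)).
  + exact/cvg_at_left_filter/(deriv_cont (dF b)).
- by move=> x _; rewrite derive1E; have [_ ->] := dF x.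
Qed.

(** Decay of the primitive along the integers [n] and [- n] is enough, because
the integral over the line is the limit of those over [[-n, n]]. *)
Lemma FTC_line (F f : R -> R) : (forall x : R, is_derive x 1 F (f x)) -> continuous f ->
  Rintegrable setT f -> F n.+1%:R @[n --> \oo] --> (0 : R) -> F (- n.+1%:R) @[n --> \oo] --> (0 : R) ->
  \int[mu]_x f x = 0.
Proof.
move=> dF cf hf F1 F2.
pose D (n : nat) := `[- n.+1%:R, n.+1%:R : R]%classic.
have h : (fun n => \int[mu]_x (f x * \1_(D n) x)) @ \oo --> \int[mu]_x f x.
  apply: (@Rint_dominated _ _ _ (fun x => `|f x|)) => //.
  - move=> n; apply: measurable_funM; first exact: meas_cont.
    by apply: measurable_indic; exact: measurable_itv.
  - exact: Rintegrable_abs.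
  - move=> x _; apply: cvg_near_cst; near=> n.
    have -> : \1_(D n) x = 1 :> R.
      rewrite indicE mem_set// /D /= in_itv/= -ler_norml.
      near: n; exists (Num.truncn `|x|) => // n /= hn.
      rewrite (le_trans (ltW (truncnS_gt _)))// ler_nat ltnS //.
    by rewrite mulr1.
  - move=> n x _; rewrite indicE normrM ler_piMr//.
    by case: (_ \in _); rewrite ?normr1 ?normr0.
have h2 : (fun n => \int[mu]_x (f x * \1_(D n) x)) @ \oo --> (0 - 0 : R).
  rewrite (_ : (fun n => _) = (fun n => F n.+1%:R - F (- n.+1%:R))); first exact: cvgB.
  apply/funext => n; rewrite -Rint_mkcond (@FTC_seg F)//.
  by rewrite -subr_gt0 opprK addr_gt0.
by rewrite -(cvg_lim _ h)// (cvg_lim _ h2)// subrr.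
Unshelve. all: end_near. Qed.

End Integral.

(** * Functions of time and velocity *)

Section Joint.
Context {R : realType}.

Definition jointly_continuous (g : R -> R -> R) (s u : R) : Prop :=
  {for (s, u), continuous (fun p : R * R => g p.1 p.2)}.

(** Class [C^{1,2}] in (time, velocity) for times in [D], with the derivatives
given as functions. *)
Definition C12 (D : set R) (r rs ru ruu : R -> R -> R) : Prop :=
  forall s u : R, D s ->
  [/\ is_derive s 1 (r ^~ u) (rs s u), is_derive u 1 (r s) (ru s u),
      is_derive u 1 (ru s) (ruu s u) &
      [/\ jointly_continuous rs s u, jointly_continuous ru s u & jointly_continuous ruu s u]].

Lemma jointly_continuous_snd (g : R -> R -> R) (s u : R) : jointly_continuous g s u -> {for u, continuous (g s)}.
Proof.
move=> h; apply: (@continuous_comp _ _ _ (fun v : R => (s, v)) (fun p => g p.1 p.2)); last exact: h.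
exact: (cvg_pair (cvg_cst _) (@cvg_id _ _)).
Qed.

(** Compactness is used through near coverings: the bound [M] and the time [s]
range over the product filter of [+oo] and the neighbourhoods of [s0]. *)
Lemma strip_bounded (g : R -> R -> R) (s0 : R) (K : set R) : compact K ->
  (forall u, K u -> jointly_continuous g s0 u) ->
  exists2 M, 0 <= M & \forall s \near s0, forall u, K u -> `|g s u| <= M.
Proof.
move=> cK hg.
pose F := filter_prod (pinfty_nbhs R) (nbhs s0).
have cov u : K u -> \forall u' \near u & i \near F, `|g i.2 u'| <= i.1.
  move=> Ku.
  have /cvgrPdist_lt /(_ 1 ltr01) := hg u Ku.
  case=> -[A B] /= [hA hB] AB.
  exists (B, ([set M | `|g s0 u| + 1 < M] `*` A)).
    split => //=.
    exists ([set M | `|g s0 u| + 1 < M], A) => //=; split => //.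
    by apply: nbhs_pinfty_gt; rewrite num_real.
  move=> [v [M s]] /= [Bv [hM As]].
  have /= := AB (s, v) (conj As Bv).
  rewrite distrC => h; rewrite -(subrK (g s0 u) (g s v)).
  rewrite (le_trans (ler_normD _ _))// ltW// (le_lt_trans _ hM)// addrC lerD2l.
  exact: ltW.
have [[A B] /= [hA hB] AB] := (compact_near_coveringP K).1 cK _ F
  (fun i u => `|g i.2 u| <= i.1) _ cov.
have [M [M0 AM]] : exists M, 0 <= M /\ A M.
  have [M0 [_ hM]] := hA.
  exists (Num.max 0 (M0 + 1)); split; first by rewrite le_max lexx.
  by apply: hM; rewrite lt_max ltrDl ltr01 orbT.
exists M => //; apply: filterS hB => s Bs u Ku.
exact: (AB (M, s)).
Qed.

Lemma is_derive_lip (h dh : R -> R) (s0 d M : R) : 0 < d ->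
  (forall s, `|s - s0| < d -> is_derive s 1 h (dh s)) ->
  (forall s, `|s - s0| < d -> `|dh s| <= M) ->
  forall s, `|s - s0| < d -> `|h s - h s0| <= M * `|s - s0|.
Proof.
move=> d0 hd hM s hs.
have aux (x y : R) : x < y -> `|x - s0| < d -> `|y - s0| < d ->
    `|h y - h x| <= M * `|y - x|.
  move=> xy hx hy.
  have hz z : z \in `[x, y] -> `|z - s0| < d.
    rewrite in_itv/= => /andP[xz zy].
    move: hx hy; rewrite !ltr_norml => /andP[? _] /andP[_ ?].
    apply/andP; split; [apply: lt_le_trans (_ : x - s0 <= _) => //|
      apply: le_lt_trans (_ : _ <= y - s0) _ => //]; by rewrite lerD2r.
  have [z zxy ->] : exists2 z, z \in `]x, y[%R & h y - h x = dh z * (y - x).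
    apply: (@MVT _ h dh) => //.
      move=> z zxy; apply: hd; apply: hz; exact: subset_itv_oo_cc.
    apply: continuous_in_subspaceT => z /set_mem zxy.
    by apply: (deriv_cont (hd _ _)); apply: hz.
  by rewrite normrM ler_wpM2r// hM// hz//; exact: subset_itv_oo_cc.
have [ss|ss|->] := ltgtP s s0.
- by rewrite distrC (distrC s); apply: aux => //; rewrite subrr normr0.
- by apply: aux => //; rewrite subrr normr0.
- by rewrite !subrr !normr0 mulr0.
Qed.

(** [C12] says nothing of the joint continuity of [r] itself.  It follows from a
local bound on the time derivative, which makes [r] Lipschitz in time uniformly
in velocity, and from continuity in velocity at the fixed time [s0]. *)
Lemma C12_jointly_continuous (D : set R) r rs ru ruu (s0 u0 : R) : open D -> C12 D r rs ru ruu ->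
  D s0 -> jointly_continuous r s0 u0.
Proof.
move=> oD hr Ds0; apply/cvgrPdist_le => e e0 /=.
have [_ /deriv_cont cu _ [crs _ _]] := hr s0 u0 Ds0.
have /cvgrPdist_lt /(_ 1 ltr01) := crs.
case=> -[A B] /= [hA hB] AB.
have [d1 /= d10 hd1] : exists2 d : R, 0 < d & ball s0 d `<=` A `&` D.
  have := filterI hA (open_nbhs_nbhs (conj oD Ds0)).
  by rewrite -nbhs_ballE => -[d d0 hd]; exists d.
set M := `|rs s0 u0| + 1.
have M0 : 0 < M by rewrite /M ltr_wpDl.
have bM s u : `|s - s0| < d1 -> B u -> `|rs s u| <= M.
  move=> hs Bu; have [|As _] := hd1 s; first by rewrite /ball/= distrC.
  have /= := AB (s, u) (conj As Bu).
  rewrite distrC => h; rewrite -(subrK (rs s0 u0) (rs s u)).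
  by rewrite (le_trans (ler_normD _ _))// addrC lerD2l ltW.
move/cvgrPdist_le: cu => /(_ (e / 2) (divr_gt0 e0 _)) -/(_ ltac:(by [])) cu.
pose A' := [set s | `|s - s0| < Num.min d1 (e / 2 / M)].
exists (A', B `&` [set u | `|r s0 u0 - r s0 u| <= e / 2]).
  split; last exact: filterI.
  have : 0 < Num.min d1 (e / 2 / M) by rewrite lt_min d10 !divr_gt0.
  move=> h; apply/nbhs_ballP; exists (Num.min d1 (e / 2 / M)) => //= s.
  by rewrite /ball/= distrC.
move=> [s u] /= [As [Bu hu]].
move: As; rewrite /A' /= lt_min => /andP[As1 As2].
rewrite -(subrKA (r s0 u)) (le_trans (ler_normD _ _))// [leRHS]splitr lerD//.
rewrite distrC.
apply: le_trans (@is_derive_lip (r ^~ u) (rs ^~ u) s0 d1 M _ _ _ s _) _ => //.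
- move=> t ht; have [|_ Dt] := hd1 t; first by rewrite /ball/= distrC.
  by have [] := hr t u Dt.
- by move=> t ht; apply: bM.
- by rewrite mulrC -ler_pdivlMr// ltW.
Qed.

End Joint.

(** * A polynomial cutoff *)

Section Cutoff.
Context {R : realType}.
Implicit Types (N u x : R).

(** Only used on [[-N, N]], at whose ends [chi] and its derivative both vanish; this
is all that two integrations by parts need, and it keeps the cutoff polynomial. *)
Definition chi N u : R := (1 - (u / N) ^+ 2) ^+ 2.
Definition chi' N u : R := - 4 * (u / N) * (1 - (u / N) ^+ 2) / N.
Definition chi'' N u : R := (12 * (u / N) ^+ 2 - 4) / N ^+ 2.
(** All the errors made by the cutoff are bounded by multiples of this one
weight, which is at most [1] and tends to [0] pointwise as [N] grows. *)
Definition theta N u : R := (1 + `|u|) / (N + `|u|).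

Lemma is_derive_chi N u : is_derive u 1 (chi N) (chi' N u).
Proof. by rewrite /chi; deriv; rewrite /chi' /=; ring. Qed.

Lemma is_derive_chi' N u : is_derive u 1 (chi' N) (chi'' N u).
Proof. by rewrite /chi'; deriv; rewrite /chi'' /= -exprVn; ring. Qed.

Lemma theta_ge0 N u : 1 <= N -> 0 <= theta N u.
Proof. by move=> N1; rewrite /theta divr_ge0// addr_ge0// (le_trans ler01). Qed.

Lemma theta_le1 N u : 1 <= N -> theta N u <= 1.
Proof.
move=> N1; rewrite /theta ler_pdivrMr ?mul1r ?lerD2r//.
by rewrite ltr_pwDl// (lt_le_trans ltr01).
Qed.

Lemma theta_ge N u : 1 <= N -> `|u| <= N -> (1 + `|u|) / N <= 2 * theta N u.
Proof.
move=> N1 uN; have N0 : 0 < N by rewrite (lt_le_trans ltr01).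
have u0 := normr_ge0 u.
rewrite /theta mulrCA ler_pM2l ?ltr_pwDl//.
by rewrite ler_pdivlMr ?ltr_pwDl// mulrC ler_pdivrMr// mulr_natl mulr2n lerD2l.
Qed.

Lemma ratio_le1 N u : 1 <= N -> `|u| <= N -> `|u / N| <= 1.
Proof.
move=> N1 uN; have N0 : 0 < N by rewrite (lt_le_trans ltr01).
by rewrite normrM normfV (gtr0_norm N0) ler_pdivrMr// mul1r.
Qed.

Lemma chi_01 N u : 1 <= N -> `|u| <= N -> 0 <= chi N u <= 1.
Proof.
move=> N1 uN; have := ratio_le1 N1 uN.
rewrite ler_norml /chi; set x := u / N => /andP[x1 x2].
have : 0 <= 1 - x ^+ 2 <= 1 by nra.
by move=> /andP[h1 h2]; rewrite exprn_ge0// expr_le1.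
Qed.

Lemma chi'_le N u : 1 <= N -> `|u| <= N -> `|chi' N u| <= 4 * (`|u| / N) / N.
Proof.
move=> N1 uN; have N0 : 0 < N by rewrite (lt_le_trans ltr01).
have := ratio_le1 N1 uN.
have <- : `|u / N| = `|u| / N by rewrite normrM normfV (gtr0_norm N0).
rewrite /chi'; set x := u / N => x1.
have h : `|1 - x ^+ 2| <= 1.
  rewrite ler_norml; move: x1; rewrite ler_norml => /andP[? ?]; nra.
rewrite !normrM normrN normfV (gtr0_norm N0) ler_pM2r ?invr_gt0//.
rewrite (ger0_norm (_ : 0 <= 4))// -mulrA ler_pM2l// ler_piMr//.
by rewrite divr_ge0// ltW.
Qed.

Lemma chi'_theta N u : 1 <= N -> `|u| <= N -> `|chi' N u| <= 8 * theta N u.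
Proof.
move=> N1 uN; have N0 : 0 < N by rewrite (lt_le_trans ltr01).
apply: le_trans (chi'_le N1 uN) _.
have := theta_ge N1 uN; have := normr_ge0 u => u0 h.
apply: le_trans (_ : 4 * ((1 + `|u|) / N) <= _); last by lra.
rewrite -mulrA ler_pM2l// ler_pM2r ?invr_gt0//.
rewrite (le_trans (_ : _ <= 1)) ?lerDl//.
by rewrite ler_pdivrMr// mul1r.
Qed.

(** The drift grows like [|u|], but [u chi'] is of order [(u / N)^2 <= |u| / N] on
[[-N, N]]. *)
Lemma chi'_drift N u xi : 1 <= N -> `|u| <= N ->
  `|(xi - u) * chi' N u| <= 8 * (`|xi| + 1) * theta N u.
Proof.
move=> N1 uN; have N0 : 0 < N by rewrite (lt_le_trans ltr01).
have := theta_ge N1 uN; have := normr_ge0 u => u0 h.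
have xi0 := normr_ge0 xi.
rewrite normrM.
apply: le_trans (_ : (`|xi| + `|u|) * (4 * (`|u| / N) / N) <= _).
  by rewrite ler_pM// ?chi'_le// (le_trans (ler_normB _ _)).
apply: le_trans (_ : 4 * (`|xi| + 1) * ((1 + `|u|) / N) <= _); last first.
  have : 0 <= `|xi| + 1 by rewrite addr_ge0.
  by move: h; set A := _ / N; set B := theta _ _; nra.
rewrite [leLHS](_ : _ = 4 * ((`|xi| + `|u|) * (`|u| / N)) / N); last by ring.
rewrite -!mulrA ler_pM2l// !mulrA ler_pM2r ?invr_gt0//.
have : `|u| / N <= 1 by rewrite ler_pdivrMr// mul1r.
rewrite -(mulrA _ `|u|); set x := `|u| / N => x1.
have x0 : 0 <= x by rewrite divr_ge0// ltW.
nra.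
Qed.

Lemma chi''_theta N u : 1 <= N -> `|u| <= N -> `|chi'' N u| <= 24 * theta N u.
Proof.
move=> N1 uN; have N0 : 0 < N by rewrite (lt_le_trans ltr01).
have := ratio_le1 N1 uN; rewrite /chi''; set x := u / N => x1.
have := theta_ge N1 uN; have := normr_ge0 u => u0 h.
apply: le_trans (_ : 12 * ((1 + `|u|) / N) <= _); last by lra.
rewrite normrM normfV (gtr0_norm (_ : 0 < N ^+ 2)) ?exprn_gt0//.
have {}x1 : `|12 * x ^+ 2 - 4| <= 12.
  rewrite ler_norml; move: x1; rewrite ler_norml => /andP[? ?]; nra.
apply: le_trans (_ : 12 * (1 / N) <= _); last first.
  by rewrite ler_pM2l// ler_pM2r ?invr_gt0// lerDl.
rewrite mul1r ler_pM ?invr_ge0 ?exprn_ge0// ?(ltW N0)//.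
by rewrite lef_pV2 ?posrE ?exprn_gt0// expr2 ler_peMr// ltW.
Qed.

(** Outside [[-N, N]] the left side is [1] and [theta >= 1/2]; inside,
[1 - chi <= 2 (u / N)^2]. *)
Lemma chi_compl N u : 1 <= N ->
  `|1 - chi N u * \1_(`[- N, N]%classic) u| <= 4 * theta N u.
Proof.
move=> N1; have N0 : 0 < N by rewrite (lt_le_trans ltr01).
have u0 := normr_ge0 u.
rewrite indicE; case: (boolP (u \in _)) => [/set_mem|/negP uN]; rewrite ?mulr1 ?mulr0.
  rewrite /= in_itv/= -ler_norml => uN.
  have /andP[c0 c1] := chi_01 N1 uN.
  rewrite ger0_norm ?subr_ge0//.
  have h := theta_ge N1 uN.
  apply: le_trans (_ : 2 * ((1 + `|u|) / N) <= _); last by lra.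
  have : `|u / N| = `|u| / N by rewrite normrM normfV (gtr0_norm N0).
  have := ratio_le1 N1 uN.
  rewrite /chi; have -> : (u / N) ^+ 2 = `|u / N| ^+ 2 by rewrite real_normK// num_real.
  set x := `|u / N| => x1 hx.
  have x0 : 0 <= x by rewrite /x.
  apply: le_trans (_ : 2 * x <= _); first by nra.
  by rewrite ler_pM2l// hx ler_pM2r ?invr_gt0// lerDr.
rewrite subr0 normr1.
have {}uN : N < `|u|.
  by rewrite ltNge; apply/negP => h; apply: uN; rewrite inE/= in_itv/= -ler_norml.
rewrite /theta mulrA ler_pdivlMr ?ltr_pwDl//; lra.
Qed.

Lemma theta_cvg0 u : (fun n => theta n.+1%:R u) @ \oo --> (0 : R).
Proof.
have h : (fun n => (1 + `|u|) * n.+1%:R^-1) @ \oo --> ((1 + `|u|) * 0 : R).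
  by apply: cvgM; [exact: cvg_cst|exact: cvg_harmonic].
rewrite mulr0 in h.
apply: (squeeze_cvgr _ (cvg_cst _) h).
apply: nearW => n; apply/andP; split; first by apply: theta_ge0; rewrite ler1n.
rewrite /theta ler_wpM2l ?addr_ge0// lef_pV2 ?posrE ?ltr_pwDl//.
by rewrite lerDl.
Qed.

Lemma cont_theta N : 1 <= N -> continuous (theta N).
Proof.
move=> N1 u; suff: {for u, continuous (fun v => (1 + `|v|) * (N + `|v|)^-1)} by [].
apply: cont_mul; first by cont.
apply: cont_inv; last by cont.
by rewrite gt_eqF// ltr_pwDl// (lt_le_trans ltr01).
Qed.

End Cutoff.

(** * Curves in a weighted space of integrable functions *)

Section Weighted.
Context {R : realType}.
Local Notation mu := (@lebesgue_measure R).
Local Notation Rintegrable D f := (mu.-integrable D (EFin \o f)).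
Local Notation mble D := (@measurable _ (measurableTypeR R) D).

Definition wintegrable (r : R -> R) := Rintegrable setT r /\ Rintegrable setT (fun u => (1 + `|u|) * r u).
Definition wnorm (r : R -> R) : R := \int[mu]_u ((1 + `|u|) * `|r u|).

(** A continuous curve on [[0, +oo[] in the space [L^1 ((1 + |u|) du)]. *)
Definition wcurve (r : R -> R -> R) :=
  (forall s, 0 <= s -> wintegrable (r s)) /\
  (forall s0 : R, 0 <= s0 -> forall e : R, 0 < e ->
    \forall s \near nbhs s0, 0 <= s -> wnorm (fun u => r s u - r s0 u) < e).

Definition wtail (N : R) (r : R -> R) : R :=
  \int[mu]_u ((1 + `|u|) * `|r u| * theta N u).

Lemma wgt_gt0 (u : R) : 0 < 1 + `|u|.
Proof. by rewrite ltr_pwDl. Qed.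

Lemma wgt_ge0 (u : R) : 0 <= 1 + `|u|.
Proof. exact/ltW/wgt_gt0. Qed.

Lemma wintegrable_meas r : wintegrable r -> measurable_fun setT r.
Proof. by case=> h _; exact: (Rintegrable_meas _ h). Qed.

Lemma wintegrable_abs r : wintegrable r -> Rintegrable setT (fun u => (1 + `|u|) * `|r u|).
Proof.
move=> [_ h]; have := Rintegrable_abs measurableT h; apply: eq_integrable => //.
by move=> u _ /=; rewrite normrM (ger0_norm (ltW (wgt_gt0 u))).
Qed.

Lemma wintegrable_tail N r : 1 <= N -> wintegrable r -> Rintegrable setT (fun u => (1 + `|u|) * `|r u| * theta N u).
Proof.
move=> N1 hr; apply: Rintegrable_le (wintegrable_abs hr) => //.
  apply: measurable_funM; first exact: (Rintegrable_meas _ (wintegrable_abs hr)).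
  exact: (meas_cont _ (cont_theta N1)).
move=> u _; rewrite normrM (ger0_norm (theta_ge0 u N1)).
rewrite ger0_norm ?mulr_ge0 ?wgt_ge0////.
by rewrite ler_piMr ?theta_le1// mulr_ge0 ?wgt_ge0//.
Qed.

Lemma wintegrable_sub r1 r2 : wintegrable r1 -> wintegrable r2 -> wintegrable (fun u => r1 u - r2 u).
Proof.
move=> [h1 h2] [k1 k2]; split; first exact: Rintegrable_sub.
have := Rintegrable_sub measurableT h2 k2; apply: eq_integrable => // u _ /=.
by rewrite mulrBr.
Qed.

Lemma wnorm_ge0 r : 0 <= wnorm r.
Proof. by apply: Rint_ge0 => u _; rewrite mulr_ge0 ?wgt_ge0//. Qed.

Lemma wtail_ge0 N r : 1 <= N -> 0 <= wtail N r.
Proof.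
move=> N1; apply: Rint_ge0 => u _.
apply: mulr_ge0; first by apply: mulr_ge0 => //; exact: wgt_ge0. exact: theta_ge0.
Qed.

Lemma Rint_add D (f g : R -> R) : mble D -> Rintegrable D f -> Rintegrable D g ->
  \int[mu]_(x in D) (f x + g x) = \int[mu]_(x in D) f x + \int[mu]_(x in D) g x.
Proof. by move=> mD hf hg; apply: RintegralD. Qed.

Lemma Rint_sub D (f g : R -> R) : mble D -> Rintegrable D f -> Rintegrable D g ->
  \int[mu]_(x in D) (f x - g x) = \int[mu]_(x in D) f x - \int[mu]_(x in D) g x.
Proof. by move=> mD hf hg; apply: RintegralB. Qed.

Lemma Rint_mull D (c : R) (f : R -> R) : mble D -> Rintegrable D f ->
  \int[mu]_(x in D) (c * f x) = c * \int[mu]_(x in D) f x.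
Proof. by move=> mD hf; apply: RintegralZl. Qed.

Lemma wtail_triangle N r1 r2 : 1 <= N -> wintegrable r1 -> wintegrable r2 ->
  wtail N r1 <= wtail N r2 + wnorm (fun u => r1 u - r2 u).
Proof.
move=> N1 h1 h2; rewrite /wtail /wnorm -Rint_add//; last 2 first.
- exact: wintegrable_tail.
- exact/wintegrable_abs/wintegrable_sub.
apply: Rint_le => //.
- exact: wintegrable_tail.
- by apply: Rintegrable_add => //; [exact: wintegrable_tail|exact/wintegrable_abs/wintegrable_sub].
move=> u _; rewrite -!mulrA -mulrDr ler_pM2l ?wgt_gt0//.
apply: le_trans (_ : (`|r2 u| + `|r1 u - r2 u|) * theta N u <= _).
  rewrite ler_wpM2r ?theta_ge0//.
  by rewrite addrC -lerBlDr (le_trans (lerB_dist _ _)).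
by rewrite mulrDl lerD2l ler_piMr// theta_le1.
Qed.

Lemma wnorm_triangle r1 r2 : wintegrable r1 -> wintegrable r2 ->
  wnorm r1 <= wnorm r2 + wnorm (fun u => r1 u - r2 u).
Proof.
move=> h1 h2; rewrite /wnorm -Rint_add//; last 2 first.
- exact: wintegrable_abs.
- exact/wintegrable_abs/wintegrable_sub.
apply: Rint_le => //.
- exact: wintegrable_abs.
- by apply: Rintegrable_add => //; [exact: wintegrable_abs|exact/wintegrable_abs/wintegrable_sub].
move=> u _; rewrite -mulrDr ler_pM2l ?wgt_gt0//.
by rewrite addrC -lerBlDr (le_trans (lerB_dist _ _)).
Qed.

Lemma wtail_cvg0 r : wintegrable r -> (fun n => wtail n.+1%:R r) @ \oo --> (0 : R).
Proof.
move=> hr.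
have -> : (0 : R) = \int[mu]_u (0 : R).
  by rewrite Rintegral_cst// mul0r.
apply: (@Rint_dominated _ _ _ _ (fun u => (1 + `|u|) * `|r u|)) => //.
- move=> n; apply: Rintegrable_meas => //; apply: wintegrable_tail => //; by rewrite ler1n.
- exact: integrable0.
- exact: wintegrable_abs.
- move=> u _; rewrite -[X in _ --> X](mulr0 ((1 + `|u|) * `|r u|)).
  by apply: cvgM; [exact: cvg_cst|exact: theta_cvg0].
- move=> n u _; have N1 : 1 <= n.+1%:R :> R by rewrite ler1n.
  rewrite normrM (ger0_norm (theta_ge0 u N1)).
  rewrite ger0_norm ?mulr_ge0 ?wgt_ge0////.
  by rewrite ler_piMr ?theta_le1// mulr_ge0 ?wgt_ge0//.
Qed.

(** Near [s0] the tail of [r s] is at most that of [r s0] plus the distance of the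
two; compactness of [[0, T]] turns the pointwise decay into a uniform one. *)
Lemma wcurve_tail r (T e : R) : wcurve r -> 0 < e ->
  \forall n \near \oo, forall s, 0 <= s <= T -> wtail n.+1%:R (r s) <= e.
Proof.
move=> [hr cr] e0.
have e20 : 0 < e / 2 by rewrite divr_gt0.
have cK : compact (`[0, T] : set R) by exact: segment_compact.
have cov s0 : `[0, T]%classic s0 -> \forall s \near s0 & n \near \oo,
    `[0, T]%classic s -> wtail n.+1%:R (r s) <= e.
  rewrite /= in_itv/= => /andP[s00 _].
  have /cvgrPdist_lt /(_ _ e20) tn := wtail_cvg0 (hr _ s00).
  exists ([set s | 0 <= s -> wnorm (fun u => r s u - r s0 u) < e / 2],
          [set n | `|0 - wtail n.+1%:R (r s0)| < e / 2]).
    by split => //; exact: cr.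
  move=> [s n] /= [hs hn]; rewrite in_itv/= => /andP[s0' _].
  have N1 : 1 <= n.+1%:R :> R by rewrite ler1n.
  apply: le_trans (wtail_triangle N1 (hr _ s0') (hr _ s00)) _.
  rewrite [leRHS]splitr lerD ?(ltW (hs s0'))//.
  by move: hn; rewrite sub0r normrN ger0_norm ?wtail_ge0// => /ltW.
have F0 : Filter (\oo : set_system nat) by exact: _.
have := (near_covering_withinP _).2 ((compact_near_coveringP _).1 cK) _ _
  (fun n s => wtail n.+1%:R (r s) <= e) F0 cov.
by apply: filterS => n /= hn s hs; apply: hn; rewrite /= in_itv.
Qed.

Lemma wcurve_bounded r (T : R) : wcurve r ->
  exists B, forall s, 0 <= s <= T -> wnorm (r s) <= B.
Proof.
move=> [hr cr].
have cK : compact (`[0, T] : set R) by exact: segment_compact.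
have cov s0 : `[0, T]%classic s0 -> \forall s \near s0 & B \near +oo,
    `[0, T]%classic s -> wnorm (r s) <= B.
  rewrite /= in_itv/= => /andP[s00 _].
  exists ([set s | 0 <= s -> wnorm (fun u => r s u - r s0 u) < 1],
          [set B | wnorm (r s0) + 1 < B]).
    by split => /=; [exact: cr|apply: nbhs_pinfty_gt; rewrite num_real].
  move=> [s n] /= [hs hn]; rewrite in_itv/= => /andP[s0' _].
  apply: le_trans (wnorm_triangle (hr _ s0') (hr _ s00)) _.
  by apply: le_trans (ltW hn); rewrite lerD2l ltW// hs.
have F0 : Filter (pinfty_nbhs R) by exact: _.
have := (near_covering_withinP _).2 ((compact_near_coveringP _).1 cK) _ _
  (fun B s => wnorm (r s) <= B) F0 cov.
move=> [M [_ hM]]; exists (M + 1) => s hs; apply: (hM (M + 1)).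
  by rewrite ltrDl.
by rewrite /= in_itv.
Qed.

End Weighted.

(** * Truncated pairings *)

Section Truncated.
Context {R : realType}.
Local Notation mu := (@lebesgue_measure R).
Local Notation Rintegrable D f := (mu.-integrable D (EFin \o f)).
Local Notation mble D := (@measurable _ (measurableTypeR R) D).
Local Notation box N := (`[- N, N]%classic : set R).

Lemma box_itv (N u : R) : box N u -> `|u| <= N.
Proof. by rewrite /= in_itv/= -ler_norml. Qed.

Lemma cont_chi (N u : R) : {for u, continuous (chi N)}.
Proof. exact: deriv_cont (is_derive_chi N u). Qed.

Lemma cont_chi' (N u : R) : {for u, continuous (chi' N)}.
Proof. exact: deriv_cont (is_derive_chi' N u). Qed.

Lemma cont_chi'' (N u : R) : {for u, continuous (chi'' N)}.
Proof. by rewrite /chi''; cont. Qed.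

Lemma chi_end (N : R) : 0 < N -> [/\ chi N N = 0, chi N (- N) = 0, chi' N N = 0 & chi' N (- N) = 0].
Proof.
move=> N0; have N1 : N / N = 1 by rewrite divff// gt_eqF.
by rewrite /chi /chi' !mulNr N1; split; ring.
Qed.

(** The Fokker-Planck generator [f |-> - ((xi - u) f)' + kap f''], its adjoint,
and the commutator of the adjoint with the multiplication by [chi]. *)
Definition gen_fwd (xi kap : R) (r ru ruu : R -> R) (u : R) : R :=
  - ((xi - u) * ru u - r u) + kap * ruu u.
Definition gen_bwd (xi kap : R) (v vu vuu : R -> R) (u : R) : R :=
  (xi - u) * vu u + kap * vuu u.
Definition cutoff_error (xi kap N : R) (v vu : R -> R) (u : R) : R :=
  (xi - u) * v u * chi' N u + kap * (2 * vu u * chi' N u + v u * chi'' N u).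

(** The integrand of the difference of the two sides is the derivative of the
flux [F] below, and the flux vanishes at [N] and [- N] with [chi] and [chi']. *)
Lemma green_identity (xi kap N : R) (r ru ruu v vu vuu : R -> R) : 0 < N ->
  (forall u : R, is_derive u 1 r (ru u)) -> (forall u : R, is_derive u 1 ru (ruu u)) ->
  (forall u : R, is_derive u 1 v (vu u)) -> (forall u : R, is_derive u 1 vu (vuu u)) ->
  continuous ruu -> continuous vuu ->
  \int[mu]_(u in box N) ((gen_fwd xi kap r ru ruu u * v u
     - r u * gen_bwd xi kap v vu vuu u) * chi N u)
  = \int[mu]_(u in box N) (r u * cutoff_error xi kap N v vu u).
Proof.
move=> N0 dr dru dv dvu cruu cvuu.
have cr u : {for u, continuous r} by exact: deriv_cont (dr u).
have cru u : {for u, continuous ru} by exact: deriv_cont (dru u).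
have cv u : {for u, continuous v} by exact: deriv_cont (dv u).
have cvu u : {for u, continuous vu} by exact: deriv_cont (dvu u).
have cruu' u : {for u, continuous ruu} by exact: cruu.
have cvuu' u : {for u, continuous vuu} by exact: cvuu.
have h u := @cont_chi N u; have h' u := @cont_chi' N u; have h'' u := @cont_chi'' N u.
pose F u := - ((xi - u) * (r u * (v u * chi N u)))
  + kap * (ru u * (v u * chi N u) - r u * (vu u * chi N u + v u * chi' N u)).
apply/eqP; rewrite -subr_eq0 -Rint_sub//; last 2 first.
- apply: Rintegrable_cont => u.
  suff : {for u, continuous (fun u => (gen_fwd xi kap r ru ruu u * v u
     - r u * gen_bwd xi kap v vu vuu u) * chi N u)} by [].
  have := h u; have := cr u; have := cru u; have := cruu' u; have := cv u.
  have := cvu u; have := cvuu' u => *.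
  by rewrite /gen_fwd /gen_bwd; cont.
- apply: Rintegrable_cont => u.
  suff : {for u, continuous (fun u => r u * cutoff_error xi kap N v vu u)} by [].
  have := h u; have := cr u; have := cv u; have := h' u; have := h'' u.
  have := cvu u => *.
  by rewrite /cutoff_error; cont.
have dF (u : R) : is_derive u 1 F ((gen_fwd xi kap r ru ruu u * v u
     - r u * gen_bwd xi kap v vu vuu u) * chi N u - r u * cutoff_error xi kap N v vu u).
  have := dr u; have := dru u; have := dv u; have := dvu u.
  have := is_derive_chi N u; have := is_derive_chi' N u => ? ? ? ? ? ?.
  by rewrite /F; deriv; rewrite /gen_fwd /gen_bwd /cutoff_error /=; ring.
rewrite (@FTC_seg _ F)//.
- have [e1 e2 e3 e4] := chi_end N0.
  by rewrite /F e1 e2 e3 e4; apply/eqP; ring.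
- by rewrite -subr_gt0 opprK addr_gt0.
- move=> u.
  suff : {for u, continuous (fun u => (gen_fwd xi kap r ru ruu u * v u
     - r u * gen_bwd xi kap v vu vuu u) * chi N u - r u * cutoff_error xi kap N v vu u)} by [].
  have := h u; have := cr u; have := cru u; have := cruu' u; have := cv u.
  have := cvu u; have := cvuu' u; have := h' u; have := h'' u => *.
  by rewrite /gen_fwd /gen_bwd /cutoff_error; cont.
Qed.

Lemma cutoff_error_le (xi kap C N : R) (v vu : R -> R) (u : R) : 1 <= N -> `|u| <= N -> 0 <= kap ->
  `|v u| <= C * (1 + `|u|) -> `|vu u| <= C * (1 + `|u|) ->
  `|cutoff_error xi kap N v vu u| <= (8 * (`|xi| + 1) + 40 * kap) * C * ((1 + `|u|) * theta N u).
Proof.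
move=> N1 uN kap0 hv hvu; set w := 1 + `|u| in hv hvu *.
have w0 : 0 <= w by exact: wgt_ge0.
have t0 : 0 <= theta N u by exact: theta_ge0.
have b0 := chi'_drift xi N1 uN; have b1 := chi'_theta N1 uN; have b2 := chi''_theta N1 uN.
rewrite /cutoff_error [X in `|X + _|](_ : _ = v u * ((xi - u) * chi' N u)); last by ring.
rewrite (le_trans (ler_normD _ _))//.
apply: le_trans (_ : C * w * (8 * (`|xi| + 1) * theta N u)
  + kap * (2 * (C * w) * (8 * theta N u) + C * w * (24 * theta N u)) <= _); last first.
  by rewrite le_eqVlt; apply/orP; left; apply/eqP; ring.
apply: lerD; first by rewrite normrM ler_pM.
rewrite normrM (ger0_norm kap0) ler_wpM2l// (le_trans (ler_normD _ _))// lerD//.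
  by rewrite normrM ler_pM// normrM (ger0_norm (_ : 0 <= 2)) // ler_wpM2l.
by rewrite normrM ler_pM.
Qed.

(** Every term of the commutator contains a derivative of [chi], so the error is
controlled by the tail of [r] alone, without any derivative of [r]. *)
Lemma cutoff_error_int (xi kap C N : R) (r v vu : R -> R) : 1 <= N -> 0 <= kap ->
  continuous r -> continuous v -> continuous vu -> wintegrable r ->
  (forall u, `|v u| <= C * (1 + `|u|)) -> (forall u, `|vu u| <= C * (1 + `|u|)) ->
  `|\int[mu]_(u in box N) (r u * cutoff_error xi kap N v vu u)| <=
    (8 * (`|xi| + 1) + 40 * kap) * C * wtail N r.
Proof.
move=> N1 kap0 cr cv cvu hr hv hvu.
have C0 : 0 <= C by have := le_trans (normr_ge0 _) (hv 0); rewrite normr0 addr0 mulr1.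
have ce : continuous (fun u => r u * cutoff_error xi kap N v vu u).
  move=> u; suff : {for u, continuous (fun u => r u * cutoff_error xi kap N v vu u)} by [].
  have : {for u, continuous r} by exact: cr.
  have : {for u, continuous v} by exact: cv.
  have : {for u, continuous vu} by exact: cvu.
  have := @cont_chi' N u; have := @cont_chi'' N u => *.
  by rewrite /cutoff_error; cont.
set K := (_ * C).
have iK : Rintegrable setT (fun u => K * ((1 + `|u|) * `|r u| * theta N u)).
  by apply: Rintegrable_mull => //; exact: wintegrable_tail.
apply: le_trans (_ : \int[mu]_(u in box N) (K * ((1 + `|u|) * `|r u| * theta N u)) <= _).
  apply: Rint_abs_le => //.
  - exact: Rintegrable_cont.
  - by apply: Rintegrable_sub_set => //; exact: measurable_itv.
  - move=> u /box_itv uN; rewrite normrM.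
    have := cutoff_error_le xi N1 uN kap0 (hv u) (hvu u); rewrite -/K => h.
    apply: le_trans (ler_wpM2l (normr_ge0 (r u)) h) _.
    by rewrite le_eqVlt; apply/orP; left; apply/eqP; ring.
rewrite /wtail -Rint_mull//; last exact: wintegrable_tail.
apply: Rint_subset_le => //.
move=> u; apply: mulr_ge0.
  by rewrite /K mulr_ge0// addr_ge0 ?mulr_ge0// addr_ge0.
by rewrite mulr_ge0 ?theta_ge0// mulr_ge0 ?wgt_ge0.
Qed.

(** On the compact box the time derivative of the integrand is bounded near [s0]
by [strip_bounded], which is the domination needed to differentiate under the
integral. *)
Lemma trunc_deriv (N s0 : R) (D : set R) (r rs ru ruu v vs vu vuu : R -> R -> R) : open D -> D s0 ->
  C12 D r rs ru ruu -> C12 setT v vs vu vuu ->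
  is_derive s0 1 (fun s => \int[mu]_(u in box N) (r s u * v s u * chi N u))
    (\int[mu]_(u in box N) ((rs s0 u * v s0 u + r s0 u * vs s0 u) * chi N u)).
Proof.
move=> oD Ds0 hr hv.
pose f s u := r s u * v s u * chi N u.
pose df s u := (rs s u * v s u + r s u * vs s u) * chi N u.
have cr s u : D s -> jointly_continuous r s u by move=> Ds; exact: C12_jointly_continuous oD hr Ds.
have cv s u : jointly_continuous v s u by apply: C12_jointly_continuous (openT) hv _.
have hdf (s u : R) : D s -> is_derive s 1 (f ^~ u) (df s u).
  move=> Ds; have [d1 _ _ _] := hr s u Ds; have [d2 _ _ _] := hv s u I.
  by rewrite /f; deriv; rewrite /df /=; ring.
have cdf s u : D s -> jointly_continuous df s u.
  move=> Ds; have [_ _ _ [c1 _ _]] := hr s u Ds; have [_ _ _ [c2 _ _]] := hv s u I.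
  have c3 := cr s u Ds; have c4 := cv s u.
  have c5 : jointly_continuous (fun=> chi N) s u.
    by apply: (@continuous_comp _ _ _ snd (chi N)); [exact: cvg_snd|exact: cont_chi].
  rewrite /jointly_continuous /df; move: c1 c2 c3 c4 c5; rewrite /jointly_continuous => c1 c2 c3 c4 c5.
  by cont.
have [M M0 hM] := strip_bounded (@segment_compact _ (- N) N) (fun u _ => cdf s0 u Ds0).
have hD : \forall s \near s0, D s by exact: open_nbhs_nbhs.
have : nbhs s0 [set s | D s /\ forall u, box N u -> `|df s u| <= M].
  exact: filterI.
rewrite -nbhs_ballE => -[d /= d0 hd].
have Ih s : `]s0 - d, s0 + d[%classic s -> D s /\ forall u, box N u -> `|df s u| <= M.
  rewrite /= in_itv/= => hs; apply: hd.
  by move: hs => /andP[h1 h2]; rewrite /ball/= distrC ltr_norml; apply/andP; split; lra.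
have I0 : `]s0 - d, s0 + d[%classic s0.
  by rewrite /= in_itv/= ltrDl d0 ltrBlDr ltrDl d0.
have intf s : `]s0 - d, s0 + d[%classic s -> Rintegrable (box N) (f s).
  move=> /Ih [Ds _]; apply: Rintegrable_cont => u; rewrite /f.
  have c1 := jointly_continuous_snd (cr s u Ds); have c2 := jointly_continuous_snd (cv s u); have c3 := @cont_chi N u.
  suff : {for u, continuous (fun u => r s u * v s u * chi N u)} by [].
  by cont.
have derf s u : `]s0 - d, s0 + d[%classic s -> box N u -> derivable (f ^~ u) s 1.
  by move=> /Ih [Ds _] _; case: (hdf s u Ds).
have pE s u : `]s0 - d, s0 + d[%classic s -> partial1of2 f s u = df s u.
  by move=> /Ih [Ds _]; rewrite partial1of2E; have [_ ->] := hdf s u Ds.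
have hG : forall s u, `]s0 - d, s0 + d[%classic s -> box N u -> `|partial1of2 f s u| <= M.
  by move=> s u Is Bu; rewrite pE//; have [_] := Ih s Is; apply.
have iM : Rintegrable (box N) (fun=> M) by apply: Rintegrable_cont => u; exact: cst_continuous.
have mB : mble (box N) by exact: measurable_itv.
have d1 := @derivable_under_integral R _ (measurableTypeR R) mu f _ mB _ _ _ I0 intf derf (fun=> M) (fun=> M0) iM hG.
have d2 := @differentiation_under_integral R _ (measurableTypeR R) mu f _ mB _ _ _ I0 intf derf (fun=> M) (fun=> M0) iM hG.
split; first exact: d1.
rewrite -derive1E d2; apply: Rint_eq => u _; exact: pE.
Qed.

(** At the initial time no derivative is available.  The change of [r] is
controlled in the weighted norm, and that of [v] by dominated convergence
against the fixed function [r 0]. *)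
Lemma trunc_cvg0 (N C T : R) (r v vs vu vuu : R -> R -> R) : 1 <= N -> 0 < T ->
  wcurve r -> C12 setT v vs vu vuu ->
  (forall s u, s <= T -> `|v s u| <= C * (1 + `|u|)) ->
  \int[mu]_(u in box N) (r s u * v s u * chi N u) @[s --> 0^'+] -->
  \int[mu]_(u in box N) (r 0 u * v 0 u * chi N u).
Proof.
move=> N1 T0 [hr cr] hv bv.
have N0 : 0 < N by rewrite (lt_le_trans ltr01).
have mB : mble (box N) by exact: measurable_itv.
have C0 : 0 <= C by have := le_trans (normr_ge0 _) (bv 0 0 (ltW T0)); rewrite normr0 addr0 mulr1.
have cv s u : {for u, continuous (v s)}.
  by have [_ /deriv_cont] := hv s u I.
have mv s s' : 0 <= s' -> measurable_fun (box N) (fun u => r s' u * v s u * chi N u).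
  move=> s'0; apply: measurable_funM; last by apply: meas_cont => // w; exact: cont_chi.
  apply: measurable_funM; last by apply: meas_cont => // w; exact: cv.
  by have [h _] := hr s' s'0; apply: (Rintegrable_meas mB); exact: Rintegrable_sub_set.
have bnd (g : R -> R) s u : s <= T -> box N u -> `|g u * v s u * chi N u| <= C * ((1 + `|u|) * `|g u|).
  move=> sT /box_itv uN; have /andP[c0 c1] := chi_01 N1 uN.
  rewrite normrM (ger0_norm c0) (le_trans (ler_piMr _ c1))// normrM mulrA mulrC ler_wpM2r//.
  exact: bv.
have iw s : 0 <= s -> Rintegrable (box N) (fun u => C * ((1 + `|u|) * `|r s u|)).
  by move=> s0; apply: Rintegrable_mull => //; apply: Rintegrable_sub_set => //; apply: wintegrable_abs; exact: hr.
have ii s s' : s <= T -> 0 <= s' -> Rintegrable (box N) (fun u => r s' u * v s u * chi N u).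
  move=> sT s'0; apply: Rintegrable_le (iw s' s'0) => //; first exact: mv.
  by move=> u Bu; exact: bnd.
pose A s := \int[mu]_(u in box N) (r 0 u * v s u * chi N u).
have cA : A s @[s --> 0^'+] --> A 0.
  apply: cvg_at_right_filter.
  have cf : {ae mu, forall u, box N u -> {in `]-1, T[%classic, continuous (fun s => r 0 u * v s u * chi N u)}}.
    apply: aeW => u _ s _.
    suff : {for s, continuous (fun s => r 0 u * v s u * chi N u)} by [].
    have c1 : {for s, continuous (v ^~ u)} by have [/deriv_cont] := hv s u I.
    by cont.
  have := @continuity_under_integral R _ (measurableTypeR R) mu
    (fun s u => r 0 u * v s u * chi N u) (box N) mB (-1) T _ cf
    (fun u => C * ((1 + `|u|) * `|r 0 u|)) (iw 0 (lexx _)) _.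
  apply.
  - by move=> s; rewrite /= in_itv/= => /andP[_ /ltW sT]; exact: ii.
  - by move=> s; rewrite /= in_itv/= => /andP[_ /ltW sT]; apply: aeW => u Bu; exact: bnd.
  - by rewrite inE /= in_itv/= T0 ltrN10.
apply/cvgrPdist_le => e e0.
have e20 : 0 < e / 2 by rewrite divr_gt0.
move/cvgrPdist_le : cA => /(_ _ e20) cA.
have C1 : 0 < C + 1 by rewrite ltr_wpDl.
have cr' : \forall s \near 0^'+, 0 <= s -> wnorm (fun u => r s u - r 0 u) < e / 2 / (C + 1).
  apply: cvg_within; apply: cr => //; exact: divr_gt0.
near=> s.
have s0 : 0 < s by near: s; exact: nbhs_right_gt.
have sT : s <= T by near: s; apply: nbhs_right_le.
have hA : `|A 0 - A s| <= e / 2 by near: s.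
have hw : wnorm (fun u => r s u - r 0 u) < e / 2 / (C + 1).
  have : 0 <= s by exact: ltW.
  by near: s.
rewrite -/(A 0) -(subrKA (A s)) (le_trans (ler_normD _ _))// [leRHS]splitr lerD//.
rewrite /A -Rint_sub//; last 2 first.
- by apply: ii => //.
- by apply: ii => //; exact: ltW.
have hi : wintegrable (fun u => r s u - r 0 u) by apply: wintegrable_sub; apply: hr => //; exact: ltW.
apply: le_trans (_ : \int[mu]_(u in box N) (C * ((1 + `|u|) * `|r s u - r 0 u|)) <= _).
  apply: Rint_abs_le => //.
  - have h0 := ii s 0 sT (lexx _); have hs := ii s s sT (ltW s0).
    exact: Rintegrable_sub.
  - by apply: Rintegrable_mull => //; apply: Rintegrable_sub_set => //; exact: wintegrable_abs.
  - move=> u Bu; have h := bnd (fun u => r s u - r 0 u) s u sT Bu.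
    by rewrite distrC -!mulrBl.
apply: le_trans (_ : \int[mu]_u (C * ((1 + `|u|) * `|r s u - r 0 u|)) <= _).
  apply: Rint_subset_le => //.
    by apply: Rintegrable_mull => //; exact: wintegrable_abs.
  by move=> u; rewrite mulr_ge0// mulr_ge0 ?wgt_ge0.
rewrite Rint_mull//; last exact: wintegrable_abs.
apply: le_trans (_ : C * (e / 2 / (C + 1)) <= _); first by rewrite ler_wpM2l// ltW.
rewrite mulrCA ler_piMr ?(ltW e20)// ler_pdivrMr// mul1r lerDl//.
Unshelve. all: end_near. Qed.

End Truncated.

(** * The duality estimate *)

Section Master.
Context {R : realType}.
Local Notation mu := (@lebesgue_measure R).
Local Notation Rintegrable D f := (mu.-integrable D (EFin \o f)).
Local Notation mble D := (@measurable _ (measurableTypeR R) D).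
Local Notation box N := (`[- N, N]%classic : set R).

(** Apply the mean value theorem to [P - y] and to [P + y]; only the value of [y]
at [0] is taken as a limit. *)
Lemma mvt_compare (y dy P dP : R -> R) (T : R) : 0 < T ->
  (forall s : R, 0 < s -> is_derive s 1 y (dy s)) -> y s @[s --> 0^'+] --> y 0 ->
  (forall s : R, is_derive s 1 P (dP s)) ->
  (forall s : R, 0 < s < T -> `|dy s| <= dP s) ->
  `|y T - y 0| <= P T - P 0.
Proof.
move=> T0 hy y0 hP hd.
have aux (z dz : R -> R) : (forall s : R, 0 < s -> is_derive s 1 z (dz s)) ->
    z s @[s --> 0^'+] --> z 0 -> (forall s : R, 0 < s < T -> `|dz s| <= dP s) ->
    0 <= (P T - P 0) - (z T - z 0).
  move=> hz z0 hdz.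
  have [c cT e] : exists2 c, c \in `]0, T[%R &
      (P T - z T) - (P 0 - z 0) = (dP c - dz c) * (T - 0).
    apply: (@MVT _ (fun s => P s - z s) (fun s => dP s - dz s)) => //.
      move=> c; rewrite in_itv/= => /andP[c0 _].
      have := hP c; have := hz c c0 => ? ?.
      by deriv.
    apply/continuous_within_itvP => //; split.
    - move=> c; rewrite in_itv/= => /andP[c0 _].
      apply: (@deriv_cont _ _ _ (dP c - dz c)).
      by have := hP c; have := hz c c0 => ? ?; deriv.
    - by apply: cvgB => //; exact/cvg_at_right_filter/(deriv_cont (hP 0)).
    - apply: cvgB; first exact/cvg_at_left_filter/(deriv_cont (hP T)).
      exact/cvg_at_left_filter/(deriv_cont (hz T T0)).
  have -> : P T - P 0 - (z T - z 0) = (P T - z T) - (P 0 - z 0) by ring.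
  rewrite e subr0 mulr_ge0 ?(ltW T0)// subr_ge0.
  by rewrite (le_trans (ler_norm _))// hdz//; move: cT; rewrite in_itv.
have h1 := aux _ _ hy y0 hd.
have h2 : 0 <= (P T - P 0) - (- y T - - y 0).
  apply: (aux (fun s => - y s) (fun s => - dy s)).
  - by move=> s s0; have := hy s s0 => ?; deriv.
  - exact: cvgN.
  - by move=> s hs; rewrite normrN hd.
by rewrite ler_norml; apply/andP; split; lra.
Qed.

Lemma trunc_close (N C : R) (r v : R -> R) : 1 <= N -> wintegrable r -> continuous v ->
  (forall u, `|v u| <= C * (1 + `|u|)) ->
  `|\int[mu]_u (r u * v u) - \int[mu]_(u in box N) (r u * v u * chi N u)| <= 4 * C * wtail N r.
Proof.
move=> N1 hr cv bv.
have C0 : 0 <= C by have := le_trans (normr_ge0 _) (bv 0); rewrite normr0 addr0 mulr1.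
have mr := wintegrable_meas hr.
have mv : measurable_fun setT v by exact: meas_cont.
have mc : measurable_fun setT (fun u => chi N u * \1_(box N) u).
  apply: measurable_funM; first by apply: meas_cont => // u; exact: cont_chi.
  by apply: measurable_indic; exact: measurable_itv.
have iC : Rintegrable setT (fun u => C * ((1 + `|u|) * `|r u|)).
  by apply: Rintegrable_mull => //; exact: wintegrable_abs.
have brv u : `|r u * v u| <= C * ((1 + `|u|) * `|r u|).
  by rewrite normrM mulrA mulrC ler_wpM2r.
have irv : Rintegrable setT (fun u => r u * v u).
  by apply: Rintegrable_le iC => //; exact: measurable_funM.
have bt u : `|r u * v u * (1 - chi N u * \1_(box N) u)| <=
    4 * C * ((1 + `|u|) * `|r u| * theta N u).
  rewrite normrM [leRHS](_ : _ = C * ((1 + `|u|) * `|r u|) * (4 * theta N u)); last by ring.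
  by rewrite ler_pM// chi_compl.
have it : Rintegrable setT (fun u => 4 * C * ((1 + `|u|) * `|r u| * theta N u)).
  by apply: Rintegrable_mull => //; exact: wintegrable_tail.
have irest : Rintegrable setT (fun u => r u * v u * (1 - chi N u * \1_(box N) u)).
  apply: Rintegrable_le it => //; apply: measurable_funM; first exact: measurable_funM.
  by apply: measurable_funB => //; exact: measurable_cst.
have irc : Rintegrable setT (fun u => r u * v u * chi N u * \1_(box N) u).
  have := Rintegrable_sub measurableT irv irest; apply: eq_integrable => // u _ /=.
  by congr EFin; ring.
rewrite [X in _ - X]Rint_mkcond -Rint_sub// /wtail -Rint_mull//; last exact: wintegrable_tail.
apply: Rint_abs_le => //; first exact: Rintegrable_sub.
move=> u _; rewrite [X in `|X|](_ : _ = r u * v u * (1 - chi N u * \1_(box N) u)) ?bt//.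
by ring.
Qed.

(** Differentiating the truncated pairing in time, the transport terms cancel
because [v1] and [v2] solve the adjoint system, the generator moves onto the
test functions by [green_identity], and there remain the source and errors that
are small with the tails of [r1], [r2] and [f].  Then [N] tends to infinity.
The function [f] stands for the derivative of the Gaussian profile, and
[g1 + i g2] for the coupling times the first moment. *)
Lemma duality_estimate (a xi kap T C M : R)
  (r1 r1s r1u r1uu r2 r2s r2u r2uu v1 v1s v1u v1uu v2 v2s v2u v2uu : R -> R -> R)
  (g1 g2 f P dP : R -> R) : 0 <= kap -> 0 <= T -> 0 <= M ->
  wcurve r1 -> wcurve r2 ->
  C12 [set s | 0 < s] r1 r1s r1u r1uu -> C12 [set s | 0 < s] r2 r2s r2u r2uu ->
  (forall s u, 0 < s -> r1s s u =
     - (a * u * r2 s u) + gen_fwd xi kap (r1 s) (r1u s) (r1uu s) u - g1 s * f u) ->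
  (forall s u, 0 < s -> r2s s u =
     a * u * r1 s u + gen_fwd xi kap (r2 s) (r2u s) (r2uu s) u - g2 s * f u) ->
  C12 setT v1 v1s v1u v1uu -> C12 setT v2 v2s v2u v2uu ->
  (forall s u, v1s s u = a * u * v2 s u - gen_bwd xi kap (v1 s) (v1u s) (v1uu s) u) ->
  (forall s u, v2s s u = - (a * u * v1 s u) - gen_bwd xi kap (v2 s) (v2u s) (v2uu s) u) ->
  (forall s u, s <= T -> `|v1 s u| <= C * (1 + `|u|)) ->
  (forall s u, s <= T -> `|v2 s u| <= C * (1 + `|u|)) ->
  (forall s u, s <= T -> `|v1u s u| <= C * (1 + `|u|)) ->
  (forall s u, s <= T -> `|v2u s u| <= C * (1 + `|u|)) ->
  wintegrable f -> continuous f ->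
  (forall s, 0 < s < T -> `|g1 s| <= M) -> (forall s, 0 < s < T -> `|g2 s| <= M) ->
  (forall s : R, is_derive s 1 P (dP s)) ->
  (forall s, 0 < s < T -> `|\int[mu]_u (f u * (g1 s * v1 s u - g2 s * v2 s u))| <= dP s) ->
  `|(\int[mu]_u (r1 T u * v1 T u) - \int[mu]_u (r2 T u * v2 T u)) -
    (\int[mu]_u (r1 0 u * v1 0 u) - \int[mu]_u (r2 0 u * v2 0 u))| <= P T - P 0.
Proof.
move=> kap0; rewrite le_eqVlt => /orP[/eqP <-|T0] M0.
  by move=> *; rewrite !subrr normr0.
move=> w1 w2 h1 h2 eq1 eq2 k1 k2 ad1 ad2 b1 b2 b1u b2u wf cf bg1 bg2 hP src.
have C0 : 0 <= C by have := le_trans (normr_ge0 _) (b1 0 0 (ltW T0)); rewrite normr0 addr0 mulr1.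
set K := (8 * (`|xi| + 1) + 40 * kap) * C.
have K0 : 0 <= K by rewrite /K mulr_ge0// addr_ge0 ?mulr_ge0// addr_ge0.
have cv1 s u : {for u, continuous (v1 s)} by have [_ /deriv_cont] := k1 s u I.
have cv2 s u : {for u, continuous (v2 s)} by have [_ /deriv_cont] := k2 s u I.
have cv1u s u : {for u, continuous (v1u s)} by have [_ _ /deriv_cont] := k1 s u I.
have cv2u s u : {for u, continuous (v2u s)} by have [_ _ /deriv_cont] := k2 s u I.
have cv1uu s u : {for u, continuous (v1uu s)}.
  by have [_ _ _ [_ _ c]] := k1 s u I; exact: jointly_continuous_snd c.
have cv2uu s u : {for u, continuous (v2uu s)}.
  by have [_ _ _ [_ _ c]] := k2 s u I; exact: jointly_continuous_snd c.
have cr1 s u : 0 < s -> {for u, continuous (r1 s)} by move=> s0; have [_ /deriv_cont] := h1 s u s0.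
have cr2 s u : 0 < s -> {for u, continuous (r2 s)} by move=> s0; have [_ /deriv_cont] := h2 s u s0.
have cr1u s u : 0 < s -> {for u, continuous (r1u s)} by move=> s0; have [_ _ /deriv_cont] := h1 s u s0.
have cr2u s u : 0 < s -> {for u, continuous (r2u s)} by move=> s0; have [_ _ /deriv_cont] := h2 s u s0.
have cr1uu s u : 0 < s -> {for u, continuous (r1uu s)}.
  by move=> s0; have [_ _ _ [_ _ c]] := h1 s u s0; exact: jointly_continuous_snd c.
have cr2uu s u : 0 < s -> {for u, continuous (r2uu s)}.
  by move=> s0; have [_ _ _ [_ _ c]] := h2 s u s0; exact: jointly_continuous_snd c.
have cf' u : {for u, continuous f} by exact: cf.
have opos : open [set s : R | 0 < s] by exact: open_gt.
pose h s u := g1 s * v1 s u - g2 s * v2 s u.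
have ch s u : {for u, continuous (h s)}.
  by have c1 := cv1 s u; have c2 := cv2 s u; rewrite /h; cont.
have bh s u : 0 < s < T -> `|h s u| <= 2 * M * C * (1 + `|u|).
  move=> hs; have sT : s <= T by case/andP: hs => _ /ltW.
  rewrite /h (le_trans (ler_normB _ _))// !normrM.
  rewrite [leRHS](_ : _ = M * (C * (1 + `|u|)) + M * (C * (1 + `|u|))); last by ring.
  by apply: lerD; apply: ler_pM => //; [exact: bg1|exact: b1|exact: bg2|exact: b2].
set Y := fun s => \int[mu]_u (r1 s u * v1 s u) - \int[mu]_u (r2 s u * v2 s u).
rewrite -/(Y T) -/(Y 0).
(* [e] bounds the three tails at once *)
suff main e : 0 < e -> `|Y T - Y 0| <= P T - P 0 + (2 * K + 8 * M * C) * e * T + 16 * C * e.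
  apply/ler_addgt0Pr => d d0.
  set W := (2 * K + 8 * M * C) * T + 16 * C.
  have MC0 : 0 <= M * C by rewrite mulr_ge0.
  have W0 : 0 <= W.
    rewrite /W addr_ge0//; first by rewrite mulr_ge0 ?(ltW T0)//; move: MC0 K0; lra.
    by rewrite mulr_ge0.
  have e0 : 0 < d / (W + 1) by rewrite divr_gt0// ltr_wpDl.
  apply: le_trans (main _ e0) _.
  rewrite [leLHS](_ : _ = P T - P 0 + W * (d / (W + 1))); last by rewrite /W; ring.
  by rewrite lerD2l mulrCA ler_piMr ?(ltW d0)// ler_pdivrMr ?ltr_wpDl// mul1r lerDl.
move=> e0.
have [n [t1 [t2 tf]]] : exists n, (forall s, 0 <= s <= T -> wtail n.+1%:R (r1 s) <= e) /\
    (forall s, 0 <= s <= T -> wtail n.+1%:R (r2 s) <= e) /\ `|0 - wtail n.+1%:R f| <= e.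
  near \oo => n; exists n; split; last split.
  - by near: n; exact: wcurve_tail.
  - by near: n; exact: wcurve_tail.
  - by near: n; move/cvgrPdist_le : (wtail_cvg0 wf) => /(_ _ e0).
set N := n.+1%:R : R; rewrite -/N in t1 t2 tf.
have N1 : 1 <= N by rewrite ler1n.
have N0 : 0 < N by rewrite (lt_le_trans ltr01).
have {}tf : wtail N f <= e by move: tf; rewrite sub0r normrN => /(le_trans (ler_norm _)).
pose y s := \int[mu]_(u in box N) (r1 s u * v1 s u * chi N u)
  - \int[mu]_(u in box N) (r2 s u * v2 s u * chi N u).
pose dy s := \int[mu]_(u in box N) ((r1s s u * v1 s u + r1 s u * v1s s u) * chi N u)
  - \int[mu]_(u in box N) ((r2s s u * v2 s u + r2 s u * v2s s u) * chi N u).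
have close s : 0 <= s <= T -> `|Y s - y s| <= 8 * C * e.
  move=> hs; have /andP[s0 sT] := hs.
  have c1 := trunc_close N1 (w1.1 s s0) (cv1 s) (fun u => b1 s u sT).
  have c2 := trunc_close N1 (w2.1 s s0) (cv2 s) (fun u => b2 s u sT).
  rewrite /Y /y; set A1 := (X in `|X - _ - _|); set A2 := (X in `|_ - X - _|).
  rewrite [X in `|X|](_ : _ = (A1 - \int[mu]_(u in box N) (r1 s u * v1 s u * chi N u))
    - (A2 - \int[mu]_(u in box N) (r2 s u * v2 s u * chi N u))); last by ring.
  rewrite (le_trans (ler_normB _ _))// (_ : 8 * C * e = 4 * C * e + 4 * C * e); last by ring.
  apply: lerD; [apply: le_trans c1 _|apply: le_trans c2 _]; rewrite ler_wpM2l ?mulr_ge0//.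
    exact: t1.
  exact: t2.
have ydy (s : R) : 0 < s -> is_derive s 1 y (dy s).
  move=> s0; have d1 := trunc_deriv N opos s0 h1 k1.
  have d2 := trunc_deriv N opos s0 h2 k2.
  by rewrite /y; deriv.
have y0 : y s @[s --> 0^'+] --> y 0.
  by apply: cvgB; [exact: (trunc_cvg0 N1 T0 w1 k1 b1)|exact: (trunc_cvg0 N1 T0 w2 k2 b2)].
have dyE s : 0 < s -> dy s =
    \int[mu]_(u in box N) (r1 s u * cutoff_error xi kap N (v1 s) (v1u s) u)
    - \int[mu]_(u in box N) (r2 s u * cutoff_error xi kap N (v2 s) (v2u s) u)
    - \int[mu]_(u in box N) (f u * h s u * chi N u).
  move=> s0.
  have mB : mble (box N) by exact: measurable_itv.
  rewrite -(green_identity _ _ N0 (fun u => let: And4 _ d _ _ := h1 s u s0 in d)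
    (fun u => let: And4 _ _ d _ := h1 s u s0 in d)
    (fun u => let: And4 _ d _ _ := k1 s u I in d)
    (fun u => let: And4 _ _ d _ := k1 s u I in d)
    (fun u => @cr1uu s u s0) (@cv1uu s)).
  rewrite -(green_identity _ _ N0 (fun u => let: And4 _ d _ _ := h2 s u s0 in d)
    (fun u => let: And4 _ _ d _ := h2 s u s0 in d)
    (fun u => let: And4 _ d _ _ := k2 s u I in d)
    (fun u => let: And4 _ _ d _ := k2 s u I in d)
    (fun u => @cr2uu s u s0) (@cv2uu s)).
  have i1 : Rintegrable (box N) (fun u => (gen_fwd xi kap (r1 s) (r1u s) (r1uu s) u * v1 s u -
      r1 s u * gen_bwd xi kap (v1 s) (v1u s) (v1uu s) u) * chi N u).
    apply: Rintegrable_cont => u.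
    suff : {for u, continuous (fun u => (gen_fwd xi kap (r1 s) (r1u s) (r1uu s) u * v1 s u -
      r1 s u * gen_bwd xi kap (v1 s) (v1u s) (v1uu s) u) * chi N u)} by [].
    have := cr1 s u s0; have := cr1u s u s0; have := cr1uu s u s0; have := @cont_chi _ N u.
    have := cv1 s u; have := cv1u s u; have := cv1uu s u => *.
    by rewrite /gen_fwd /gen_bwd; cont.
  have i2 : Rintegrable (box N) (fun u => (gen_fwd xi kap (r2 s) (r2u s) (r2uu s) u * v2 s u -
      r2 s u * gen_bwd xi kap (v2 s) (v2u s) (v2uu s) u) * chi N u).
    apply: Rintegrable_cont => u.
    suff : {for u, continuous (fun u => (gen_fwd xi kap (r2 s) (r2u s) (r2uu s) u * v2 s u -
      r2 s u * gen_bwd xi kap (v2 s) (v2u s) (v2uu s) u) * chi N u)} by [].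
    have := cr2 s u s0; have := cr2u s u s0; have := cr2uu s u s0; have := @cont_chi _ N u.
    have := cv2 s u; have := cv2u s u; have := cv2uu s u => *.
    by rewrite /gen_fwd /gen_bwd; cont.
  have i3 : Rintegrable (box N) (fun u => f u * h s u * chi N u).
    apply: Rintegrable_cont => u.
    suff : {for u, continuous (fun u => f u * h s u * chi N u)} by [].
    by have := cf' u; have := ch s u; have := @cont_chi _ N u => *; cont.
  have i4 : Rintegrable (box N) (fun u => (r1s s u * v1 s u + r1 s u * v1s s u) * chi N u).
    apply: Rintegrable_cont => u.
    suff : {for u, continuous (fun u => (r1s s u * v1 s u + r1 s u * v1s s u) * chi N u)} by [].
    have [_ _ _ [/jointly_continuous_snd c1 _ _]] := h1 s u s0; have [_ _ _ [/jointly_continuous_snd c2 _ _]] := k1 s u I.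
    by have := cr1 s u s0; have := cv1 s u; have := @cont_chi _ N u => *; cont.
  have i5 : Rintegrable (box N) (fun u => (r2s s u * v2 s u + r2 s u * v2s s u) * chi N u).
    apply: Rintegrable_cont => u.
    suff : {for u, continuous (fun u => (r2s s u * v2 s u + r2 s u * v2s s u) * chi N u)} by [].
    have [_ _ _ [/jointly_continuous_snd c1 _ _]] := h2 s u s0; have [_ _ _ [/jointly_continuous_snd c2 _ _]] := k2 s u I.
    by have := cr2 s u s0; have := cv2 s u; have := @cont_chi _ N u => *; cont.
  rewrite /dy -!Rint_sub//; last exact: Rintegrable_sub.
  by apply: Rint_eq => u _; rewrite eq1// eq2// ad1 ad2 /h; ring.
have bdy s : 0 < s < T -> `|dy s| <= dP s + (2 * K + 8 * M * C) * e.
  move=> hs; have /andP[s0 sT] := hs.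
  have hs' : 0 <= s <= T by rewrite !ltW.
  rewrite dyE//.
  have e1 := cutoff_error_int xi N1 kap0 (fun u => cr1 s u s0) (cv1 s) (cv1u s) (w1.1 s (ltW s0))
    (fun u => b1 s u (ltW sT)) (fun u => b1u s u (ltW sT)).
  have e2 := cutoff_error_int xi N1 kap0 (fun u => cr2 s u s0) (cv2 s) (cv2u s) (w2.1 s (ltW s0))
    (fun u => b2 s u (ltW sT)) (fun u => b2u s u (ltW sT)).
  rewrite -/K in e1 e2.
  have e3 := trunc_close N1 wf (ch s) (fun u => bh s u hs).
  have e4 := src s hs; rewrite -/(h s) in e4.
  have T1 := ler_wpM2l K0 (t1 s hs'); have T2 := ler_wpM2l K0 (t2 s hs').
  have MC0 : 0 <= 4 * (2 * M * C) by rewrite !mulr_ge0.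
  have T3 := ler_wpM2l MC0 tf.
  move: e1 e2 e3 e4 T1 T2 T3.
  set A1 := \int[mu]_(u in box N) _; set A2 := \int[mu]_(u in box N) _.
  set A3 := \int[mu]_(u in box N) _.
  rewrite [X in _ -> _ -> _ -> `|X| <= _ -> _](_ : _ = \int[mu]_u (f u * h s u)); last by [].
  set A4 := \int[mu]_u _ => e1 e2 e3 e4 T1 T2 T3.
  have -> : A1 - A2 - A3 = A1 - A2 + (A4 - A3) - A4 by ring.
  apply: le_trans (ler_normB _ _) _.
  apply: le_trans (lerD (ler_normD _ _) (lexx _)) _.
  apply: le_trans (lerD (lerD (ler_normB _ _) (lexx _)) (lexx _)) _.
  by move: e1 e2 e3 e4 T1 T2 T3; lra.
have := @mvt_compare y dy (fun s => P s + (2 * K + 8 * M * C) * e * s)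
  (fun s => dP s + (2 * K + 8 * M * C) * e) T T0 ydy y0.
have hQ (s : R) : is_derive s 1 (fun s => P s + (2 * K + 8 * M * C) * e * s) (dP s + (2 * K + 8 * M * C) * e).
  by have := hP s => ?; deriv; rewrite /=; ring.
move=> /(_ hQ bdy) fin.
have T0' : 0 <= T by exact: ltW.
have hT := close T; have h0 := close 0.
have {}hT : `|Y T - y T| <= 8 * C * e by apply: hT; rewrite T0' lexx.
have {}h0 : `|Y 0 - y 0| <= 8 * C * e by apply: h0; rewrite T0' lexx.
have -> : Y T - Y 0 = (Y T - y T) + (y T - y 0) - (Y 0 - y 0) by ring.
apply: le_trans (ler_normB _ _) _.
apply: le_trans (lerD (ler_normD _ _) (lexx _)) _.
move: hT h0 fin; lra.
Unshelve. all: end_near. Qed.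

End Master.

(** * Backward plane waves *)

Section TestFunction.
Context {R : realType}.
Variables (a xi sg t b al be : R).

(** With [e = exp (- (t - s))] and [b = eta + a], the frequency is
[wave_q = b e - a]; [wave_S] is [int_s^t wave_q^2], and [wave_Q] is
[int_s^t wave_q e] (with [wave_q] and [e] at the integration time), that is half
the derivative of [wave_S] in [eta].  The factors [wave_X] and [wave_Y] come from
differentiating in [eta]: [wave] is the real part of [al] times the complex wave
plus [be] times [i] times its derivative in [eta]. *)
Definition wave_ep (s : R) : R := expR (s - t).
Definition wave_q (s : R) : R := b * wave_ep s - a.
Definition wave_S (s : R) : R :=
  b ^+ 2 * ((1 - wave_ep s ^+ 2) / 2) - 2 * a * b * (1 - wave_ep s) + a ^+ 2 * (t - s).
Definition wave_Q (s : R) : R := b * ((1 - wave_ep s ^+ 2) / 2) - a * (1 - wave_ep s).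
Definition wave_E (s : R) : R := expR (- (sg ^+ 2 / 2 * wave_S s)).
Definition wave_phase (de s u : R) : R :=
  wave_q s * u + xi * (b * (1 - wave_ep s) - a * (t - s)) + de.
Definition wave_X (s u : R) : R := al + be * (u * wave_ep s + xi * (1 - wave_ep s)).
Definition wave_Y (s : R) : R := be * (sg ^+ 2 * wave_Q s).

Definition wave (de s u : R) : R :=
  wave_E s * (wave_X s u * cos (wave_phase de s u) - wave_Y s * sin (wave_phase de s u)).
Definition wave_u (de s u : R) : R :=
  wave_E s * (be * wave_ep s * cos (wave_phase de s u) - wave_X s u * wave_q s * sin (wave_phase de s u)
            - wave_Y s * wave_q s * cos (wave_phase de s u)).
Definition wave_uu (de s u : R) : R :=
  wave_E s * (- (2 * be * wave_ep s * wave_q s * sin (wave_phase de s u))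
            - wave_X s u * wave_q s ^+ 2 * cos (wave_phase de s u)
            + wave_Y s * wave_q s ^+ 2 * sin (wave_phase de s u)).
Definition wave_s (de s u : R) : R :=
  a * u * (wave_E s * (- (wave_X s u * sin (wave_phase de s u)) - wave_Y s * cos (wave_phase de s u)))
  - gen_bwd xi (sg ^+ 2 / 2) (wave de s) (wave_u de s) (wave_uu de s) u.

Lemma wave_quarter de s u : wave (de + pi / 2) s u =
  wave_E s * (- (wave_X s u * sin (wave_phase de s u)) - wave_Y s * cos (wave_phase de s u)).
Proof.
rewrite /wave (_ : wave_phase (de + pi / 2) s u = wave_phase de s u + pi / 2); last by rewrite /wave_phase; ring.
by rewrite cosDpihalf sinDpihalf; ring.
Qed.

Lemma wave_opp de s u : wave (de + pi / 2 + pi / 2) s u = - wave de s u.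
Proof.
rewrite wave_quarter (_ : wave_phase (de + pi / 2) s u = wave_phase de s u + pi / 2); last by rewrite /wave_phase; ring.
by rewrite /wave cosDpihalf sinDpihalf; ring.
Qed.

Lemma wave_adjoint de s u : wave_s de s u =
  a * u * wave (de + pi / 2) s u - gen_bwd xi (sg ^+ 2 / 2) (wave de s) (wave_u de s) (wave_uu de s) u.
Proof. by rewrite wave_quarter. Qed.

Lemma wave_C12 de : C12 setT (wave de) (wave_s de) (wave_u de) (wave_uu de).
Proof.
move=> s u _; split.
- rewrite /wave /wave_E /wave_X /wave_Y /wave_phase /wave_S /wave_Q /wave_q /wave_ep.
  deriv; rewrite /wave_s /gen_bwd /wave_u /wave_uu.
  rewrite /wave_E /wave_X /wave_Y /wave_phase /wave_S /wave_Q /wave_q /wave_ep.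
  set c := cos _; set d := sin _; set e := expR (- (_ * _)); set f := expR _.
  by field.
- rewrite /wave /wave_X /wave_phase.
  by deriv; rewrite /wave_u /wave_X /wave_phase; ring.
- rewrite /wave_u /wave_X /wave_phase.
  by deriv; rewrite /wave_uu /wave_X /wave_phase; ring.
- split; rewrite /jointly_continuous /wave_s /gen_bwd /wave_u /wave_uu /wave_E /wave_X /wave_Y /wave_phase /wave_S /wave_Q /wave_q /wave_ep; by cont.
Qed.

Lemma wave_ep_01 s : s <= t -> 0 < wave_ep s <= 1.
Proof. by move=> st; rewrite /wave_ep expR_gt0/= -expR0 ler_expR subr_le0. Qed.

(** Completing the square in [b] shows that the accumulated squared frequency
falls short of [a^2 (t - s)] by at most [2 a^2], whatever the final frequency. *)
Lemma wave_S_ge s : s <= t -> a ^+ 2 * (t - s - 2) <= wave_S s.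
Proof.
move=> /wave_ep_01; rewrite /wave_S; set e := wave_ep s => /andP[e0 e1].
rewrite -subr_ge0 (_ : _ - _ = (b * (1 - e) - 2 * a) ^+ 2 / 2 + b ^+ 2 * (e * (1 - e))); last by field.
rewrite addr_ge0//; first by rewrite divr_ge0// sqr_ge0.
by rewrite mulr_ge0 ?sqr_ge0// mulr_ge0 ?(ltW e0)// subr_ge0.
Qed.

(** A weak form of the Cauchy-Schwarz inequality between [wave_q] and [e]; the
slack [a^2] makes the difference a sum of nonnegative terms. *)
Lemma wave_Q_le s : s <= t -> wave_Q s ^+ 2 <= wave_S s / 2 + a ^+ 2.
Proof.
move=> st; have := wave_ep_01 st; rewrite /wave_S /wave_Q; set e := wave_ep s => /andP[e0 e1].
rewrite -subr_ge0 (_ : _ - _ = e ^+ 2 / 2 * ((b * (1 - e) - 2 * a) ^+ 2 / 2 + b ^+ 2 * (e * (1 - e)))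
   + a ^+ 2 * (t - s) / 2 + 2 * a ^+ 2 * (e * (1 - e))); last by field.
have h : 0 <= e * (1 - e) by rewrite mulr_ge0 ?(ltW e0)// subr_ge0.
apply: addr_ge0; last by rewrite mulr_ge0// mulr_ge0// sqr_ge0.
apply: addr_ge0; last by rewrite divr_ge0// mulr_ge0 ?sqr_ge0// subr_ge0.
apply: mulr_ge0; first by rewrite divr_ge0// sqr_ge0.
by rewrite addr_ge0//; [rewrite divr_ge0// sqr_ge0|rewrite mulr_ge0// sqr_ge0].
Qed.

Lemma wave_E_gt0 s : 0 < wave_E s. Proof. exact: expR_gt0. Qed.

Lemma wave_E_le s : s <= t -> wave_E s <= expR (- (sg ^+ 2 * a ^+ 2 / 2 * (t - s - 2))).
Proof.
move=> st; rewrite /wave_E ler_expR lerN2.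
rewrite [leLHS](_ : _ = sg ^+ 2 / 2 * (a ^+ 2 * (t - s - 2))); last by ring.
by rewrite ler_wpM2l ?wave_S_ge// divr_ge0// sqr_ge0.
Qed.

Lemma wave_E_bound s : s <= t -> wave_E s <= expR (sg ^+ 2 * a ^+ 2).
Proof.
move=> st; apply: le_trans (wave_E_le st) _; rewrite ler_expR.
rewrite -subr_ge0 (_ : _ - _ = sg ^+ 2 * a ^+ 2 / 2 * (t - s)); last by field.
by rewrite mulr_ge0 ?subr_ge0// divr_ge0// mulr_ge0 ?sqr_ge0.
Qed.

(** The factor [wave_Q] is unbounded in the frequency, but it is at most [1 + z]
where [wave_E] decays like [exp (- sg^2 z)]. *)
Lemma wave_EQ_bound s : 0 < sg -> s <= t ->
  wave_E s * `|wave_Q s| <= expR (sg ^+ 2 * a ^+ 2) * (1 + (sg ^+ 2)^-1).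
Proof.
move=> sg0 st; set z := wave_S s / 2 + a ^+ 2.
have s20 : 0 < sg ^+ 2 by rewrite exprn_gt0.
have z0 : 0 <= z by rewrite (le_trans (sqr_ge0 _) (wave_Q_le st)).
have -> : wave_E s = expR (sg ^+ 2 * a ^+ 2) * expR (- (sg ^+ 2 * z)).
  by rewrite -expRD /wave_E /z; congr expR; field.
rewrite -mulrA ler_pM2l ?expR_gt0//.
have hQ : `|wave_Q s| <= 1 + z.
  have := wave_Q_le st; rewrite -/z -(real_normK (num_real (wave_Q s))).
  have := normr_ge0 (wave_Q s); set y := `|_|; nra.
apply: le_trans (ler_wpM2l (ltW (expR_gt0 _)) hQ) _.
rewrite mulrDr mulr1 lerD//.
  by rewrite -expR0 ler_expR oppr_le0 mulr_ge0// ltW.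
rewrite expRN mulrC ler_pdivrMr ?expR_gt0// mulrC ler_pdivlMr//.
rewrite mulrC (le_trans _ (expR_ge1Dx _))// lerDr//.
Qed.

(** It depends neither on the final time nor on the final frequency. *)
Definition wave_amp : R :=
  expR (sg ^+ 2 * a ^+ 2) * (`|al| + `|be| * (1 + `|xi|))
  + `|be| * (sg ^+ 2 * (expR (sg ^+ 2 * a ^+ 2) * (1 + (sg ^+ 2)^-1))).

Lemma wave_amp_ge0 : 0 <= wave_amp.
Proof.
have h1 : 0 <= expR (sg ^+ 2 * a ^+ 2) by exact: expR_ge0.
have h2 : 0 <= (sg ^+ 2)^-1 by rewrite invr_ge0 sqr_ge0.
have h3 : 0 <= `|al| + `|be| * (1 + `|xi|) by apply: addr_ge0 => //; apply: mulr_ge0 => //; apply: addr_ge0.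
apply: addr_ge0; first exact: mulr_ge0.
apply: mulr_ge0 => //; apply: mulr_ge0; first exact: sqr_ge0.
by apply: mulr_ge0 => //; apply: addr_ge0.
Qed.

Lemma norm_cos (x : R) : `|cos x| <= 1.
Proof. by rewrite ler_norml cos_geN1 cos_le1. Qed.

Lemma norm_sin (x : R) : `|sin x| <= 1.
Proof. by rewrite ler_norml sin_geN1 sin_le1. Qed.

Lemma wave_EX s u : s <= t -> wave_E s * `|wave_X s u| <=
  expR (sg ^+ 2 * a ^+ 2) * (`|al| + `|be| * (1 + `|xi|)) * (1 + `|u|).
Proof.
move=> st; have /andP[e0 e1] := wave_ep_01 st.
rewrite -mulrA ler_pM ?wave_E_bound ?expR_ge0//.
rewrite /wave_X (le_trans (ler_normD _ _))// normrM.
have h : `|u * wave_ep s + xi * (1 - wave_ep s)| <= (1 + `|xi|) * (1 + `|u|).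
  rewrite (le_trans (ler_normD _ _))// !normrM (gtr0_norm e0).
  have : `|1 - wave_ep s| <= 1 by rewrite ger0_norm ?subr_ge0//; lra.
  have := normr_ge0 u; have := normr_ge0 xi; have := normr_ge0 (1 - wave_ep s).
  by set x := `|u|; set y := `|xi|; set z := `|1 - _| => *; nra.
rewrite mulrDl; apply: lerD; first by rewrite ler_peMr// lerDl.
by rewrite -mulrA ler_wpM2l.
Qed.

Lemma wave_EY s : 0 < sg -> s <= t -> wave_E s * `|wave_Y s| <=
  `|be| * (sg ^+ 2 * (expR (sg ^+ 2 * a ^+ 2) * (1 + (sg ^+ 2)^-1))).
Proof.
move=> sg0 st; rewrite /wave_Y normrM mulrCA ler_wpM2l//.
rewrite normrM (ger0_norm (sqr_ge0 _)) mulrCA ler_wpM2l ?sqr_ge0//.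
exact: wave_EQ_bound.
Qed.

Lemma wave_bound de s u : 0 < sg -> s <= t -> `|wave de s u| <= wave_amp * (1 + `|u|).
Proof.
move=> sg0 st; rewrite /wave normrM (gtr0_norm (wave_E_gt0 s)).
have h1 := wave_EX u st; have h2 := wave_EY sg0 st.
apply: le_trans (_ : wave_E s * `|wave_X s u| + wave_E s * `|wave_Y s| <= _).
  rewrite -mulrDr ler_pM2l ?wave_E_gt0// (le_trans (ler_normB _ _))// !normrM.
  by apply: lerD; rewrite ler_piMr// ?norm_cos ?norm_sin.
rewrite /wave_amp mulrDl; apply: lerD => //.
apply: le_trans h2 _; rewrite ler_peMr ?lerDl//.
by rewrite mulr_ge0// mulr_ge0 ?sqr_ge0// mulr_ge0 ?expR_ge0// addr_ge0 ?invr_ge0 ?sqr_ge0.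
Qed.

Lemma wave_q_bound s : s <= t -> `|wave_q s| <= `|b| + `|a|.
Proof.
move=> /wave_ep_01 /andP[e0 e1]; rewrite /wave_q (le_trans (ler_normB _ _))// lerD2r.
by rewrite normrM (gtr0_norm e0) ler_piMr.
Qed.

Lemma wave_u_bound de s u : 0 < sg -> s <= t -> `|wave_u de s u| <=
  (wave_amp * (`|b| + `|a|) + expR (sg ^+ 2 * a ^+ 2) * `|be|) * (1 + `|u|).
Proof.
move=> sg0 st; rewrite /wave_u normrM (gtr0_norm (wave_E_gt0 s)).
have /andP[e0 e1] := wave_ep_01 st.
have h1 := wave_EX u st; have h2 := wave_EY sg0 st; have hq := wave_q_bound st.
have h0 := wave_E_bound st.
apply: le_trans (_ : wave_E s * `|be| + (wave_E s * `|wave_X s u| + wave_E s * `|wave_Y s|) * `|wave_q s| <= _).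
  rewrite [leRHS](_ : _ = wave_E s * (`|be| + `|wave_X s u| * `|wave_q s| + `|wave_Y s| * `|wave_q s|)); last by ring.
  rewrite ler_pM2l ?wave_E_gt0//.
  apply: le_trans (ler_normB _ _) _; apply: lerD; last first.
    by rewrite !normrM ler_piMr ?norm_cos// mulr_ge0.
  apply: le_trans (ler_normB _ _) _; apply: lerD; last first.
    by rewrite !normrM ler_piMr ?norm_sin// mulr_ge0.
  rewrite !normrM (gtr0_norm e0) -mulrA ler_piMr//.
  by rewrite mulr_ile1 ?norm_cos// ltW.
rewrite [leRHS]mulrDl [leRHS]addrC; apply: lerD.
  rewrite -mulrA ler_pM ?expR_ge0//.
  by rewrite ler_peMr// lerDl.
rewrite mulrAC; apply: ler_pM => //; first by rewrite addr_ge0// mulr_ge0 ?expR_ge0.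
rewrite /wave_amp mulrDl; apply: lerD => //.
apply: le_trans h2 _; rewrite ler_peMr ?lerDl//.
by rewrite mulr_ge0// mulr_ge0 ?sqr_ge0// mulr_ge0 ?expR_ge0// addr_ge0 ?invr_ge0 ?sqr_ge0.
Qed.

End TestFunction.

(** * Gaussian integrals against waves *)

Section Gaussian.
Context {R : realType}.
Local Notation mu := (@lebesgue_measure R).
Local Notation Rintegrable D f := (mu.-integrable D (EFin \o f)).
Variables (sg xi : R).
Hypothesis sg0 : 0 < sg.

Let F := F_ sg xi.
Definition dgauss (u : R) : R := - (2 / sg ^+ 2 * (u - xi)) * F_ sg xi u.
Local Notation dF := dgauss.
(** A Gaussian of twice the variance: it absorbs the polynomial factors met
below. *)
Definition wide_gauss (u : R) : R := expR (- ((u - xi) ^+ 2 / (2 * sg ^+ 2))).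
Local Notation g := wide_gauss.
Local Notation peak := (Num.sqrt (pi * sg ^+ 2))^-1.

Let s20 : 0 < sg ^+ 2. Proof. exact: exprn_gt0. Qed.
Let s2n : sg != 0. Proof. by rewrite gt_eqF. Qed.
Let peak0 : 0 < peak :> R.
Proof. by rewrite invr_gt0 sqrtr_gt0 mulr_gt0// pi_gt0. Qed.

Lemma gauss_gt0 u : 0 < F u.
Proof. by rewrite /F /F_ mulr_gt0 ?expR_gt0. Qed.

Lemma is_derive_gauss (u : R) : is_derive u 1 F (dF u).
Proof. by rewrite /F /F_; deriv; rewrite /dgauss /F_; set P := (Num.sqrt _)^-1; field. Qed.

Lemma cont_gauss (u : R) : {for u, continuous F}.
Proof. exact: deriv_cont (is_derive_gauss u). Qed.

Lemma cont_dgauss (u : R) : {for u, continuous dF}.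
Proof. have -> : dF = (fun u => - (2 / sg ^+ 2 * (u - xi)) * F_ sg xi u) by []. rewrite /F_; cont. Qed.

Lemma Rintegrable_wide : Rintegrable setT g.
Proof.
have h := integrable_normal_pdf xi sg.
have := Rintegrable_mull (normal_peak sg)^-1 measurableT h; apply: eq_integrable => // u _ /=.
congr EFin; rewrite normal_pdfE// mulKf ?gt_eqF ?normal_peak_gt0//.
by rewrite /normal_fun /wide_gauss; congr expR; rewrite mulNr -(mulr_natl (sg ^+ 2)).
Qed.

Lemma gauss_integral1 : \int[mu]_u F u = 1.
Proof.
have r2 : 0 < Num.sqrt 2 :> R by rewrite sqrtr_gt0.
have r22 : (Num.sqrt 2 : R) ^+ 2 = 2 by rewrite sqr_sqrtr.
have h := integral_normal_pdf xi (sg / Num.sqrt 2).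
have -> : \int[mu]_u F u = \int[mu]_u normal_pdf xi (sg / Num.sqrt 2) u.
  2: by rewrite /Rintegral h.
apply: Rint_eq => u _; rewrite normal_pdfE; last by rewrite mulf_neq0 ?invr_neq0 ?gt_eqF.
rewrite /F /F_ /normal_peak /normal_fun.
have e : (sg / Num.sqrt 2) ^+ 2 *+ 2 = sg ^+ 2.
  by rewrite expr_div_n r22 -mulr_natr divfK.
by rewrite -mulrnAl e (mulrC (sg ^+ 2)).
Qed.

(** [F = wide_gauss * exp (- y) ] up to a constant, where [y] is a multiple of
[(u - xi)^2], and [y exp (- y) <= 1]. *)
Lemma gauss_dominated (A B : R) (p : R -> R) : 0 <= A -> 0 <= B ->
  (forall u, `|p u| <= A + B * (u - xi) ^+ 2) ->
  forall u, `|p u * F u| <= (A + 2 * B * sg ^+ 2) * peak * g u.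
Proof.
move=> A0 B0 hp u; rewrite normrM (gtr0_norm (gauss_gt0 u)).
apply: le_trans (ler_wpM2r (ltW (gauss_gt0 u)) (hp u)) _.
set y := (u - xi) ^+ 2 / (2 * sg ^+ 2).
have y0 : 0 <= y by rewrite divr_ge0 ?sqr_ge0// mulr_ge0// ltW.
have -> : F u = peak * (g u * expR (- y)).
  rewrite /F /F_ /wide_gauss -expRD; congr (_ * expR _); rewrite /y; field.
  by rewrite s2n.
have -> : (u - xi) ^+ 2 = 2 * sg ^+ 2 * y by rewrite /y; field.
rewrite [leLHS](_ : _ = (A * expR (- y) + 2 * B * sg ^+ 2 * (y * expR (- y))) * (peak * g u)); last by ring.
rewrite -[leRHS]mulrA ler_pM2r; last by rewrite mulr_gt0// expR_gt0.
apply: lerD.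
  by rewrite ler_piMr// -expR0 ler_expR oppr_le0.
rewrite ler_piMr//; first by rewrite mulr_ge0 ?(ltW s20)// mulr_ge0.
rewrite expRN ler_pdivrMr ?expR_gt0// mul1r.
by rewrite (le_trans _ (expR_ge1Dx _))// lerDr.
Qed.

Lemma Rintegrable_gauss_poly (A B : R) (p : R -> R) : 0 <= A -> 0 <= B ->
  continuous p -> (forall u, `|p u| <= A + B * (u - xi) ^+ 2) ->
  Rintegrable setT (fun u => p u * F u).
Proof.
move=> A0 B0 cp hp.
apply: (Rintegrable_le _ _ (fun u _ => gauss_dominated A0 B0 hp u)) => //.
  apply: meas_cont => // u; suff : {for u, continuous (fun u => p u * F u)} by [].
  by have c1 : {for u, continuous p} := cp u; have c2 := @cont_gauss u; cont.
by apply: Rintegrable_mull => //; exact: Rintegrable_wide.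
Qed.

Lemma gauss_decay (H : R -> R) (C : R) : (forall u, `|H u| <= C * g u) ->
  H n.+1%:R @[n --> \oo] --> (0 : R) /\ H (- n.+1%:R) @[n --> \oo] --> (0 : R).
Proof.
move=> hH.
have C0 : 0 <= C.
  by have := le_trans (normr_ge0 _) (hH xi); rewrite /wide_gauss pmulr_lge0 ?expR_gt0.
pose r := Num.sqrt (2 * sg ^+ 2) : R.
have r0 : 0 < r by rewrite sqrtr_gt0 mulr_gt0.
have gE u : g u = gauss_fun ((u - xi) / r) .
  by rewrite /gauss_fun expr_div_n sqr_sqrtr// mulr_ge0// ltW.
have gN u : g u = gauss_fun ((- u + xi) / r).
  by rewrite gE /gauss_fun; congr expR; ring.
have aux (x : R) : gauss_fun ((n.+1%:R + x) / r) @[n --> \oo] --> (0 : R).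
  apply: (cvg_comp (fun n => (n.+1%:R + x) / r)); last exact: cvg_gauss_fun.
  apply/cvgryPge => A; near=> n.
  rewrite ler_pdivlMr// -lerBlDr.
  near: n; exists (Num.truncn `|A * r - x|) => // n /= hn.
  rewrite (le_trans (ler_norm _))// (le_trans (ltW (truncnS_gt _)))// ler_nat ltnS //.
have cC (x : R) : C * gauss_fun ((n.+1%:R + x) / r) @[n --> \oo] --> (0 : R).
  by rewrite -[X in _ --> X](mulr0 C); apply: cvgM; [exact: cvg_cst|exact: aux].
have squeeze (h e : nat -> R) : (forall n, `|h n| <= e n) -> e @ \oo --> (0 : R) -> h @ \oo --> (0 : R).
  move=> he ce; apply: norm_cvg0.
  by apply: (squeeze_cvgr _ (cvg_cst 0) ce); apply: nearW => n; rewrite normr_ge0 he.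
split.
- by apply: squeeze (cC (- xi)) => n; rewrite -gE.
- by apply: squeeze (cC xi) => n; rewrite -{2}[n.+1%:R]opprK -gN.
Unshelve. all: end_near. Qed.

Definition gauss_wave (q k : R) : R := \int[mu]_u (F u * cos (q * (u - xi) + k)).

Lemma Rintegrable_gauss_cos (p : R -> R) q k A B : 0 <= A -> 0 <= B ->
  continuous p -> (forall u, `|p u| <= A + B * (u - xi) ^+ 2) ->
  Rintegrable setT (fun u => p u * F u * cos (q * (u - xi) + k)).
Proof.
move=> A0 B0 cp hp.
have := @Rintegrable_gauss_poly A B (fun u => p u * cos (q * (u - xi) + k)) A0 B0.
move=> h; have {}h := h _ _.
have : Rintegrable setT (fun u => p u * cos (q * (u - xi) + k) * F u).
  apply: h.
  - move=> u; suff : {for u, continuous (fun u => p u * cos (q * (u - xi) + k))} by [].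
    by have c1 : {for u, continuous p} := cp u; cont.
  - by move=> u; rewrite normrM (le_trans _ (hp u))// ler_piMr// norm_cos.
by apply: eq_integrable => // u _ /=; congr EFin; ring.
Qed.

Lemma Rintegrable_gauss_cos1 q k : Rintegrable setT (fun u => F u * cos (q * (u - xi) + k)).
Proof.
have h : Rintegrable setT (fun u => 1 * F u * cos (q * (u - xi) + k)).
  apply: (@Rintegrable_gauss_cos (fun=> 1) q k 1 0) => //.
    by move=> u; exact: cst_continuous.
  by move=> u; rewrite normr1 mul0r addr0.
by move: h; apply: eq_integrable => // u _ /=; rewrite mul1r.
Qed.

Let dist_poly (u : R) : `|u - xi| <= 1 + 1 * (u - xi) ^+ 2.
Proof.
rewrite mul1r -(real_normK (num_real (u - xi))).
by have := normr_ge0 (u - xi); set x := `|_|; nra.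
Qed.

Let cont_dist (u : R) : {for u, continuous (fun u => u - xi)}.
Proof. by cont. Qed.

Lemma Rintegrable_dgauss_cos (q k : R) : Rintegrable setT (fun u => dF u * cos (q * (u - xi) + k)).
Proof.
have : Rintegrable setT (fun u => - (2 / sg ^+ 2) * ((u - xi) * F u * cos (q * (u - xi) + k))).
  apply: Rintegrable_mull => //; apply: (@Rintegrable_gauss_cos (fun u => u - xi) q _ 1 1) => //.
by apply: eq_integrable => // u _ /=; congr EFin; rewrite /dgauss -/F; ring.
Qed.

Lemma dgauss_cos_integral (q k : R) :
  \int[mu]_u (dF u * cos (q * (u - xi) + k)) = - (q * gauss_wave q (k + pi / 2)).
Proof.
have i1 := Rintegrable_dgauss_cos q k.
have i2 : Rintegrable setT (fun u => q * (F u * cos (q * (u - xi) + (k + pi / 2)))).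
  by apply: Rintegrable_mull => //; apply: Rintegrable_gauss_cos1.
apply/eqP; rewrite -subr_eq0 opprK /gauss_wave -Rint_mull//; last exact: Rintegrable_gauss_cos1.
rewrite -Rint_add//; apply/eqP.
have dH (u : R) : is_derive u 1 (fun u => F u * cos (q * (u - xi) + k))
    (dF u * cos (q * (u - xi) + k) + q * (F u * cos (q * (u - xi) + (k + pi / 2)))).
  have := is_derive_gauss u => ?; deriv.
  by rewrite (_ : _ + (k + pi / 2) = q * (u - xi) + k + pi / 2) ?cosDpihalf; ring.
have [b1 b2] : (fun n => F n.+1%:R * cos (q * (n.+1%:R - xi) + k)) @ \oo --> (0:R) /\
   (fun n => F (- n.+1%:R) * cos (q * (- n.+1%:R - xi) + k)) @ \oo --> (0:R).
  apply: (gauss_decay (C := (1 + 2 * 0 * sg ^+ 2) * peak)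
    (H := fun u => F u * cos (q * (u - xi) + k))) => u.
  rewrite mulrC.
  apply: (@gauss_dominated 1 0 (fun u => cos (q * (u - xi) + k)) ler01 (lexx _)) => w.
  by rewrite mul0r addr0 norm_cos.
apply: (FTC_line dH) => //; last exact: Rintegrable_add.
move=> u; have := @cont_gauss u; have := @cont_dgauss u => c1 c2.
suff : {for u, continuous (fun u => dF u * cos (q * (u - xi) + k) +
  q * (F u * cos (q * (u - xi) + (k + pi / 2))))} by [].
by cont.
Qed.

Lemma gauss_wave_opp (q k : R) : gauss_wave q (k + pi / 2 + pi / 2) = - gauss_wave q k.
Proof.
rewrite /gauss_wave -[RHS]mulN1r -Rint_mull//; last exact: Rintegrable_gauss_cos1.
by apply: Rint_eq => u _; rewrite !addrA !cosDpihalf sinDpihalf; ring.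
Qed.

(** Differentiating in [q] brings down [u - xi], and [(u - xi) F] is a multiple of
[F'], which is then integrated by parts: the characteristic function of the
Gaussian solves a linear differential equation in [q]. *)
Lemma is_derive_gauss_wave (q k : R) : is_derive q 1 (gauss_wave ^~ k) (- (sg ^+ 2 / 2 * q * gauss_wave q k)).
Proof.
pose f q u := F u * cos (q * (u - xi) + k).
pose df q u := - (F u * (u - xi) * sin (q * (u - xi) + k)).
have hd (p u : R) : is_derive p 1 (f ^~ u) (df p u).
  by rewrite /f /df; deriv; ring.
have I0 : `]q - 1, q + 1[%classic q by rewrite /= in_itv/= ltrBlDr ltrDl ltr01.
pose G u := `|(u - xi) * F u|.
have G0 u : 0 <= G u by rewrite /G.
have iG : Rintegrable setT G.
  by apply: Rintegrable_abs => //; apply: (@Rintegrable_gauss_poly 1 1) => //; move=> u; exact: cont_dist.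
have pE p u : partial1of2 f p u = df p u.
  by rewrite partial1of2E; have [_ ->] := hd p u.
have hG p u : `]q - 1, q + 1[%classic p -> [set: R] u -> `|partial1of2 f p u| <= G u.
  move=> _ _; rewrite pE /df normrN /G normrM (mulrC (F u)) ler_piMr//.
  exact: norm_sin.
have intf p : `]q - 1, q + 1[%classic p -> Rintegrable setT (f p).
  by move=> _; exact: Rintegrable_gauss_cos1.
have derf p u : `]q - 1, q + 1[%classic p -> [set: R] u -> derivable (f ^~ u) p 1.
  by move=> _ _; case: (hd p u).
have d1 := @derivable_under_integral R _ (measurableTypeR R) mu f _ measurableT _ _ _ I0 intf derf G G0 iG hG.
have d2 := @differentiation_under_integral R _ (measurableTypeR R) mu f _ measurableT _ _ _ I0 intf derf G G0 iG hG.
split; first exact: d1.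
rewrite -derive1E d2.
have h := dgauss_cos_integral q (k + pi / 2).
rewrite gauss_wave_opp mulrN opprK in h.
rewrite -mulrA -h -mulNr -Rint_mull//.
  apply: Rint_eq => u _; rewrite pE /df addrA cosDpihalf /dgauss -/F.
  by field.
exact: Rintegrable_dgauss_cos.
Qed.

Lemma gauss_waveE (q k : R) : gauss_wave q k = expR (- (sg ^+ 2 * q ^+ 2 / 4)) * cos k.
Proof.
have h (p : R) : is_derive p 1 (fun p => gauss_wave p k * expR (sg ^+ 2 * p ^+ 2 / 4)) 0.
  by have := is_derive_gauss_wave p k => ?; deriv; field.
have := is_derive_0_is_cst q 0 h; rewrite expr0n /= mulr0 mul0r expR0 mulr1.
have -> : gauss_wave 0 k = cos k.
  rewrite /gauss_wave -[RHS]mulr1 -gauss_integral1 -Rint_mull//.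
    by apply: Rint_eq => u _; rewrite mul0r add0r mulrC.
  have := Rintegrable_gauss_cos1 0 0; apply: eq_integrable => // u _ /=.
  by rewrite mul0r add0r cos0 mulr1.
move=> <-; rewrite expRN. by rewrite mulrC mulfK ?gt_eqF ?expR_gt0.
Qed.

Lemma Rintegrable_dist_dgauss_cos (q k : R) :
  Rintegrable setT (fun u => (u - xi) * dF u * cos (q * (u - xi) + k)).
Proof.
have : Rintegrable setT (fun u => - (2 / sg ^+ 2) * ((u - xi) ^+ 2 * F u * cos (q * (u - xi) + k))).
  apply: Rintegrable_mull => //; apply: (@Rintegrable_gauss_cos (fun u => (u - xi) ^+ 2) q _ 0 1) => //.
    by move=> u; suff : {for u, continuous (fun u => (u - xi) ^+ 2)} by []; cont.
  by move=> u; rewrite add0r mul1r ger0_norm// sqr_ge0.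
by apply: eq_integrable => // u _ /=; congr EFin; rewrite /dgauss -/F; ring.
Qed.

Lemma dist_dgauss_cos_integral (q k : R) :
  \int[mu]_u ((u - xi) * dF u * cos (q * (u - xi) + k)) =
  (sg ^+ 2 / 2 * q ^+ 2 - 1) * gauss_wave q k.
Proof.
have i1 := Rintegrable_dist_dgauss_cos q k.
have i2 := Rintegrable_dgauss_cos q (k + pi / 2).
have i3 := Rintegrable_gauss_cos1 q k.
have dH (u : R) : is_derive u 1 (fun u => (u - xi) * F u * cos (q * (u - xi) + k))
    (F u * cos (q * (u - xi) + k) + ((u - xi) * dF u * cos (q * (u - xi) + k)
     - q * (sg ^+ 2 / 2) * (dF u * cos (q * (u - xi) + (k + pi / 2))))).
  have := is_derive_gauss u => ?; deriv.
  rewrite (_ : _ + (k + pi / 2) = q * (u - xi) + k + pi / 2); last by ring.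
  by rewrite cosDpihalf /dgauss -/F; field.
have [b1 b2] : (fun n => (n.+1%:R - xi) * F n.+1%:R * cos (q * (n.+1%:R - xi) + k)) @ \oo --> (0:R) /\
   (fun n => (- n.+1%:R - xi) * F (- n.+1%:R) * cos (q * (- n.+1%:R - xi) + k)) @ \oo --> (0:R).
  apply: (gauss_decay (C := (1 + 2 * 1 * sg ^+ 2) * peak)
    (H := fun u => (u - xi) * F u * cos (q * (u - xi) + k))) => u.
  rewrite mulrAC.
  apply: (@gauss_dominated 1 1 (fun u => (u - xi) * cos (q * (u - xi) + k)) ler01 ler01) => w.
  by rewrite normrM (le_trans (ler_piMr _ (norm_cos _)))// dist_poly.
have i23 := Rintegrable_sub measurableT i1 (Rintegrable_mull (q * (sg ^+ 2 / 2)) measurableT i2).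
have := FTC_line dH; move=> /(_ _ (Rintegrable_add measurableT i3 i23) b1 b2) h.
have {}h := h _.
have : \int[mu]_u (F u * cos (q * (u - xi) + k) + ((u - xi) * dF u * cos (q * (u - xi) + k)
     - q * (sg ^+ 2 / 2) * (dF u * cos (q * (u - xi) + (k + pi / 2))))) = 0.
  apply: h => u.
  suff : {for u, continuous (fun u => F u * cos (q * (u - xi) + k) + ((u - xi) * dF u * cos (q * (u - xi) + k)
     - q * (sg ^+ 2 / 2) * (dF u * cos (q * (u - xi) + (k + pi / 2)))))} by [].
  by have := @cont_gauss u; have := @cont_dgauss u => c1 c2; cont.
rewrite Rint_add// Rint_sub//; last by apply: Rintegrable_mull.
rewrite Rint_mull// dgauss_cos_integral gauss_wave_opp -/(gauss_wave q k).
set I := \int[mu]_u _ => e.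
have -> : I = gauss_wave q k + (I - q * (sg ^+ 2 / 2) * - (q * - gauss_wave q k)) - gauss_wave q k
  + q * (sg ^+ 2 / 2) * - (q * - gauss_wave q k) by ring.
by rewrite e; ring.
Qed.

Lemma wintegrable_dgauss : wintegrable dF.
Proof.
have cd : continuous dF by move=> u; exact: cont_dgauss.
split.
  have := Rintegrable_dgauss_cos 0 0; apply: eq_integrable => // u _ /=.
  by rewrite mul0r add0r cos0 mulr1.
have K0 : 0 <= 2 / sg ^+ 2 by rewrite divr_ge0// ltW.
have h : Rintegrable setT (fun u => (1 + `|u|) * - (2 / sg ^+ 2 * (u - xi)) * F u).
  apply: (@Rintegrable_gauss_poly (2 / sg ^+ 2 * (1 + `|xi|)) (2 / sg ^+ 2 * (2 + `|xi|))).
  - by rewrite mulr_ge0// addr_ge0.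
  - by rewrite mulr_ge0// addr_ge0.
  - by move=> u; suff : {for u, continuous (fun u => (1 + `|u|) * - (2 / sg ^+ 2 * (u - xi)))} by []; cont.
  - move=> u; rewrite normrM normrN normrM (ger0_norm K0) (ger0_norm (wgt_ge0 u)).
    set K := 2 / _; rewrite -(mulrA K) -mulrDr mulrCA ler_wpM2l// -(real_normK (num_real (u - xi))).
    have : `|u| <= `|u - xi| + `|xi| by rewrite -{1}(subrK xi u) ler_normD.
    have := normr_ge0 (u - xi); have := normr_ge0 xi; have := normr_ge0 u.
    set x := `|u - xi|; set y := `|xi|; set z := `|u| => z0 y0 x0 hz.
    have h1 : (1 + z) * x <= (1 + (x + y)) * x by rewrite ler_wpM2r// lerD2l.
    have h2 : 0 <= (1 + y) * (1 - x + x ^+ 2).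
      by apply: mulr_ge0; [rewrite addr_ge0|have := sqr_ge0 (x - 1); nra].
    by apply: le_trans h1 _; rewrite -subr_ge0 (_ : _ - _ = (1 + y) * (1 - x + x ^+ 2)) //; ring.
by move: h; apply: eq_integrable => // u _ /=; congr EFin; rewrite /dgauss -/F; ring.
Qed.

(** The forcing of a wave by the profile [F'].  The half squared frequency that
the Gaussian contributes completes [wave_S] to a quadratic form in the final
frequency, made explicit in [dgauss_wave_le]. *)
Lemma dgauss_wave (a t b al be de s : R) :
  let q := wave_q a t b s in let e := wave_ep t s in
  let k := q * xi + xi * (b * (1 - e) - a * (t - s)) + de in
  \int[mu]_u (dF u * wave a xi sg t b al be de s u) =
  expR (- (sg ^+ 2 / 2 * wave_S a t b s + sg ^+ 2 * q ^+ 2 / 4)) *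
  (q * (al + be * xi) * sin k +
   be * (sg ^+ 2 / 2 * q * (b - a - a * (1 - e)) - e) * cos k).
Proof.
move=> q e k; pose E := wave_E a sg t b s; pose Q := wave_Q a t b s.
have -> : \int[mu]_u (dF u * wave a xi sg t b al be de s u) = \int[mu]_u
   (E * (al + be * xi) * (dF u * cos (q * (u - xi) + k)) +
   (E * (be * e) * ((u - xi) * dF u * cos (q * (u - xi) + k)) +
    E * (be * (sg ^+ 2 * Q)) * (dF u * cos (q * (u - xi) + (k + pi / 2))))).
  apply: Rint_eq => u _; rewrite /wave.
  have -> : wave_phase a xi t b de s u = q * (u - xi) + k by rewrite /wave_phase /k -/q -/e; ring.
  rewrite (addrA _ k (pi / 2)) cosDpihalf /wave_X /wave_Y -/e -/E -/Q.
  by ring.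
have i1 := Rintegrable_dgauss_cos q k; have i2 := Rintegrable_dgauss_cos q (k + pi / 2).
have i3 := Rintegrable_dist_dgauss_cos q k.
rewrite Rint_add//; last 2 first.
- exact: Rintegrable_mull.
- by apply: Rintegrable_add => //; exact: Rintegrable_mull.
rewrite Rint_add//; last 2 first.
- exact: Rintegrable_mull.
- exact: Rintegrable_mull.
rewrite !Rint_mull// !dgauss_cos_integral dist_dgauss_cos_integral gauss_wave_opp !gauss_waveE cosDpihalf.
rewrite opprD expRD -/(wave_E a sg t b s) -/E /Q /wave_Q -/e.
rewrite /q /wave_q -/e.
by set X := expR (- (_ / 4)); field.
Qed.

Lemma dgauss_wave_le (a t b al be de s : R) (e := wave_ep t s) (q := b * e - a) (h := b - a) :
  `|\int[mu]_u (dF u * wave a xi sg t b al be de s u)| <=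
  expR (- (sg ^+ 2 * (h ^+ 2 / 4 - a * h * (1 - e) / 2 + a ^+ 2 / 2 * (t - s - (1 - e))))) *
  (`|q| * (`|al| + `|be| * `|xi|) +
   `|be| * `|sg ^+ 2 / 2 * q * (h - a * (1 - e)) - e|).
Proof.
rewrite dgauss_wave normrM (gtr0_norm (expR_gt0 _)).
rewrite [X in expR (- X)](_ : _ = sg ^+ 2 * (h ^+ 2 / 4 - a * h * (1 - e) / 2 + a ^+ 2 / 2 * (t - s - (1 - e)))); last first.
  by rewrite /h /wave_S /wave_q -/e; field.
rewrite ler_pM2l ?expR_gt0// (le_trans (ler_normD _ _))// lerD//.
  rewrite normrM (le_trans (ler_piMr _ (norm_sin _)))// normrM ler_wpM2l//.
  by rewrite (le_trans (ler_normD _ _))// normrM.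
by rewrite normrM (le_trans (ler_piMr _ (norm_cos _)))// normrM.
Qed.

End Gaussian.

(** * Response of a mode to its own first moment *)

Section Response.
Context {R : realType}.
Local Notation mu := (@lebesgue_measure R).
Local Notation Rintegrable D f := (mu.-integrable D (EFin \o f)).
Variables (a xi sg cr ci : R).
Variables (r1 r1s r1u r1uu r2 r2s r2u r2uu : R -> R -> R).
Hypotheses (sg0 : 0 < sg) (a0 : a != 0) (cr1 : `|cr| <= 1) (ci1 : `|ci| <= 1).
Hypotheses (w1 : wcurve r1) (w2 : wcurve r2).
Hypotheses (h1 : C12 [set s | 0 < s] r1 r1s r1u r1uu)
  (h2 : C12 [set s | 0 < s] r2 r2s r2u r2uu).

Definition moment (r : R -> R -> R) (s : R) : R := \int[mu]_u (u * r s u).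
Local Notation g1 s := (cr * moment r1 s - ci * moment r2 s).
Local Notation g2 s := (cr * moment r2 s + ci * moment r1 s).
Local Notation kap := (sg ^+ 2 / 2).
Local Notation dF := (dgauss sg xi).

Hypotheses
  (eq1 : forall s u, 0 < s -> r1s s u =
     - (a * u * r2 s u) + gen_fwd xi kap (r1 s) (r1u s) (r1uu s) u - g1 s * dF u)
  (eq2 : forall s u, 0 < s -> r2s s u =
     a * u * r1 s u + gen_fwd xi kap (r2 s) (r2u s) (r2uu s) u - g2 s * dF u).

(** The real part of the integral of [r1 + i r2] against the complex wave with
phase [de]. *)
Definition pairing (t b al be de s : R) : R :=
  \int[mu]_u (r1 s u * wave a xi sg t b al be de s u) -
  \int[mu]_u (r2 s u * wave a xi sg t b al be (de + pi / 2) s u).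

Definition amp_total (b al be : R) : R :=
  wave_amp a xi sg al be * (1 + (`|b| + `|a|)) + expR (sg ^+ 2 * a ^+ 2) * `|be|.

(** The coupling has modulus at most [1] in each part, hence each component of the
source is at most [2 Mb], and the two of them give the factor [4]. *)
Lemma duhamel_bound (T b al be de Mb : R) (j P dP : R -> R) : 0 <= T -> 0 <= Mb ->
  (forall s, 0 < s < T -> `|moment r1 s| <= Mb) ->
  (forall s, 0 < s < T -> `|moment r2 s| <= Mb) ->
  (forall s d, 0 < s < T -> `|\int[mu]_u (dF u * wave a xi sg T b al be d s u)| <= j s) ->
  (forall s : R, is_derive s 1 P (dP s)) ->
  (forall s, 0 < s < T -> 4 * Mb * j s <= dP s) ->
  `|pairing T b al be de T - pairing T b al be de 0| <= P T - P 0.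
Proof.
move=> T0 M0 m1 m2 hj hP jP.
have amp0 := wave_amp_ge0 a xi sg al be.
have n0 : 0 <= `|b| + `|a| by rewrite addr_ge0.
have E0 : 0 <= expR (sg ^+ 2 * a ^+ 2) * `|be| by rewrite mulr_ge0 ?expR_ge0.
have ampT : wave_amp a xi sg al be <= amp_total b al be.
  by rewrite /amp_total -[leLHS]addr0 lerD// ler_peMr// lerDl.
have ampu : wave_amp a xi sg al be * (`|b| + `|a|) + expR (sg ^+ 2 * a ^+ 2) * `|be| <= amp_total b al be.
  by rewrite /amp_total lerD2r ler_wpM2l// lerDr.
have le1 (s u d : R) : s <= T -> `|wave a xi sg T b al be d s u| <= amp_total b al be * (1 + `|u|).
  move=> sT; apply: le_trans (wave_bound a xi b al be d u sg0 sT) _.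
  by rewrite ler_wpM2r ?wgt_ge0.
have le2 (s u d : R) : s <= T -> `|wave_u a xi sg T b al be d s u| <= amp_total b al be * (1 + `|u|).
  move=> sT; apply: le_trans (wave_u_bound a xi b al be d u sg0 sT) _.
  by rewrite ler_wpM2r ?wgt_ge0.
have wf := wintegrable_dgauss xi sg0.
have cf : continuous dF by move=> u; exact: cont_dgauss.
have bg1 s : 0 < s < T -> `|g1 s| <= 2 * Mb.
  move=> hs; rewrite (le_trans (ler_normB _ _))// !normrM mulr_natl mulr2n.
  by apply: lerD; rewrite -[leRHS]mul1r ler_pM// ?m1 ?m2.
have bg2 s : 0 < s < T -> `|g2 s| <= 2 * Mb.
  move=> hs; rewrite (le_trans (ler_normD _ _))// !normrM mulr_natl mulr2n.
  by apply: lerD; rewrite -[leRHS]mul1r ler_pM// ?m1 ?m2.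
have M20 : 0 <= 2 * Mb by rewrite mulr_ge0.
apply: (duality_estimate _ T0 M20 w1 w2 h1 h2 eq1 eq2
  (wave_C12 a xi sg T b al be de) (wave_C12 a xi sg T b al be (de + pi / 2)) _ _
  (fun s u sT => le1 s u de sT) (fun s u sT => le1 s u (de + pi / 2) sT)
  (fun s u sT => le2 s u de sT) (fun s u sT => le2 s u (de + pi / 2) sT)
  wf cf bg1 bg2 hP).
- by rewrite divr_ge0// sqr_ge0.
- by move=> s u; rewrite wave_adjoint.
- by move=> s u; rewrite wave_adjoint wave_opp mulrN.
move=> s hs; apply: le_trans (jP s hs).
have sT : s <= T by case/andP: hs => _ /ltW.
have i1 d : Rintegrable setT (fun u => dF u * wave a xi sg T b al be d s u).
  have iC : Rintegrable setT (fun u => amp_total b al be * ((1 + `|u|) * `|dF u|)).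
    by apply: Rintegrable_mull => //; exact: wintegrable_abs.
  apply: Rintegrable_le iC => //.
    apply: measurable_funM; first exact: wintegrable_meas.
    apply: meas_cont => // u.
    by have [_ /deriv_cont] := wave_C12 a xi sg T b al be d (s := s) u I.
  by move=> u _; rewrite normrM mulrA mulrC ler_wpM2r// le1.
have lin (c d : R) : \int[mu]_u (dF u * (c * wave a xi sg T b al be de s u - d * wave a xi sg T b al be (de + pi / 2) s u))
  = c * \int[mu]_u (dF u * wave a xi sg T b al be de s u) - d * \int[mu]_u (dF u * wave a xi sg T b al be (de + pi / 2) s u).
  rewrite -!Rint_mull// -Rint_sub//; [|exact: Rintegrable_mull|exact: Rintegrable_mull].
  by apply: Rint_eq => u _; ring.
rewrite lin.
rewrite (le_trans (ler_normB _ _))// !normrM.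
rewrite [leRHS](_ : _ = 2 * Mb * j s + 2 * Mb * j s); last by ring.
by apply: lerD; apply: ler_pM => //; [exact: bg1|exact: hj|exact: bg2|exact: hj].
Qed.

Definition init_mass : R := wnorm (r1 0) + wnorm (r2 0).

Lemma le_pair_wnorm (r v : R -> R) (C : R) : 0 <= C -> wintegrable r -> continuous v ->
  (forall u, `|v u| <= C * (1 + `|u|)) -> `|\int[mu]_u (r u * v u)| <= C * wnorm r.
Proof.
move=> C0 wr cv bv; rewrite /wnorm -Rint_mull//; last exact: wintegrable_abs.
have iC : Rintegrable setT (fun u => C * ((1 + `|u|) * `|r u|)).
  by apply: Rintegrable_mull => //; exact: wintegrable_abs.
have le u : `|r u * v u| <= C * ((1 + `|u|) * `|r u|).
  by rewrite normrM mulrA mulrC ler_wpM2r.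
apply: Rint_abs_le => //; apply: Rintegrable_le iC => //.
by apply: measurable_funM; [exact: wintegrable_meas|exact: meas_cont].
Qed.

Lemma cont_wave t b al be de s : continuous (wave a xi sg t b al be de s).
Proof. by move=> u; have [_ /deriv_cont] := wave_C12 a xi sg t b al be de (s := s) u I. Qed.

Lemma pairing_init (T b al be de : R) : 0 <= T ->
  `|pairing T b al be de 0| <= wave_amp a xi sg al be * init_mass.
Proof.
move=> T0; have amp0 := wave_amp_ge0 a xi sg al be.
rewrite /pairing (le_trans (ler_normB _ _))// /init_mass mulrDr.
apply: lerD; apply: le_pair_wnorm => //.
- exact: w1.1.
- exact: cont_wave.
- by move=> u; exact: wave_bound.
- exact: w2.1.
- exact: cont_wave.
- by move=> u; exact: wave_bound.
Qed.

Lemma wave_final t b al be de u : wave a xi sg t b al be de t u = (al + be * u) * cos ((b - a) * u + de).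
Proof.
have eS : wave_S a t b t = 0 by rewrite /wave_S /wave_ep subrr expR0; field.
have eQ : wave_Q a t b t = 0 by rewrite /wave_Q /wave_ep subrr expR0; field.
rewrite /wave /wave_E eS /wave_Y eQ mulr0 oppr0 expR0 !mulr0 mul0r subr0 mul1r.
by rewrite /wave_X /wave_phase /wave_q /wave_ep subrr expR0; congr (_ * cos _); ring.
Qed.

Local Notation w := (sg * `|a| / 2).
Local Notation A := (sg ^+ 2 * a ^+ 2 / 2).

Let w0 : 0 < w. Proof. by rewrite divr_gt0// mulr_gt0// normr_gt0. Qed.
Let A0 : 0 < A. Proof. by rewrite divr_gt0//; apply: mulr_gt0; [exact: exprn_gt0|rewrite exprn_even_gt0]. Qed.
Let Aw : A = 2 * w ^+ 2.
Proof. by rewrite [in RHS]expr_div_n exprMn real_normK ?num_real//; field. Qed.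

(** Up to sign, an antiderivative in [s] of a bound on the kernel of the first
moment.  In
terms of [p = 1 - wave_ep], of the factor [E = exp (- A (tau - p))] and of
[A = 2 w^2], the derivative of [p E] in [tau] is [(exp (- tau) - A p^2) E],
which accounts for the signed kernel; to turn the sign of [A p^2] around, it
remains to integrate [2 exp (- tau) E], and [E <= 1 / (1 + (w p)^2)] has the
arctangent of [w p] as primitive.  Finally [- E / A] is a primitive of [p E]. *)
Definition kern_prim (T s : R) : R :=
  2 / w * atan ((1 - wave_ep T s) * w)
  - ((1 - wave_ep T s) + `|xi * a| / A) * expR (- (A * (T - s - (1 - wave_ep T s)))).

Definition kern (T s : R) : R :=
  expR (- (A * (T - s - (1 - wave_ep T s)))) *
  (wave_ep T s + A * (1 - wave_ep T s) ^+ 2 + `|xi * a| * (1 - wave_ep T s)).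

Definition kern_prim' (T s : R) : R :=
  - (2 * wave_ep T s / (1 + ((1 - wave_ep T s) * w) ^+ 2))
  + (wave_ep T s - A * (1 - wave_ep T s) ^+ 2 - `|xi * a| * (1 - wave_ep T s)) *
    expR (- (A * (T - s - (1 - wave_ep T s)))).

Lemma is_derive_kern_prim (T s : R) : is_derive s 1 (kern_prim T) (kern_prim' T s).
Proof.
rewrite /kern_prim /wave_ep; deriv; rewrite /kern_prim' /wave_ep.
set e := expR (- (_ * _)); set f := expR _; set x := `|xi * a|.
have hw : w != 0 by rewrite gt_eqF.
have hA : A != 0 by rewrite gt_eqF.
have hd : 1 + ((1 - f) * w) ^+ 2 != 0.
  by rewrite gt_eqF// ltr_wpDr ?sqr_ge0.
move: hw hA hd; set W := _ * `|a| / 2; set AA := _ * a ^+ 2 / 2 => hw hA hd.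
by field; rewrite hw hA hd.
Qed.

(** In [tau = T - s], the difference of the two sides vanishes at [0] and has the
derivative [(1 - exp (- tau))^2]. *)
Lemma half_sqr_ep_le (T s : R) : s <= T -> (1 - wave_ep T s) ^+ 2 / 2 <= T - s - (1 - wave_ep T s).
Proof.
move=> sT; rewrite /wave_ep.
pose f x : R := x - (1 - expR (- x)) - (1 - expR (- x)) ^+ 2 / 2.
pose df x : R := (1 - expR (- x)) ^+ 2.
have hf (x : R) : is_derive x 1 f (df x).
  by rewrite /f; deriv; rewrite /df; field.
have : f 0 <= f (T - s).
  have := sT; rewrite -subr_ge0 le_eqVlt => /orP[/eqP <-//|Ts0].
  have [c _ e] : exists2 c, c \in `]0, (T - s)[%R & f (T - s) - f 0 = df c * (T - s - 0).
    apply: (@MVT _ f df) => //.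
    by apply: continuous_subspaceT => x; exact: deriv_cont (hf x).
  rewrite -subr_ge0 e mulr_ge0 ?sqr_ge0// subr0 ltW//.
have -> : f 0 = 0 by rewrite /f oppr0 expR0; ring.
by rewrite /f (opprB T s) subr_ge0.
Qed.

(** The inequality amounts to [exp (- A (tau - p)) <= 1 / (1 + w^2 p^2)], that is
to [1 + y <= exp y] together with [tau - p >= p^2 / 2]. *)
Lemma kern_le (T s : R) : s <= T -> kern T s <= - kern_prim' T s.
Proof.
move=> sT; have /andP[e0 e1] := wave_ep_01 sT.
have hs := half_sqr_ep_le sT.
rewrite /kern /kern_prim'.
set f := wave_ep T s in e0 e1 hs *.
set e := expR (- (_ * _)); set x := `|xi * a|.
rewrite -subr_ge0 (_ : _ - _ = 2 * f * ((1 + ((1 - f) * w) ^+ 2)^-1 - e)); last by ring.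
rewrite mulr_ge0//; first by rewrite mulr_ge0// ltW.
rewrite subr_ge0 /e expRN lef_pV2 ?posrE ?expR_gt0//; last by rewrite ltr_wpDr ?sqr_ge0.
apply: le_trans (expR_ge1Dx _); rewrite lerD2l Aw exprMn.
rewrite [leLHS](_ : _ = 2 * w ^+ 2 * ((1 - f) ^+ 2 / 2)); last by field.
by rewrite ler_wpM2l// mulr_ge0// sqr_ge0.
Qed.

Lemma kern_prim_diff (T : R) : 0 <= T ->
  kern_prim T 0 - kern_prim T T <= pi / w + `|xi * a| / A.
Proof.
move=> T0; have /andP[e0 e1] := wave_ep_01 T0.
have -> : kern_prim T T = - (`|xi * a| / A).
  by rewrite /kern_prim /wave_ep !subrr expR0 !subrr mul0r atan0 !mulr0 oppr0 expR0 mulr1 !add0r.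
rewrite /kern_prim opprK.
have x0 : 0 <= `|xi * a| / A by rewrite divr_ge0// ltW.
set X := _ / A in x0 *; set E := expR _.
have E0 : 0 < E by exact: expR_gt0.
have := mulr_ge0 (addr_ge0 (_ : 0 <= 1 - wave_ep T 0) x0) (ltW E0).
rewrite subr_ge0 => /(_ e1) hh.
have : 2 / w * atan ((1 - wave_ep T 0) * w) <= pi / w.
  rewrite mulrAC ler_pM2r ?invr_gt0// mulrC -ler_pdivlMr// ltW//.
  exact: atan_ltpi2.
by move: hh; lra.
Qed.

(** The wave with [b = a], that is [eta = 0], and [(al, be) = (0, 1)] ends as the
function [u], with phase [0] for the real part of the moment and [pi / 2] for
the imaginary part. *)
Lemma moment_step (T Mb : R) : 0 <= T -> 0 <= Mb ->
  (forall s, 0 < s < T -> `|moment r1 s| <= Mb) ->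
  (forall s, 0 < s < T -> `|moment r2 s| <= Mb) ->
  let M := wave_amp a xi sg 0 1 * init_mass + 4 * Mb * (pi / w + `|xi * a| / A) in
  `|moment r1 T| <= M /\ `|moment r2 T| <= M.
Proof.
move=> T0 M0 m1 m2 M.
have key de : `|pairing T a 0 1 de T| <= M.
  have hd := @duhamel_bound T a 0 1 de Mb (kern T) (fun s => - (4 * Mb * kern_prim T s))
    (fun s => - (4 * Mb * kern_prim' T s)) T0 M0 m1 m2 _ _ _.
  rewrite -(subrK (pairing T a 0 1 de 0) (pairing T a 0 1 de T)).
  rewrite (le_trans (ler_normD _ _))// addrC /M lerD//; first exact: pairing_init.
  apply: le_trans (hd _ _ _) _.
  - move=> s d /andP[_ /ltW sT]; apply: le_trans (dgauss_wave_le _ sg0 _ _ _ _ _ _ _) _.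
    have /andP[e0 e1] := wave_ep_01 sT.
    rewrite /kern subrr; set f := wave_ep T s in e0 e1 *.
    rewrite [X in expR (- X)](_ : _ = A * (T - s - (1 - f))); last by field.
    rewrite ler_pM2l ?expR_gt0// normr0 normr1 add0r !mul1r.
    have f1 : 0 <= 1 - f by rewrite subr_ge0.
    rewrite (_ : a * f - a = - (a * (1 - f))); last by ring.
    rewrite normrN normrM (ger0_norm f1) addrC; apply: lerD.
      rewrite [X in `|X|](_ : _ = A * (1 - f) ^+ 2 - f); last by field.
      rewrite (le_trans (ler_normB _ _))// addrC (gtr0_norm e0) lerD2l ger0_norm//.
      by rewrite mulr_ge0 ?sqr_ge0// ltW.
    by rewrite le_eqVlt; apply/orP; left; apply/eqP; rewrite normrM; ring.
  - by move=> s; have := is_derive_kern_prim T s => ?; deriv; ring.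
  - move=> s /andP[_ /ltW sT]; rewrite -mulrN ler_wpM2l ?mulr_ge0//.
    exact: kern_le.
  rewrite [leLHS](_ : _ = 4 * Mb * (kern_prim T 0 - kern_prim T T)); last by ring.
  rewrite ler_wpM2l ?mulr_ge0//.
  exact: kern_prim_diff.
have e1 : moment r1 T = pairing T a 0 1 0 T.
  rewrite /pairing /moment (_ : \int[mu]_u (r2 T u * _) = 0) ?subr0.
    by apply: Rint_eq => u _; rewrite wave_final subrr mul0r !add0r cos0 mul1r mulr1 mulrC.
  rewrite (Rint_eq (g := fun=> 0)); first by rewrite Rintegral_cst// mul0r.
  by move=> u _; rewrite wave_final subrr mul0r !add0r cos_pihalf !mulr0.
have e2 : moment r2 T = pairing T a 0 1 (pi / 2) T.
  rewrite /pairing /moment (_ : \int[mu]_u (r1 T u * _) = 0) ?sub0r.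
    rewrite -[RHS]mulN1r -Rint_mull//.
      apply: Rint_eq => u _; rewrite wave_final subrr mul0r !add0r cosDpihalf sin_pihalf.
      by ring.
    have := (w2.1 T T0); move=> hw2.
    have iC : Rintegrable setT (fun u => 1 * ((1 + `|u|) * `|r2 T u|)).
      by apply: Rintegrable_mull => //; exact: wintegrable_abs.
    apply: Rintegrable_le iC => //.
      by apply: measurable_funM; [exact: wintegrable_meas|apply: meas_cont => //; exact: cont_wave].
    move=> u _; rewrite wave_final subrr mul0r !add0r cosDpihalf sin_pihalf mul1r mul1r.
    by rewrite mulrN1 normrM normrN mulrC ler_wpM2r// lerDr.
  rewrite (Rint_eq (g := fun=> 0)); first by rewrite Rintegral_cst// mul0r.
  by move=> u _; rewrite wave_final subrr mul0r !add0r cos_pihalf !mulr0.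
by rewrite e1 e2; split; exact: key.
Qed.

(** The supremum of the moment over [[0, s]] is finite, so the feedback inequality
of [moment_step], with a gain of at most one half, can be solved for it. *)
Lemma moment_bound (small : pi / w + `|xi * a| / A <= 8^-1) (s : R) : 0 <= s ->
  `|moment r1 s| <= 2 * (wave_amp a xi sg 0 1 * init_mass) /\
  `|moment r2 s| <= 2 * (wave_amp a xi sg 0 1 * init_mass).
Proof.
set M0 := _ * init_mass => s0.
have amp0 := wave_amp_ge0 a xi sg 0 1.
have M00 : 0 <= M0 by rewrite mulr_ge0// addr_ge0// wnorm_ge0.
have mw (r : R -> R -> R) t : wcurve r -> 0 <= t -> `|moment r t| <= wnorm (r t).
  move=> [hr _] t0; have := @le_pair_wnorm (r t) id 1 ler01 (hr t t0) (fun u => @cvg_id _ _) _.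
  rewrite mul1r /moment => h.
  rewrite (Rint_eq (g := fun u => r t u * id u)); last by move=> u _; rewrite mulrC.
  by apply: h => u; rewrite mul1r lerDr.
have [B1 hB1] := wcurve_bounded s w1; have [B2 hB2] := wcurve_bounded s w2.
pose E := [set x | exists2 t, 0 <= t <= s & x = `|moment r1 t| \/ x = `|moment r2 t|].
have Es t : 0 <= t <= s -> E `|moment r1 t| /\ E `|moment r2 t|.
  by move=> ht; split; exists t => //; [left|right].
have ubE : has_ubound E.
  exists (Num.max B1 B2) => x [t ht [->|->]]; have /andP[t0 _] := ht.
    by apply: le_trans (mw _ _ w1 t0) _; rewrite le_max hB1.
  by apply: le_trans (mw _ _ w2 t0) _; rewrite le_max hB2 ?orbT.
have E0 : E !=set0 by exists `|moment r1 s|; apply: (Es s _).1; rewrite s0 lexx.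
have hsup : has_sup E by split.
have supE x : E x -> x <= sup E by move=> Ex; exact: (ub_le_sup ubE).
have sup0 : 0 <= sup E by apply: le_trans (normr_ge0 (moment r1 s)) (supE _ (Es s _).1); rewrite s0 lexx.
have half : sup E <= M0 + sup E / 2.
  apply: ge_sup => // x [t ht hx].
  have /andP[t0 ts] := ht.
  have b1 (q : R) : 0 < q < t -> `|moment r1 q| <= sup E.
    by move=> /andP[q0 qt]; apply: supE; apply: (Es q _).1; rewrite (ltW q0) (le_trans (ltW qt)).
  have b2 (q : R) : 0 < q < t -> `|moment r2 q| <= sup E.
    by move=> /andP[q0 qt]; apply: supE; apply: (Es q _).2; rewrite (ltW q0) (le_trans (ltW qt)).
  have [s1 s2] := moment_step t0 sup0 b1 b2.
  have le : M0 + 4 * sup E * (pi / w + `|xi * a| / A) <= M0 + sup E / 2.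
    rewrite lerD2l; apply: le_trans (_ : 4 * sup E * 8^-1 <= _); first by rewrite ler_wpM2l// mulr_ge0.
    by lra.
  by case: hx => ->; apply: le_trans le; [exact: s1|exact: s2].
have h : sup E <= 2 * M0 by move: half; lra.
have hs : 0 <= s <= s by rewrite s0 lexx.
by have [k1 k2] := Es s hs; split; apply: le_trans h; exact: supE.
Qed.

(** ** All frequencies *)

(* [4 / sg] leaves [exp (- sg^2 h^2 / 32)] of the available decay
   [exp (- sg^2 h^2 / 8)]; the rest absorbs a quadratic polynomial *)
Local Notation env h := (wide_gauss (4 / sg) 0 h).

Lemma env_gt0 h : 0 < env h. Proof. exact: expR_gt0. Qed.

Lemma env_le1 h : env h <= 1.
Proof.
rewrite /wide_gauss -expR0 ler_expR oppr_le0 divr_ge0 ?sqr_ge0//.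
by rewrite mulr_ge0// sqr_ge0.
Qed.

Lemma poly_env (h : R) :
  (1 + h ^+ 2) * expR (- (sg ^+ 2 * h ^+ 2 / 8)) <= (1 + 32 / (3 * sg ^+ 2)) * env h.
Proof.
have s20 : 0 < sg ^+ 2 by rewrite exprn_gt0.
have sgn : sg != 0 by rewrite gt_eqF.
set z := sg ^+ 2 * h ^+ 2 * 3 / 32.
have z0 : 0 <= z by rewrite divr_ge0// mulr_ge0// mulr_ge0 ?sqr_ge0.
have -> : expR (- (sg ^+ 2 * h ^+ 2 / 8)) = expR (- z) * env h.
  by rewrite /wide_gauss -expRD; congr expR; rewrite /z; field.
rewrite mulrA ler_pM2r ?env_gt0//.
have -> : h ^+ 2 = 32 / (3 * sg ^+ 2) * z by rewrite /z; field.
rewrite mulrDl mul1r; apply: lerD.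
  by rewrite -expR0 ler_expR oppr_le0.
rewrite -(mulrA (32 / _)) ler_piMr//; first by rewrite divr_ge0// mulr_ge0// ltW.
rewrite expRN ler_pdivrMr ?expR_gt0// mul1r.
by rewrite (le_trans _ (expR_ge1Dx _))// lerDr.
Qed.

(** The exponent of [dgauss_wave_le] is a quadratic form in the final frequency
[h]; completing the square leaves [- sg^2 h^2 / 8] and the decay at rate [A],
at the cost of the constant [exp (2 A)]. *)
Lemma source_decay (al be : R) : exists2 C, 0 <= C & forall h T s d, s <= T ->
  `|\int[mu]_u (dF u * wave a xi sg T (h + a) al be d s u)| <=
    C * env h * expR (- (A * (T - s))).
Proof.
have s20 : 0 < sg ^+ 2 by rewrite exprn_gt0.
set y := `|a|; set p0 := `|al| + `|be| * `|xi|.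
have y0 : 0 <= y by rewrite /y.
have p00 : 0 <= p0 by rewrite /p0 addr_ge0// mulr_ge0.
set K := (1 + 2 * y) * p0 + `|be| * (kap * (1 + 3 * y + 2 * y ^+ 2) + 1).
have kap0 : 0 <= kap by rewrite divr_ge0// ltW.
have K0 : 0 <= K.
  rewrite /K; apply: addr_ge0; first by rewrite mulr_ge0// addr_ge0// mulr_ge0.
  apply: mulr_ge0 => //; apply: addr_ge0 => //; apply: mulr_ge0 => //.
  by rewrite addr_ge0 ?mulr_ge0 ?sqr_ge0// addr_ge0// mulr_ge0.
exists (expR (2 * A) * K * (1 + 32 / (3 * sg ^+ 2))).
  apply: mulr_ge0; first by rewrite mulr_ge0 ?expR_ge0.
  by rewrite addr_ge0// divr_ge0// mulr_ge0// ltW.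
move=> h T s d sT; apply: le_trans (dgauss_wave_le _ sg0 _ _ _ _ _ _ _) _.
have /andP[e0 e1] := wave_ep_01 sT.
rewrite addrK; set f := wave_ep T s in e0 e1 *.
have f1 : 0 <= 1 - f by rewrite subr_ge0.
apply: le_trans (_ : (expR (2 * A) * expR (- (A * (T - s))) * expR (- (sg ^+ 2 * h ^+ 2 / 8))) *
   (K * (1 + h ^+ 2)) <= _); last first.
  rewrite [leLHS](_ : _ = expR (2 * A) * K * expR (- (A * (T - s))) *
     ((1 + h ^+ 2) * expR (- (sg ^+ 2 * h ^+ 2 / 8)))); last by ring.
  rewrite [leRHS](_ : _ = expR (2 * A) * K * expR (- (A * (T - s))) *
     ((1 + 32 / (3 * sg ^+ 2)) * env h)); last by ring.
  apply: ler_wpM2l; last exact: poly_env.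
  by rewrite mulr_ge0 ?expR_ge0// mulr_ge0 ?expR_ge0.
apply: ler_pM; first exact: expR_ge0.
- by rewrite addr_ge0// mulr_ge0.
- rewrite -!expRD ler_expR -subr_ge0.
  rewrite (_ : _ - _ = sg ^+ 2 * ((h - 2 * a * (1 - f)) ^+ 2 / 8 + a ^+ 2 * (f * (3 - f)) / 2)); last by field.
  apply: mulr_ge0; first exact: ltW.
  rewrite addr_ge0 ?divr_ge0 ?sqr_ge0// mulr_ge0 ?sqr_ge0// mulr_ge0 ?(ltW e0)//; lra.
have x0 := normr_ge0 h; set x := `|h| in x0.
have hq : `|(h + a) * f - a| <= x + 2 * y.
  rewrite (_ : _ - a = h * f - a * (1 - f)); last by ring.
  rewrite (le_trans (ler_normB _ _))// !normrM (gtr0_norm e0) (ger0_norm f1) -/x -/y; nra.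
have hp : `|h - a * (1 - f)| <= x + y.
  rewrite (le_trans (ler_normB _ _))// lerD2l normrM (ger0_norm f1) -/y; nra.
have hx : h ^+ 2 = x ^+ 2 by rewrite /x real_normK// num_real.
rewrite hx /K [leRHS]mulrDl; apply: lerD.
  apply: le_trans (ler_wpM2r p00 hq) _.
  rewrite mulrAC; apply: ler_wpM2r => //; have h0 : 0 <= y * x ^+ 2 by rewrite mulr_ge0// sqr_ge0.
  by have := sqr_ge0 (x - 1); nra.
rewrite -(mulrA `|be|); apply: ler_wpM2l => //.
apply: le_trans (ler_normB _ _) _; rewrite [leRHS]mulrDl; apply: lerD; last first.
  by rewrite (gtr0_norm e0) mul1r (le_trans e1)// lerDl sqr_ge0.
rewrite -(mulrA kap) normrM (ger0_norm kap0) -(mulrA kap); apply: ler_wpM2l => //.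
rewrite normrM; apply: le_trans (_ : (x + 2 * y) * (x + y) <= _).
  exact: ler_pM.
have h3 : 0 <= y * (1 - x) ^+ 2 by rewrite mulr_ge0// sqr_ge0.
have h4 : 0 <= y * x ^+ 2 by rewrite mulr_ge0// sqr_ge0.
have h5 : 0 <= y ^+ 2 * x ^+ 2 by rewrite mulr_ge0// sqr_ge0.
have h6 : 0 <= y * x by rewrite mulr_ge0.
nra.
Qed.

Lemma response_bound (small : pi / w + `|xi * a| / A <= 8^-1) (al be : R) :
  exists2 C, 0 <= C & forall T h de, 0 <= T ->
  `|pairing T (h + a) al be de T - pairing T (h + a) al be de 0| <= C * env h.
Proof.
have [C C0 hC] := source_decay al be.
set Mb := 2 * (wave_amp a xi sg 0 1 * init_mass).
have Mb0 : 0 <= Mb.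
  by rewrite /Mb mulr_ge0// mulr_ge0 ?wave_amp_ge0// addr_ge0// wnorm_ge0.
have An : A != 0 by rewrite gt_eqF.
exists (4 * Mb * C / A); first by rewrite divr_ge0 ?(ltW A0)// mulr_ge0// mulr_ge0.
move=> T h de T0.
have m1 s : 0 < s < T -> `|moment r1 s| <= Mb by move=> /andP[/ltW s0 _]; have [] := moment_bound small s0.
have m2 s : 0 < s < T -> `|moment r2 s| <= Mb by move=> /andP[/ltW s0 _]; have [] := moment_bound small s0.
apply: le_trans (@duhamel_bound T (h + a) al be de Mb (fun s => C * env h * expR (- (A * (T - s))))
  (fun s => 4 * Mb * C / A * env h * expR (- (A * (T - s))))
  (fun s => 4 * Mb * C * env h * expR (- (A * (T - s)))) T0 Mb0 m1 m2 _ _ _) _.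
- by move=> s d /andP[_ /ltW sT]; exact: hC.
- move=> s; deriv; move: An; set AA := A; set E := expR _; set g := env h => An.
  by field.
- by move=> s _; rewrite le_eqVlt; apply/orP; left; apply/eqP; ring.
rewrite subrr mulr0 oppr0 expR0 mulr1 lerBlDr lerDl.
by rewrite mulr_ge0 ?expR_ge0// mulr_ge0 ?(ltW (env_gt0 _))// divr_ge0 ?(ltW A0)// mulr_ge0// mulr_ge0.
Qed.

(** Real and imaginary parts of the Fourier transform are the phases [0] and
[pi / 2]. *)
Definition fpart (T de eta : R) : R :=
  \int[mu]_u (r1 T u * cos (eta * u + de)) - \int[mu]_u (r2 T u * cos (eta * u + (de + pi / 2))).

Lemma fpart_pairing T de eta : fpart T de eta = pairing T (eta + a) 1 0 de T.
Proof.
by rewrite /fpart /pairing; congr (_ - _); apply: Rint_eq => u _;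
  rewrite wave_final addrK mul0r addr0 mul1r.
Qed.

Lemma Rintegrable_cos (r : R -> R) (q k : R) : wintegrable r -> Rintegrable setT (fun u => r u * cos (q * u + k)).
Proof.
move=> hr; apply: (Rintegrable_le _ _ (g := fun u => `|r u|)) => //.
- apply: measurable_funM; first exact: wintegrable_meas.
  by apply: meas_cont => // u; suff : {for u, continuous (fun u => cos (q * u + k))} by []; cont.
- by move=> u _; rewrite normrM ler_piMr// norm_cos.
- by apply: Rintegrable_abs => //; case: hr.
Qed.

Lemma is_derive_cos_int (r : R -> R) (k q : R) : wintegrable r ->
  is_derive q 1 (fun q => \int[mu]_u (r u * cos (q * u + k)))
    (\int[mu]_u (r u * (u * cos (q * u + (k + pi / 2))))).
Proof.
move=> hr.
pose f q u := r u * cos (q * u + k).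
pose df q u := r u * (u * cos (q * u + (k + pi / 2))).
have hd (p u : R) : is_derive p 1 (f ^~ u) (df p u).
  by rewrite /f /df; deriv; rewrite (addrA _ k (pi / 2)) cosDpihalf; ring.
have I0 : `]q - 1, q + 1[%classic q by rewrite /= in_itv/= ltrBlDr ltrDl ltr01.
pose G u := (1 + `|u|) * `|r u|.
have G0 u : 0 <= G u by rewrite /G mulr_ge0 ?wgt_ge0.
have iG : Rintegrable setT G by exact: wintegrable_abs.
have pE p u : partial1of2 f p u = df p u.
  by rewrite partial1of2E; have [_ ->] := hd p u.
have hG p u : `]q - 1, q + 1[%classic p -> [set: R] u -> `|partial1of2 f p u| <= G u.
  move=> _ _; rewrite pE /df /G normrM mulrC ler_wpM2r// normrM (le_trans (ler_piMr _ (norm_cos _)))//.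
  by rewrite lerDr.
have intf p : `]q - 1, q + 1[%classic p -> Rintegrable setT (f p).
  by move=> _; exact: Rintegrable_cos.
have derf p u : `]q - 1, q + 1[%classic p -> [set: R] u -> derivable (f ^~ u) p 1.
  by move=> _ _; case: (hd p u).
have d1 := @derivable_under_integral R _ (measurableTypeR R) mu f _ measurableT _ _ _ I0 intf derf G G0 iG hG.
have d2 := @differentiation_under_integral R _ (measurableTypeR R) mu f _ measurableT _ _ _ I0 intf derf G G0 iG hG.
split; first exact: d1.
by rewrite -derive1E d2; apply: Rint_eq => u _; rewrite pE.
Qed.

(** Differentiating in the frequency multiplies by [u] and advances the phase by a
quarter turn, so the derivative is the pairing with [(al, be) = (0, 1)]. *)
Lemma is_derive_fpart T de (eta : R) : 0 <= T ->
  is_derive eta 1 (fpart T de) (pairing T (eta + a) 0 1 (de + pi / 2) T).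
Proof.
move=> T0; rewrite /fpart.
have d1 := is_derive_cos_int de eta (w1.1 T T0).
have d2 := is_derive_cos_int (de + pi / 2) eta (w2.1 T T0).
deriv; rewrite /pairing; congr (_ - _); apply: Rint_eq => u _;
  by rewrite wave_final addrK add0r mul1r.
Qed.

Lemma fpart_phase (k q : R) : `|fpart 0 k q| <= `|fpart 0 0 q| + `|fpart 0 (pi / 2) q|.
Proof.
have i1 := Rintegrable_cos q 0 (w1.1 0 (lexx _)); have i2 := Rintegrable_cos q (pi / 2) (w1.1 0 (lexx _)).
have i3 := Rintegrable_cos q (pi / 2) (w2.1 0 (lexx _)).
have i4 := Rintegrable_cos q (pi / 2 + pi / 2) (w2.1 0 (lexx _)).
have -> : fpart 0 k q = cos k * fpart 0 0 q + sin k * fpart 0 (pi / 2) q.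
  rewrite /fpart add0r !mulrBr -!Rint_mull//.
  rewrite addrACA -opprD -!Rint_add//; try exact: Rintegrable_mull.
  congr (_ - _); apply: Rint_eq => u _.
    by rewrite addr0 cosDpihalf cosD; ring.
  by rewrite !addrA !cosDpihalf sinDpihalf sinD; ring.
rewrite (le_trans (ler_normD _ _))// !normrM.
by apply: lerD; rewrite ler_piMl// ?norm_cos ?norm_sin.
Qed.

(** At time [0] the wave is a damped plane wave of frequency [q], so the initial
datum enters through its Fourier transform at [q].  Since [A >= 1], the damping
contains the factor [exp (- T)], the inverse of the Jacobian of [eta |-> q]. *)
Lemma pairing_init_fpart (T de eta : R) : 0 <= T -> 1 <= A ->
  `|pairing T (eta + a) 1 0 de 0| <= expR (2 * A) * expR (- T) *
    (`|fpart 0 0 ((eta + a) * expR (- T) - a)| + `|fpart 0 (pi / 2) ((eta + a) * expR (- T) - a)|).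
Proof.
move=> T0 A1.
set q := (eta + a) * expR (- T) - a.
pose k := xi * ((eta + a) * (1 - expR (- T)) - a * T) + de.
have -> : pairing T (eta + a) 1 0 de 0 = wave_E a sg T (eta + a) 0 * fpart 0 k q.
  rewrite /pairing /fpart mulrBr -!Rint_mull//; [|exact/Rintegrable_cos/w2.1|exact/Rintegrable_cos/w1.1].
  congr (_ - _); apply: Rint_eq => u _; rewrite /wave /wave_X /wave_Y !mul0r addr0 subr0 mul1r mulrCA;
    congr (_ * (_ * cos _)); rewrite /wave_phase /wave_q /wave_ep sub0r subr0 /k /q; ring.
rewrite normrM (gtr0_norm (wave_E_gt0 _ _ _ _ _)).
apply: ler_pM => //; first exact/ltW/wave_E_gt0; last exact: fpart_phase.
apply: le_trans (wave_E_le _ _ _ T0) _.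
rewrite -expRD ler_expR subr0 -subr_ge0 (_ : _ - _ = (A - 1) * T); last by field.
by rewrite mulr_ge0// subr_ge0.
Qed.

Lemma fpart_bound (small : pi / w + `|xi * a| / A <= 8^-1) (A1 : 1 <= A) :
  exists2 C, 0 <= C & forall T de eta, 0 <= T ->
  [/\ `|fpart T de eta| <= expR (2 * A) * (expR (- T) *
    (`|fpart 0 0 ((eta + a) * expR (- T) - a)| + `|fpart 0 (pi / 2) ((eta + a) * expR (- T) - a)|))
      + C * env eta,
     `|fpart T de eta| <= C & `|pairing T (eta + a) 0 1 de T| <= C].
Proof.
have [C1 C10 h1'] := response_bound small 1 0; have [C2 C20 h2'] := response_bound small 0 1.
set D1 := wave_amp a xi sg 1 0 * init_mass; set D2 := wave_amp a xi sg 0 1 * init_mass.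
have m0 : 0 <= init_mass by rewrite addr_ge0// wnorm_ge0.
have D10 : 0 <= D1 by rewrite mulr_ge0// wave_amp_ge0.
have D20 : 0 <= D2 by rewrite mulr_ge0// wave_amp_ge0.
exists (C1 + C2 + D1 + D2); first by rewrite !addr_ge0.
move=> T de eta T0.
have tri al be : `|pairing T (eta + a) al be de T| <=
    `|pairing T (eta + a) al be de 0| + `|pairing T (eta + a) al be de T - pairing T (eta + a) al be de 0|.
  by rewrite -{1}(subrK (pairing T (eta + a) al be de 0) (pairing T (eta + a) al be de T)) addrC ler_normD.
have E0 := env_gt0 eta; have E1 := env_le1 eta.
rewrite fpart_pairing; split.
- apply: le_trans (tri 1 0) _; rewrite mulrA; apply: lerD; first exact: pairing_init_fpart.
  apply: le_trans (h1' _ _ _ T0) _; apply: ler_wpM2r; first exact: ltW.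
  by rewrite -!addrA lerDl !addr_ge0.
- apply: le_trans (tri 1 0) _.
  have k1 := pairing_init (eta + a) 1 0 de T0; rewrite -/D1 in k1.
  have k2 := h1' _ eta de T0; have k3 := ler_piMr C10 E1.
  by move: k1 k2 k3; lra.
- apply: le_trans (tri 0 1) _.
  have k1 := pairing_init (eta + a) 0 1 de T0; rewrite -/D2 in k1.
  have k2 := h2' _ eta de T0; have k3 := ler_piMr C20 E1.
  by move: k1 k2 k3; lra.
Qed.

End Response.

(** * Real and imaginary parts of a mode *)

Section ComplexParts.
Context {R : realType}.
Implicit Types z w : R[i].

Lemma Re_add z w : complex.Re (z + w) = complex.Re z + complex.Re w.
Proof. by case: z; case: w. Qed.
Lemma Im_add z w : complex.Im (z + w) = complex.Im z + complex.Im w.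
Proof. by case: z; case: w. Qed.
Lemma Re_opp z : complex.Re (- z) = - complex.Re z.
Proof. by case: z. Qed.
Lemma Im_opp z : complex.Im (- z) = - complex.Im z.
Proof. by case: z. Qed.
Lemma Re_mul z w : complex.Re (z * w) =
  complex.Re z * complex.Re w - complex.Im z * complex.Im w.
Proof. by case: z; case: w. Qed.
Lemma Im_mul z w : complex.Im (z * w) =
  complex.Re z * complex.Im w + complex.Im z * complex.Re w.
Proof. by case: z; case: w. Qed.

Lemma cabs_Re z : `|complex.Re z| <= cabs z.
Proof.
case: z => x y; rewrite /cabs /ComplexField.Normc.normc /= -sqrtr_sqr ler_sqrt ?lerDl ?sqr_ge0//.
by rewrite addr_ge0 ?sqr_ge0.
Qed.

Lemma cabs_Im z : `|complex.Im z| <= cabs z.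
Proof.
case: z => x y; rewrite /cabs /ComplexField.Normc.normc /= -sqrtr_sqr ler_sqrt ?lerDr ?sqr_ge0//.
by rewrite addr_ge0 ?sqr_ge0.
Qed.

Lemma cabs_ge0 z : 0 <= cabs z.
Proof. exact: le_trans (normr_ge0 _) (cabs_Re z). Qed.

Lemma cabs_le z : cabs z <= `|complex.Re z| + `|complex.Im z|.
Proof.
case: z => x y; rewrite /cabs /ComplexField.Normc.normc /=.
rewrite -[leRHS]ger0_norm ?addr_ge0// -sqrtr_sqr ler_sqrt ?sqr_ge0//.
rewrite sqrrD !real_normK ?num_real// -addrA lerD2l lerDr.
by rewrite mulrn_wge0// mulr_ge0.
Qed.

End ComplexParts.

Lemma ge0_le_eintegral (R : realType) (f g : R -> R) : (forall u, 0 <= f u) -> (forall u, f u <= g u) ->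
  measurable_fun setT f -> measurable_fun setT g ->
  (\int[@lebesgue_measure R]_u (f u)%:E <= \int[@lebesgue_measure R]_u (g u)%:E)%E.
Proof.
move=> f0 fg mf mg; apply: ge0_le_integral => //.
- by move=> u _; rewrite lee_fin.
- exact/measurable_EFinP.
- exact/measurable_EFinP.
- by move=> u _; rewrite lee_fin.
Qed.

Section Model.
Context {R : realType}.
Local Notation mu := (@lebesgue_measure R).
Local Notation Rintegrable D f := (mu.-integrable D (EFin \o f)).
Variables (L sg xi : R) (G phi : R -> R) (k : int) (rho : R -> R -> R[i]).
Hypotheses (sg0 : 0 < sg) (sol : mode_solution L sg G phi xi k rho).

Definition re (f : R -> R -> R[i]) (s u : R) : R := complex.Re (f s u).
Definition im (f : R -> R -> R[i]) (s u : R) : R := complex.Im (f s u).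
Definition dt (r : R -> R -> R) (s u : R) : R := derive1 (r ^~ u) s.
Definition du (r : R -> R -> R) (s u : R) : R := derive1 (r s) u.

Local Notation a := (2 * pi * k%:~R / L).
Definition coupling : R[i] := (derive1 G xi)%:C * phi_coef L phi k.

Lemma derivable_derive1 (f : R -> R) (x : R) : derivable f x 1 -> is_derive x 1 f (derive1 f x).
Proof. by move=> h; rewrite derive1E; exact: derivableP. Qed.

Lemma C12_re : C12 [set s | 0 < s] (re rho) (dt (re rho)) (du (re rho)) (du (du (re rho))).
Proof.
case: sol => _ _ hd hc _ s u s0.
have [[d1 _] [d2 _] [d3 _]] := hd s u s0; have [[c1 _] [c2 _] [c3 _]] := hc s u s0.
split.
- exact: (derivable_derive1 d1).
- exact: (derivable_derive1 d2).
- exact: (derivable_derive1 d3).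
- split.
  + exact: c1.
  + exact: c2.
  + exact: c3.
Qed.

Lemma C12_im : C12 [set s | 0 < s] (im rho) (dt (im rho)) (du (im rho)) (du (du (im rho))).
Proof.
case: sol => _ _ hd hc _ s u s0.
have [[_ d1] [_ d2] [_ d3]] := hd s u s0; have [[_ c1] [_ c2] [_ c3]] := hc s u s0.
split.
- exact: (derivable_derive1 d1).
- exact: (derivable_derive1 d2).
- exact: (derivable_derive1 d3).
- split.
  + exact: c1.
  + exact: c2.
  + exact: c3.
Qed.

Lemma wintegrable_of (r : R -> R) : Rintegrable setT r -> Rintegrable setT (fun u => u * r u) -> wintegrable r.
Proof.
move=> i1 i2; split => //.
have i3 := Rintegrable_add measurableT (Rintegrable_abs measurableT i1) (Rintegrable_abs measurableT i2).
apply: Rintegrable_le i3 => //.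
  apply: measurable_funM; last exact: (Rintegrable_meas measurableT i1).
  by apply: meas_cont => // u; suff : {for u, continuous (fun u : R => 1 + `|u|)} by []; cont.
by move=> u _; rewrite !normrM (ger0_norm (wgt_ge0 u)) mulrDl mul1r.
Qed.

Lemma wintegrable_re t : 0 <= t -> wintegrable (re rho t).
Proof.
case: sol => hi _ _ _ _ t0; have [[i1 _] [i2 _]] := hi t t0.
apply: wintegrable_of => //; move: i2; apply: eq_integrable => // u _ /=.
by rewrite Re_mul /= mul0r subr0.
Qed.

Lemma wintegrable_im t : 0 <= t -> wintegrable (im rho t).
Proof.
case: sol => hi _ _ _ _ t0; have [[_ i1] [_ i2]] := hi t t0.
apply: wintegrable_of => //; move: i2; apply: eq_integrable => // u _ /=.
by rewrite Im_mul /= mul0r addr0.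
Qed.

Lemma measurable_cabs (f g : R -> R) : measurable_fun setT f -> measurable_fun setT g ->
  measurable_fun setT (fun u => cabs (f u +i* g u)).
Proof.
move=> mf mg; rewrite /cabs /ComplexField.Normc.normc /=.
apply: (@measurable_comp _ _ _ _ _ _ setT) => //.
  by apply: measurable_funTS; apply: continuous_measurable_fun; exact: sqrt_continuous.
by apply: measurable_funD; apply: measurable_funX.
Qed.

(** Both parts are bounded by the modulus, so the convergence of the weighted
integral of the modulus transfers to them. *)
Lemma weighted_cont (t0 e : R) : 0 <= t0 -> 0 < e -> \forall t \near nbhs t0, 0 <= t ->
  wnorm (fun u => re rho t u - re rho t0 u) < e /\ wnorm (fun u => im rho t u - im rho t0 u) < e.
Proof.
move=> t00 e0; case: sol => _ hc _ _ _; have := hc t0 t00.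
move=> /fine_cvgP [h1 /cvgrPdist_lt /(_ e e0) h2].
pose D t := (\int[mu]_u ((1 + `|u|) * cabs (rho t u - rho t0 u))%:E)%E.
have {}h1 : \forall t \near nbhs t0, 0 <= t -> D t \is a fin_num := h1.
have {}h2 : \forall t \near nbhs t0, 0 <= t -> `|0 - fine (D t)| < e := h2.
apply: filterS2 h1 h2 => t h1 h2 t0'.
have {}h1 := h1 t0'; have {h2} := h2 t0'; rewrite sub0r normrN => h2.
have mr : measurable_fun setT (fun u => re rho t u - re rho t0 u).
  by apply: measurable_funB; apply: wintegrable_meas; exact: wintegrable_re.
have mi : measurable_fun setT (fun u => im rho t u - im rho t0 u).
  by apply: measurable_funB; apply: wintegrable_meas; exact: wintegrable_im.
have mw : measurable_fun setT (fun u : R => 1 + `|u|).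
  by apply: meas_cont => // u; suff : {for u, continuous (fun u : R => 1 + `|u|)} by []; cont.
have mc : measurable_fun setT (fun u : R => (1 + `|u|) * cabs (rho t u - rho t0 u)).
  apply: measurable_funM => //.
  rewrite (_ : (fun u => _) = fun u => cabs ((re rho t u - re rho t0 u) +i* (im rho t u - im rho t0 u))).
    exact: measurable_cabs.
  by apply/funext => u; rewrite /re /im; case: (rho t u) => x y; case: (rho t0 u).
have key (r : R -> R) : measurable_fun setT r -> (forall u, `|r u| <= cabs (rho t u - rho t0 u)) ->
    wnorm r < e.
  move=> mr' hr; apply: le_lt_trans (le_lt_trans (ler_norm _) h2).
  have D0 : (0 <= D t)%E by apply: integral_ge0 => u _; rewrite lee_fin mulr_ge0 ?wgt_ge0 ?cabs_ge0.
  have le : (\int[mu]_u ((1 + `|u|) * `|r u|)%:E <= D t)%E.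
    apply: ge0_le_eintegral => //.
    - by move=> u; rewrite ler_wpM2l ?wgt_ge0.
    - by apply: measurable_funM => //; apply: measurableT_comp.
  rewrite /wnorm /Rintegral fine_le//.
  rewrite ge0_fin_numE; last by apply: integral_ge0 => u _; rewrite lee_fin mulr_ge0 ?wgt_ge0.
  by apply: le_lt_trans le _; rewrite -ge0_fin_numE.
by split; apply: key => // u; rewrite /re /im -?Re_opp -?Im_opp -?Re_add -?Im_add ?cabs_Re ?cabs_Im.
Qed.

Lemma wcurve_re : wcurve (re rho).
Proof.
split; first exact: wintegrable_re.
move=> s0 h0 e e0; apply: filterS (weighted_cont h0 e0) => t h t0.
by have [] := h t0.
Qed.

Lemma wcurve_im : wcurve (im rho).
Proof.
split; first exact: wintegrable_im.
move=> s0 h0 e e0; apply: filterS (weighted_cont h0 e0) => t h t0.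
by have [] := h t0.
Qed.

Lemma drift_derive (f : R -> R) (u : R) : derivable f u 1 ->
  derive1 (fun v => (xi - v) * f v) u = (xi - u) * derive1 f u - f u.
Proof.
move=> /derivable_derive1 h; have hd : is_derive u 1 (fun v => (xi - v) * f v) ((xi - u) * derive1 f u - f u).
  by deriv; ring.
by rewrite [LHS]derive1E; have [_ ->] := hd.
Qed.

Lemma mode_moment s : cintegral setT (fun v => v%:C * rho s v) =
  moment (re rho) s +i* moment (im rho) s.
Proof.
rewrite /cintegral /moment; congr (_ +i* _); apply: Rint_eq => u _.
  by rewrite Re_mul /= mul0r subr0.
by rewrite Im_mul /= mul0r addr0.
Qed.

(** The transport term [i a u] exchanges the real and imaginary parts. *)
Lemma mode_equation_parts s u : 0 < s ->
  dt (re rho) s u = - (a * u * im rho s u)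
    + gen_fwd xi (sg ^+ 2 / 2) (re rho s) (du (re rho) s) (du (du (re rho)) s) u
    - (complex.Re coupling * moment (re rho) s - complex.Im coupling * moment (im rho) s) * dgauss sg xi u
  /\ dt (im rho) s u = a * u * re rho s u
    + gen_fwd xi (sg ^+ 2 / 2) (im rho s) (du (im rho) s) (du (du (im rho)) s) u
    - (complex.Re coupling * moment (im rho) s + complex.Im coupling * moment (re rho) s) * dgauss sg xi u.
Proof.
move=> s0; case: sol => _ _ hd _ /(_ s u s0); rewrite /mode_equation mode_moment -/coupling.
have [_ [dr di] _] := hd s u s0.
have -> : derive1 (F_ sg xi) u = dgauss sg xi u.
  by rewrite derive1E; have [_ ->] := is_derive_gauss xi sg0 u.
have -> : cderive (fun v => (xi - v)%:C * rho s v) u =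
   ((xi - u) * du (re rho) s u - re rho s u) +i* ((xi - u) * du (im rho) s u - im rho s u).
  rewrite /cderive; congr (_ +i* _).
    rewrite (_ : (fun y => _) = fun v => (xi - v) * re rho s v); first exact: drift_derive.
    by apply/funext => v; rewrite Re_mul /= mul0r subr0.
  rewrite (_ : (fun y => _) = fun v => (xi - v) * im rho s v); first exact: drift_derive.
  by apply/funext => v; rewrite Im_mul /= mul0r addr0.
move=> e; split.
  have := congr1 (@complex.Re R) e.
  rewrite !(Re_add, Re_opp, Re_mul, Im_mul) /= => eR.
  rewrite /dt /re in eR *; rewrite eR /gen_fwd /du /re /im.
  by ring.
have := congr1 (@complex.Im R) e.
rewrite !(Im_add, Im_opp, Re_mul, Im_mul) /= => eI.
rewrite /dt /im in eI *; rewrite eI /gen_fwd /du /re /im.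
by ring.
Qed.

End Model.

(** * Norms of the Fourier transform of a mode *)

Section Stability.
Context {R : realType}.
Local Notation mu := (@lebesgue_measure R).
Local Notation Rintegrable D f := (mu.-integrable D (EFin \o f)).

Lemma cLnorm1E (f : R -> R[i]) : cLnorm 1 f = (\int[mu]_x (cabs (f x))%:E)%E.
Proof.
rewrite /cLnorm Lnorm1; apply: eq_integral => x _.
by rewrite gee0_abs// lee_fin cabs_ge0.
Qed.

Lemma cLnormy_le (f : R -> R[i]) (C : R) : (forall x, cabs (f x) <= C) ->
  (cLnorm +oo f <= C%:E)%E.
Proof.
move=> h; have C0 : 0 <= C := le_trans (cabs_ge0 _) (h 0).
rewrite /cLnorm unlock; case: ifPn => _; last by rewrite lee_fin.
by apply/ess_supP; apply/aeW => x /=; rewrite lee_fin ger0_norm ?cabs_ge0.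
Qed.

Lemma affine_substitution (f : R -> R) (l c : R) : 0 < l -> continuous f -> (forall x, 0 <= f x) ->
  (\int[mu]_x (l * f (l * x + c))%:E = \int[mu]_x (f x)%:E)%E.
Proof.
move=> l0 cf f0; pose F (x : R) := l * x + c.
have dF (x : R) : is_derive x 1 F l by rewrite /F; deriv; ring.
have F'E : derive1 F = fun=> l.
  by apply/funext => x; rewrite derive1E; have [_ ->] := dF x.
rewrite (@increasing_ge0_integration_by_substitutionT _ F f)//.
- by apply: eq_integral => x _; congr EFin; rewrite [RHS]mulrC F'E.
- by move=> x y xy; rewrite /F ltrD2r ltr_pM2l.
- by rewrite F'E => x; exact: cst_continuous.
- by rewrite F'E; exact: is_cvg_cst.
- by rewrite F'E; exact: is_cvg_cst.
- apply/cvgrNyPle => M; apply: filterS (nbhs_ninfty_le (num_real ((M - c) / l))) => x.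
  by rewrite ler_pdivlMr// /F lerBrDr mulrC.
- apply/cvgryPge => M; apply: filterS (nbhs_pinfty_ge (num_real ((M - c) / l))) => x.
  by rewrite ler_pdivrMr// /F lerBlDr mulrC.
Qed.

Section Mode.
Variables (L sg xi : R) (G phi : R -> R) (k : int) (rho : R -> R -> R[i]).
Hypotheses (sg0 : 0 < sg) (sol : mode_solution L sg G phi xi k rho).
Local Notation r1 := (re rho).
Local Notation r2 := (im rho).
Local Notation a := (2 * pi * k%:~R / L).
Hypotheses (a0 : a != 0) (c1 : cabs (coupling L xi G phi k) < 1).
Local Notation A := (sg ^+ 2 * a ^+ 2 / 2).
Hypotheses (A1 : 1 <= A) (small : pi / (sg * `|a| / 2) + `|xi * a| / A <= 8^-1).

Lemma fourier_re t (eta : R) : 0 <= t -> complex.Re (fourier (rho t) eta) = fpart r1 r2 t 0 eta.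
Proof.
move=> t0; rewrite /fourier /cintegral /fpart /=.
rewrite -Rint_sub//; [|exact/Rintegrable_cos/(wintegrable_re sol)|exact/Rintegrable_cos/(wintegrable_im sol)].
apply: Rint_eq => u _; rewrite Re_mul /= cosN sinN add0r addr0 cosDpihalf.
by rewrite /re /im; ring.
Qed.

Lemma fourier_im t (eta : R) : 0 <= t -> complex.Im (fourier (rho t) eta) = fpart r1 r2 t (pi / 2) eta.
Proof.
move=> t0; rewrite /fourier /cintegral /fpart /=.
rewrite -Rint_sub//; [|exact/Rintegrable_cos/(wintegrable_re sol)|exact/Rintegrable_cos/(wintegrable_im sol)].
apply: Rint_eq => u _; rewrite Im_mul /= cosN sinN addrA !cosDpihalf sinDpihalf.
by rewrite /re /im; ring.
Qed.

Lemma cderive_fourier t (eta : R) : 0 <= t -> cderive (fourier (rho t)) eta =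
  pairing a xi sg r1 r2 t (eta + a) 0 1 (0 + pi / 2) t +i*
  pairing a xi sg r1 r2 t (eta + a) 0 1 (pi / 2 + pi / 2) t.
Proof.
move=> t0; rewrite /cderive; congr (_ +i* _).
  rewrite (_ : (fun y => _) = fpart r1 r2 t 0); last by apply/funext => y; exact: fourier_re.
  rewrite derive1E.
  by have [_ ->] := is_derive_fpart a xi sg (wcurve_re sol) (wcurve_im sol) 0 eta t0.
rewrite (_ : (fun y => _) = fpart r1 r2 t (pi / 2)); last by apply/funext => y; exact: fourier_im.
rewrite derive1E.
by have [_ ->] := is_derive_fpart a xi sg (wcurve_re sol) (wcurve_im sol) (pi / 2) eta t0.
Qed.

Lemma cont_cabs_fourier t : 0 <= t -> continuous (fun eta => cabs (fourier (rho t) eta)).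
Proof.
move=> t0 eta.
have -> : (fun eta => cabs (fourier (rho t) eta)) =
    fun eta => Num.sqrt (fpart r1 r2 t 0 eta ^+ 2 + fpart r1 r2 t (pi / 2) eta ^+ 2).
  apply/funext => y; rewrite -fourier_re// -fourier_im//.
have c0 : {for eta, continuous (fpart r1 r2 t 0)}.
  exact: deriv_cont (is_derive_fpart a xi sg (wcurve_re sol) (wcurve_im sol) 0 eta t0).
have c2 : {for eta, continuous (fpart r1 r2 t (pi / 2))}.
  exact: deriv_cont (is_derive_fpart a xi sg (wcurve_re sol) (wcurve_im sol) (pi / 2) eta t0).
suff : {for eta, continuous (fun eta => Num.sqrt (fpart r1 r2 t 0 eta ^+ 2 + fpart r1 r2 t (pi / 2) eta ^+ 2))} by [].
by apply: cont_comp; [exact: sqrt_continuous|cont].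
Qed.

(** The two supremum norms are bounded pointwise.  For the [L^1] norm, the initial
datum is integrated by the affine substitution [eta |-> q] and the response by
the Gaussian envelope. *)
Lemma mode_norm_bounded : (mode_norm (rho 0) < +oo)%E ->
  exists B : R, forall t, 0 <= t -> (mode_norm (rho t) <= B%:E)%E.
Proof.
move=> fin0.
have hc : `|complex.Re (coupling L xi G phi k)| <= 1 by rewrite (le_trans (cabs_Re _))// ltW.
have hi : `|complex.Im (coupling L xi G phi k)| <= 1 by rewrite (le_trans (cabs_Im _))// ltW.
have [C C0 hC] := fpart_bound sg0 a0 hc hi (wcurve_re sol) (wcurve_im sol)
  (C12_re sol) (C12_im sol) (fun s u s0 => (mode_equation_parts sg0 sol u s0).1)
  (fun s u s0 => (mode_equation_parts sg0 sol u s0).2) small A1.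
pose N0 := (\int[mu]_x (cabs (fourier (rho 0) x))%:E)%E.
have N0fin : N0 \is a fin_num.
  rewrite ge0_fin_numE; last by apply: integral_ge0 => x _; rewrite lee_fin cabs_ge0.
  rewrite /N0 -cLnorm1E; apply: le_lt_trans fin0; rewrite /mode_norm -addeA leeDl//.
  by rewrite adde_ge0// Lnorm_ge0.
pose K := expR (2 * A).
have K0 : 0 <= K by exact: expR_ge0.
have s4 : 0 < 4 / sg by rewrite divr_gt0.
pose env := wide_gauss (4 / sg) 0.
have ienv : Rintegrable setT env by exact: Rintegrable_wide.
have env0 x : 0 <= env x by exact: expR_ge0.
have cenv : continuous env.
  move=> x; suff : {for x, continuous (fun u : R => expR (- ((u - 0) ^+ 2 / (2 * (4 / sg) ^+ 2))))} by [].
  by cont.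
exists (4 * K * fine N0 + 2 * C * fine (\int[mu]_x (env x)%:E)%E + 2 * C + 2 * C) => t t0.
have bnd eta : cabs (fourier (rho t) eta) <= 4 * K * (expR (- t) * cabs (fourier (rho 0) (expR (- t) * eta + (a * expR (- t) - a)))) + 2 * C * env eta.
  have -> : expR (- t) * eta + (a * expR (- t) - a) = (eta + a) * expR (- t) - a by ring.
  set q := (eta + a) * expR (- t) - a.
  apply: le_trans (cabs_le _) _; rewrite fourier_re// fourier_im//.
  have [b1 _ _] := hC t 0 eta t0; have [b2 _ _] := hC t (pi / 2) eta t0.
  apply: le_trans (lerD b1 b2) _; rewrite -/q -/K -/(env eta).
  have e1 : `|fpart r1 r2 0 0 q| <= cabs (fourier (rho 0) q) by rewrite -fourier_re// cabs_Re.
  have e2 : `|fpart r1 r2 0 (pi / 2) q| <= cabs (fourier (rho 0) q) by rewrite -fourier_im// cabs_Im.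
  have e3 : K * (expR (- t) * (`|fpart r1 r2 0 0 q| + `|fpart r1 r2 0 (pi / 2) q|)) <=
      K * (expR (- t) * (2 * cabs (fourier (rho 0) q))).
    apply: ler_wpM2l => //; apply: ler_wpM2l; first exact: expR_ge0.
    by move: e1 e2; lra.
  by move: e3; lra.
apply: (@le_trans _ _ ((4 * K * fine N0 + 2 * C * fine (\int[mu]_x (env x)%:E)%E)%:E + (2 * C)%:E + (2 * C)%:E)%E); last first.
  by rewrite -!EFinD.
apply: leeD; last first.
  apply: cLnormy_le => eta; rewrite cderive_fourier//.
  apply: le_trans (cabs_le _) _ => /=.
  have [_ _ b1] := hC t (0 + pi / 2) eta t0; have [_ _ b2] := hC t (pi / 2 + pi / 2) eta t0.
  by move: b1 b2; lra.
apply: leeD; last first.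
  apply: cLnormy_le => eta.
  apply: le_trans (cabs_le _) _; rewrite fourier_re// fourier_im//.
  have [_ b1 _] := hC t 0 eta t0; have [_ b2 _] := hC t (pi / 2) eta t0.
  by move: b1 b2; lra.
rewrite cLnorm1E.
have cf := cont_cabs_fourier t0; have cf0 := cont_cabs_fourier (lexx 0).
pose g x := expR (- t) * cabs (fourier (rho 0) (expR (- t) * x + (a * expR (- t) - a))).
have g0 x : 0 <= g x by rewrite /g mulr_ge0 ?expR_ge0 ?cabs_ge0.
have cg : continuous g.
  move=> x; suff : {for x, continuous (fun x : R => expR (- t) * cabs (fourier (rho 0) (expR (- t) * x + (a * expR (- t) - a))))} by [].
  apply: cont_mul; first exact: cont_cst.
  apply: (@cont_comp _ _ (fun x => cabs (fourier (rho 0) x))) => //.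
  by cont.
have mg : measurable_fun setT g by exact: meas_cont.
have menv : measurable_fun setT env by exact: meas_cont.
apply: le_trans (ge0_le_eintegral (fun u => cabs_ge0 _) bnd _ _) _.
- exact: meas_cont.
- by apply: measurable_funD; apply: measurable_funM => //; exact: measurable_cst.
rewrite (_ : (\int[mu]_x _)%E = ((4 * K)%:E * N0 + (2 * C)%:E * \int[mu]_x (env x)%:E)%E).
  have e0 : (0 <= \int[mu]_x (env x)%:E)%E by apply: integral_ge0 => x _; rewrite lee_fin.
  have fe : (\int[mu]_x (env x)%:E)%E \is a fin_num by exact: integrable_fin_num.
  by rewrite EFinD !EFinM !fineK// -!EFinM.
have -> : N0 = (\int[mu]_x (g x)%:E)%E.
  rewrite /N0 -(@affine_substitution (fun x => cabs (fourier (rho 0) x)) (expR (- t)) (a * expR (- t) - a))//.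
  - exact: expR_gt0.
  - by move=> x; exact: cabs_ge0.
rewrite -!ge0_integralZl_EFin//.
- rewrite -ge0_integralD//.
  + by move=> x _; rewrite -EFinM lee_fin mulr_ge0// mulr_ge0.
  + by apply/measurable_EFinP; apply: measurable_funM => //; exact: measurable_cst.
  + by move=> x _; rewrite -EFinM lee_fin mulr_ge0// mulr_ge0.
  + by apply/measurable_EFinP; apply: measurable_funM => //; exact: measurable_cst.
- by move=> x _; rewrite lee_fin.
- exact/measurable_EFinP.
- by rewrite mulr_ge0.
- by move=> x _; rewrite lee_fin.
- exact/measurable_EFinP.
- by rewrite mulr_ge0.
Qed.

End Mode.
End Stability.

(** * A threshold for all modes *)

(** Since [|k| >= 1], the frequency satisfies [|a| L >= 2 pi], so that
[sg |a| >= 16 pi (1 + |xi|)]. *)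
Lemma noise_threshold (R : realType) (L xi sg : R) (k : int) : 0 < L -> k != 0 ->
  1 + 8 * L * (1 + `|xi|) < sg ->
  let a := 2 * pi * k%:~R / L in
  [/\ a != 0, 1 <= sg ^+ 2 * a ^+ 2 / 2 &
      pi / (sg * `|a| / 2) + `|xi * a| / (sg ^+ 2 * a ^+ 2 / 2) <= 8^-1].
Proof.
move=> L0 k0 hs a.
have p2 : 2 <= pi :> R by exact: pi_ge2.
have Ln : L != 0 by rewrite gt_eqF.
have k1 : 1 <= `|k%:~R : R| by rewrite -intr_norm ler1z; move: k0; case: k @a => [[|n]|n].
have x0 := normr_ge0 xi; set x := `|xi| in hs x0 *.
have Lx : 0 <= L * x by rewrite mulr_ge0// ltW.
have s1 : 1 <= sg by move: hs; nra.
have sg0 : 0 < sg by lra.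
pose y := `|a|.
have ya : a ^+ 2 = y ^+ 2 by rewrite /y real_normK// num_real.
have yL : 2 * pi <= y * L.
  rewrite /y /a !normrM normfV (gtr0_norm L0) divfK// (ger0_norm (_ : 0 <= 2))// (ger0_norm (pi_ge0 R)).
  by rewrite ler_peMr// mulr_ge0// pi_ge0.
have y0 : 0 < y by rewrite -(pmulr_lgt0 _ L0); lra.
have a0 : a != 0 by rewrite -normr_gt0.
have sL : 8 * L * (1 + x) <= sg by lra.
have x1 : 0 < 1 + x by lra.
have sy : 16 * pi * (1 + x) <= sg * y.
  apply: le_trans (_ : 8 * L * (1 + x) * y <= _); last by rewrite ler_pM2r.
  have : 0 <= (1 + x) * (y * L - 2 * pi) by rewrite mulr_ge0//; lra.
  by nra.
have z16 : 16 <= sg * y by apply: le_trans sy; nra.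
split => //.
  by rewrite ya -exprMn; move: z16; set z := sg * y; nra.
have z0 : 0 < sg * y by lra.
have xn : 1 + x != 0 by rewrite gt_eqF.
have sgn : sg != 0 by rewrite gt_eqF.
have yn : y != 0 by rewrite gt_eqF.
have h1 : pi / (sg * y / 2) <= (8 * (1 + x))^-1.
  rewrite ler_pdivrMr; last by lra.
  rewrite mulrC ler_pdivlMr; last by rewrite mulr_gt0.
  by move: sy; nra.
have h2 : x * y / (sg ^+ 2 * a ^+ 2 / 2) <= x * (8 * (1 + x))^-1.
  rewrite ya (_ : x * y / _ = x * (2 / (sg * (sg * y)))); last by field; rewrite sgn yn.
  apply: ler_wpM2l => //; rewrite ler_pdivrMr; last by rewrite mulr_gt0.
  rewrite mulrC ler_pdivlMr; last by rewrite mulr_gt0.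
  apply: le_trans (_ : sg * y <= _); last by rewrite ler_peMl// ltW.
  by apply: le_trans sy; rewrite mulrA ler_pM2r//; lra.
rewrite (normrM xi) -/x -/y.
apply: le_trans (lerD h1 h2) _.
by rewrite (_ : _ + _ = 8^-1)//; field.
Qed.

Theorem proposition3 (R : realType) (L : R) (G phi : R -> R) (xi : R)
    (L_gt0 : 0 < L)
    (G_odd : forall x, G (- x) = - G x)
    (G_smooth : smooth G)
    (phi_influence : influence_function L phi)
    (xi_fixed : xi = G xi)
    (coupling_lt1 : forall k : int, k != 0 ->
       cabs ((derive1 G xi)%:C * phi_coef L phi k) < 1) :
  exists sigma0 : R, 0 < sigma0 /\
    forall sigma : R, sigma0 < sigma ->
      forall k : int, k != 0 -> mode_stable L sigma G phi xi k.
Proof.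
have t0 : 0 < 1 + 8 * L * (1 + `|xi|).
  by rewrite ltr_pwDl// mulr_ge0 ?wgt_ge0// mulr_ge0// ltW.
exists (1 + 8 * L * (1 + `|xi|)); split=> // sg hs k k0 rho sol fin0.
have sg0 : 0 < sg := lt_trans t0 hs.
have [a0 A1 small] := noise_threshold L_gt0 k0 hs.
have [B hB] := mode_norm_bounded sg0 sol a0 (coupling_lt1 k k0) A1 small fin0.
apply: (@le_lt_trans _ _ B%:E); last exact: ltry.
by apply: ge_ereal_sup => _ [t /= t_ge0 <-]; exact: hB.
Qed.
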